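(* Let $\mathbb K=\mathbb R$ or $\mathbb C$, let $f=(f^1,\dots,f^p):\mathbb K^n\to\mathbb K^p$ be a real polynomial map (if $\mathbb K=\mathbb R$) or a mixed polynomial map (if $\mathbb K=\mathbb C$), and let $F:\mathbb K^n\times\mathbb K\to\mathbb K^p$ be a deformation of $f$. Suppose there are $C$-face diagrams $D_1,\dots,D_p$ in $\mathbb R^n$ such that: (i) $f$ is IKND (resp. SIKND) with respect to $D_1,\dots,D_p$; (ii) for each $j=1,\dots,p$ and each $\varepsilon\in\mathbb K$, $d(w;F^j_\varepsilon-f^j)\ge d(w;D_j)$ for all $w\in\mathcal P(D_j)$. Then there is a neighborhood $T\subset\mathbb K$ of the origin such that $F$ has weak no coalescing of critical points (resp. no coalescing of critical points) along $T$. If the inequalities in (ii) are all strict, then $F$ has weak no coalescing of critical points (resp. no coalescing of critical points).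
   Context: Notation. $[n]=\{1,\dots,n\}$. A real polynomial map $f:\mathbb R^n\to\mathbb R^p$ has real polynomial components and $f(0)=0$. A mixed polynomial map $f:\mathbb C^n\to\mathbb C^p$ has components that are finite sums $\sum c_{\nu,\mu}x^\nu\bar x^\mu$, $c_{\nu,\mu}\in\mathbb C$, and $f(0)=0$. For a component $g$, $\mathrm{supp}(g)=\{\nu: c_\nu\ne0\}$ in the real case and $\mathrm{supp}(g)=\{\nu+\mu: c_{\nu,\mu}\neq0\}$ in the mixed case. For $A\subset\mathbb R^n$, $g_A$ is the sum of the terms of $g$ whose exponent $\nu$ (resp. $\nu+\mu$) lies in $A$. For $w\in(\mathbb Q_{>0})^n$, $d(w;g)=\min\{\langle w,\nu\rangle:\nu\in\mathrm{supp}(g)\}$ ($+\infty$ if $g=0$). $V(f)=f^{-1}(0)$; $\Sigma(f)$ is the set of points where the real Jacobian matrix of $f$ has rank $<p$ if $\mathbb K=\mathbb R$, and rank $<2p$ if $\mathbb K=\mathbb C$ (identifying $\mathbb C=\mathbb R^2$). For $I\subset[n]$, $\mathbb K^I=\{x\in\mathbb K^n:x_i=0\ \forall i\notin I\}$ and $(\mathbb K^* )^I=\{x\in\mathbb K^I:x_i\ne0\ \forall i\in I\}$. $C$-face diagrams. A $C$-face diagram is a set $D=D(J)=\{\nu\in(\mathbb R_{\ge0})^n:\min_{\ell\in J}\ell(\nu)=1\}$, with $J$ a nonempty finite set of linear forms with positive rational coefficients. For $w\in(\mathbb Q_{>0})^n$, $d(w;D)=\min_{\nu\in D}\langle w,\nu\rangle$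 and $\Delta(w;D)$ is the subset of $D$ where this minimum is attained. $\mathcal P(D)=\{w_1,\dots,w_N\}\subset(\mathbb Q_{>0})^n$ consists of one weight vector for each $(n-1)$-dimensional face $\Delta(w_i;D)$ of $D$, and $D$ is the union of these faces. A face of $D$ is a nonempty set $\Delta=\{\nu\in D:\nu_i=0\ (i\notin I_\Delta),\ \ell(\nu)=1\ (\ell\in J_\Delta)\}$ with $I_\Delta\subset[n]$, $\emptyset\ne J_\Delta\subset J$; it is inner if it is not contained in any proper coordinate subspace. For $C$-face diagrams $D_1,\dots,D_p$, $D=D_1+\dots+D_p$ denotes the union of the compact faces of the Minkowski sum of the polyhedra $D_j+(\mathbb R_{\ge0})^n$; it is again a $C$-face diagram, and each face $\Delta$ of $D$ decomposes uniquely as a Minkowski sum $\Delta=\Delta_1+\dots+\Delta_p$ with $\Delta_j$ a face of $D_j$. Put $f_\Delta=(f^1_{\Delta_1},\dots,f^p_{\Delta_p})$. IKND/SIKND. $f$ is IKND with respect to $D_1,\dots,D_p$ if (a) $d(w;f^j)\ge d(w;D_j)$ for all $j$ and $w\in\mathcal P(D_j)$; and (b) for every inner face $\Delta$ of $D=D_1+\dots+D_p$ and every nonempty $I\subset[n]$ with $\Delta\cap\mathbb R^I\neq\emptyset$, $\Sigma(f_\Delta)\cap V(f_\Delta)\cap(\mathbb K^* )^I=\emptyset$. It is SIKND with respect to $D_1,\dots,D_p$ if moreover $\Sigma(f_\Delta)\cap(\mathbb K^* )^I=\emptyset$ for all such $\Delta,I$. Deformations. A deformation of $f$ is a map $F:\mathbb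 K^n\times\mathbb K\to\mathbb K^p$, $F_\varepsilon(x)=F(x,\varepsilon)$, with $F_0=f$, $F_\varepsilon(0)=0$ for all $\varepsilon$, each $F_\varepsilon$ being a real (resp. mixed) polynomial map with coefficients depending real-analytically on $\varepsilon$. For a connected set $T\subset\mathbb K$ containing $0$, $F$ has no coalescing (resp. weak no coalescing) of critical points along $T$ if there is $\epsilon>0$ such that $\Sigma(F_\varepsilon)\cap B_\epsilon(0)\subseteq\{0\}$ (resp. $\Sigma(F_\varepsilon)\cap V(F_\varepsilon)\cap B_\epsilon(0)\subseteq\{0\}$) for all $\varepsilon\in T$. $F$ has (weak) no coalescing of critical points if this holds along every compact connected $T\subset\mathbb K$ containing $0$. *)

(* Defs.v *)
From HB Require Import structures.
From mathcomp Require Import all_boot all_order all_algebra.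
From mathcomp Require Import complex.
From mathcomp Require Import all_classical all_reals all_analysis.
From mathcomp Require Import -(notations) mpoly.

Set Implicit Arguments.
Unset Strict Implicit.
Unset Printing Implicit Defensive.

Import Order.TTheory GRing.Theory Num.Theory.
Import numFieldNormedType.Exports.

Local Open Scope classical_set_scope.
Local Open Scope ring_scope.

Section FaceDiagrams.
Variables (R : realType) (n : nat).
Implicit Types (w l : 'rV[rat]_n) (J : seq 'rV[rat]_n) (nu : 'rV[R]_n).
Implicit Types (D S E Q Delta : set 'rV[R]_n) (P : set 'rV[rat]_n).

Definition dot (u nu : 'rV[R]_n) : R := \sum_i u 0 i * nu 0 i.

(* Weight vectors and linear forms are both given by rational row vectors. *)
Definition pairing w nu : R := dot (map_mx ratr w) nu.

Definition positive_form w : Prop := forall i, 0 < w 0 i.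

Definition orthant : set 'rV[R]_n := [set nu | forall i, 0 <= nu 0 i].

Definition coord_subspace (I : {set 'I_n}) : set 'rV[R]_n :=
  [set nu | forall i, i \notin I -> nu 0 i = 0].

(* D(J): the last two conditions spell out min_(l in J) l(nu) = 1. *)
Definition diagram J : set 'rV[R]_n :=
  [set nu | [/\ orthant nu, forall l, l \in J -> 1 <= pairing l nu
              & exists2 l, l \in J & pairing l nu = 1]].

Definition presents J D : Prop :=
  [/\ J != [::], forall l, l \in J -> positive_form l & D = diagram J].

Definition Cface_diagram D : Prop := exists J, presents J D.

(* The sets obtained do not depend on the choice of the presentation J. *)
Definition is_face D Delta : Prop :=
  exists J (I : {set 'I_n}) (J' : seq 'rV[rat]_n),
    [/\ presents J D, J' != [::], {subset J' <= J}, Delta !=set0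
      & Delta = [set nu | [/\ D nu, coord_subspace I nu
                            & forall l, l \in J' -> pairing l nu = 1]]].

Definition inner Delta : Prop :=
  forall I : {set 'I_n}, I \proper [set: 'I_n] ->
    ~ (Delta `<=` coord_subspace I).

(* d(w; S); it is +oo on the empty set, and the infimum is attained when S is
   finite and nonempty or is a C-face diagram. *)
Definition wdeg w S : \bar R := ereal_inf [set (pairing w nu)%:E | nu in S].

(* Delta(w; D) *)
Definition wface w D : set 'rV[R]_n :=
  [set nu | D nu /\ (pairing w nu)%:E = wdeg w D].

Definition contains_simplex S (d : nat) : Prop :=
  exists x0 (M : 'M[R]_(d, n)),
    [/\ S x0, forall i, S (x0 + row i M) & row_free M].

Definition affine_dim S (d : nat) : Prop :=
  contains_simplex S d /\ ~ contains_simplex S d.+1.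

Definition facet D Delta : Prop := is_face D Delta /\ affine_dim Delta n.-1.

(* P is an admissible choice of P(D): one weight vector per facet, which is
   unique up to positive scaling. *)
Definition weight_system D P : Prop :=
  (forall w, P w -> positive_form w /\ facet D (wface w D)) /\
  (forall Delta, facet D Delta -> exists! w, P w /\ wface w D = Delta).

Definition polyhedron_face Q E : Prop :=
  E !=set0 /\
  exists u : 'rV[R]_n,
    E = [set x | Q x /\ forall y, Q y -> dot u x <= dot u y].

Definition msum (p : nat) (S : 'I_p -> set 'rV[R]_n) : set 'rV[R]_n :=
  [set x | exists2 y : 'I_p -> 'rV[R]_n, (forall j, S j (y j)) & x = \sum_j y j].

(* D_1 + ... + D_p *)
Definition diagram_sum (p : nat) (D : 'I_p -> set 'rV[R]_n) : set 'rV[R]_n :=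
  let Q := msum (fun j => [set nu + u | nu in D j & u in orthant]) in
  [set x | exists E, [/\ polyhedron_face Q E, compact E & E x]].

(* Delta is an inner face of D_1 + ... + D_p, and Delta = Delta_1 + ... +
   Delta_p is its decomposition, which exists and is unique. *)
Definition inner_face_decomposition (p : nat) (D : 'I_p -> set 'rV[R]_n)
    Delta (Deltas : 'I_p -> set 'rV[R]_n) : Prop :=
  [/\ is_face (diagram_sum D) Delta, inner Delta,
      forall j, is_face (D j) (Deltas j) & Delta = msum Deltas].

End FaceDiagrams.

Variant ground := RealK | ComplexK.

Definition ground_field (R : realType) (k : ground) : numFieldType :=
  match k with RealK => R | ComplexK => R[i] end.

(* Both the real dimension of K^n and the number of formal variables of a
   polynomial function on K^n: x_1, ..., x_n when K = R, and x_1, ..., x_n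
   followed by their conjugates when K = C. *)
Definition rdim (k : ground) (n : nat) : nat :=
  match k with RealK => n | ComplexK => (n + n)%N end.

Definition formal_point (R : realType) (k : ground) (n : nat) :
    'rV[ground_field R k]_n -> 'I_(rdim k n) -> ground_field R k :=
  match k return 'rV[ground_field R k]_n -> 'I_(rdim k n) -> ground_field R k with
  | RealK => fun x i => x 0 i
  | ComplexK => fun x i =>
      match @fintype.split n n i with inl a => x 0 a | inr a => conjc (x 0 a) end
  end.

(* nu for the monomial x^nu when K = R, and nu + mu for the mixed monomial with
   exponents nu in x and mu in the conjugate of x when K = C. *)
Definition exponent (R : realType) (k : ground) (n : nat) :
    multinom (rdim k n) -> 'rV[R]_n :=
  match k return multinom (rdim k n) -> 'rV[R]_n with
  | RealK => fun m => \row_i (m i)%:R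
  | ComplexK => fun m => \row_i (m (lshift n i) + m (rshift n i))%N%:R
  end.

Definition to_real (R : realType) (k : ground) (n : nat) :
    'rV[ground_field R k]_n -> 'rV[R]_(rdim k n) :=
  match k return 'rV[ground_field R k]_n -> 'rV[R]_(rdim k n) with
  | RealK => fun x => x
  | ComplexK => fun x => row_mx (map_mx (@complex.Re R) x)
                                (map_mx (@complex.Im R) x)
  end.

Definition of_real (R : realType) (k : ground) (n : nat) :
    'rV[R]_(rdim k n) -> 'rV[ground_field R k]_n :=
  match k return 'rV[R]_(rdim k n) -> 'rV[ground_field R k]_n with
  | RealK => fun u => u
  | ComplexK => fun u => \row_i Complex (lsubmx u 0 i) (rsubmx u 0 i)
  end.

Section PolynomialMaps.
Variables (R : realType) (k : ground) (n p : nat).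
Local Notation K := (ground_field R k).

(* Real (K = R) or mixed (K = C) polynomial maps K^n -> K^p, without the
   normalization f(0) = 0. *)
Definition poly_map : Type := 'I_p -> mpoly (rdim k n) K.

Definition peval (f : poly_map) (x : 'rV[K]_n) : 'rV[K]_p :=
  \row_j meval (formal_point x) (f j).

Definition supp (g : mpoly (rdim k n) K) : set 'rV[R]_n :=
  [set exponent R m | m in [set m | m \in msupp g]].

Definition truncation (g : mpoly (rdim k n) K) (A : set 'rV[R]_n) :
    mpoly (rdim k n) K :=
  \sum_(m <- msupp g | `[< A (exponent R m) >]) mcoeff m g *: mpolyX K m.

Definition zero_locus (f : poly_map) : set 'rV[K]_n := [set x | peval f x = 0].

(* The library's jacobian is the transpose of the usual one. *)
Definition singular_locus (f : poly_map) : set 'rV[K]_n :=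
  [set x | (\rank (jacobian (@to_real R k p \o peval f \o @of_real R k n)
                            (to_real x)) < rdim k p)%N].

Definition torus (I : {set 'I_n}) : set 'rV[K]_n :=
  [set x | forall i, (x 0 i != 0) = (i \in I)].

Definition euclidean_ball (e : R) : set 'rV[K]_n :=
  [set x | \sum_i to_real x 0 i ^+ 2 < e ^+ 2].

Section Nondegeneracy.
Variables (f : poly_map).
Variables (D : 'I_p -> set 'rV[R]_n) (P : 'I_p -> set 'rV[rat]_n).

Definition face_map (Deltas : 'I_p -> set 'rV[R]_n) : poly_map :=
  fun j => truncation (f j) (Deltas j).

Definition IKND : Prop :=
  (forall j w, P j w -> (wdeg w (D j) <= wdeg w (supp (f j)))%E) /\
  (forall Delta Deltas (I : {set 'I_n}),
     inner_face_decomposition D Delta Deltas -> I != finset.set0 ->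
     Delta `&` coord_subspace I !=set0 ->
     singular_locus (face_map Deltas) `&` zero_locus (face_map Deltas)
       `&` torus I = set0).

Definition SIKND : Prop :=
  IKND /\
  (forall Delta Deltas (I : {set 'I_n}),
     inner_face_decomposition D Delta Deltas -> I != finset.set0 ->
     Delta `&` coord_subspace I !=set0 ->
     singular_locus (face_map Deltas) `&` torus I = set0).

End Nondegeneracy.
End PolynomialMaps.

Definition real_analytic_R (R : realType) (g : R -> R) : Prop :=
  forall a : R, exists c : nat -> R, \forall t \near a,
    (fun N => \sum_(i < N) c i * (t - a) ^+ i) @ \oo --> g t.

(* Real-analyticity in the two real variables Re z and Im z: g is near each
   point the sum of an absolutely convergent double power series. *)
Definition real_analytic_C (C : numClosedFieldType) (g : C -> C) : Prop :=
  forall a : C, exists c : nat -> nat -> C, \forall z \near a,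
    let t i j := c i j * 'Re (z - a) ^+ i * 'Im (z - a) ^+ j in
    (exists M, forall N, \sum_(i < N) \sum_(j < N) `|t i j| <= M) /\
    (fun N => \sum_(i < N) \sum_(j < N) t i j) @ \oo --> g z.

Definition real_analytic (R : realType) (k : ground) :
    (ground_field R k -> ground_field R k) -> Prop :=
  match k return (ground_field R k -> ground_field R k) -> Prop with
  | RealK => @real_analytic_R R
  | ComplexK => @real_analytic_C R[i]
  end.

Section Deformations.
Variables (R : realType) (k : ground) (n p : nat).
Local Notation K := (ground_field R k).
Implicit Types (f : poly_map R k n p) (F : K -> poly_map R k n p) (T : set K).

Definition deformation f F : Prop :=
  [/\ F 0 = f, forall eps, peval (F eps) 0 = 0
    & forall j m, real_analytic (fun eps => mcoeff m (F eps j))].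

Definition no_coalescing_along F T : Prop :=
  [/\ connected T, T 0 & exists2 e : R, 0 < e & forall eps, T eps ->
    singular_locus (F eps) `&` @euclidean_ball R k n e `<=` [set 0]].

Definition weak_no_coalescing_along F T : Prop :=
  [/\ connected T, T 0 & exists2 e : R, 0 < e & forall eps, T eps ->
    singular_locus (F eps) `&` zero_locus (F eps) `&` @euclidean_ball R k n e
      `<=` [set 0]].

Definition no_coalescing F : Prop :=
  forall T, compact T -> connected T -> T 0 -> no_coalescing_along F T.

Definition weak_no_coalescing F : Prop :=
  forall T, compact T -> connected T -> T 0 -> weak_no_coalescing_along F T.

End Deformations.

(* Main.v *)
Require Import Defs.
From HB Require Import structures.
From mathcomp Require Import all_boot all_order all_algebra.
From mathcomp Require Import complex zify ring lra.
From mathcomp Require Import all_classical all_reals all_analysis.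
From mathcomp Require Import -(notations) mpoly.

Set Implicit Arguments.
Unset Strict Implicit.
Unset Printing Implicit Defensive.

Import Order.TTheory GRing.Theory Num.Theory.
Import numFieldNormedType.Exports.

Local Open Scope classical_set_scope.
Local Open Scope ring_scope.

(** Suppose that singular points [x a], different from the origin, of maps
    [F (eps a)] tend to the origin, where [eps a] tends to some [eps0] whose map
    agrees with [f] on the diagrams. The coordinates of [x a] have orders of
    magnitude [t a = - ln |x a|], infinite for the coordinates that vanish, and
    [t a] selects a face of the polyhedron above [D_1 + ... + D_p]. The
    nondegeneracy hypothesis says something about inner faces only, so the
    weights [t a] are first lowered, without changing their minimum on the
    polyhedron, until every variable occurs on the selected face; the face still
    meets the coordinate subspace where no weight was lowered
    ([lowered_weight]). Multiplying the coordinates by the exponentials of the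
    weights and the components of the map by the exponentials of their degrees,
    the maps converge to the face map of [f], the points converge to a point [y]
    whose nonzero coordinates include those of that subspace, and normalized
    covectors that annihilate the differentials converge to a nonzero covector
    that annihilates the differential of the face map at [y]
    ([singular_limit]). This contradicts nondegeneracy.

    The rescaled maps need not converge to a face map if the weights stay close
    to, but not on, a wall between the cones of weights that select different
    faces. Along an ultrafilter each of the finitely many relevant gaps either
    is bounded or tends to infinity, and a bounded change of the weights makes
    the bounded gaps vanish ([bounded_correction], [face_selection]). This
    argument takes the place of the curve selection lemma: the weights are real
    and vary with the point.

    Three facts make this work. By Fourier-Motzkin elimination a projection
    of a rational polyhedron is a rational polyhedron, so that the sum of diagrams
    is a diagram and the faces selected by positive weights are faces in the sense
    of the hypothesis ([diagram_sum_presents],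
    [minimizers_face]). Irredundant forms of a presentation are proportional to
    the weights of the facets, so that conditions on the degrees with respect to
    these weights place the exponents in the polyhedron, or strictly above the
    diagram ([facet_forms]). Finally, only finitely many monomials occur in the
    deformation: otherwise infinitely many nonzero analytic coefficients would
    vanish on sets that cover the parameter space, against Baire's theorem and
    the identity theorem ([uniform_vanishing_ground]). *)

(** * Polyhedra given by finitely many linear inequalities *)

Lemma cvg_sumr (K : numFieldType) (T I : Type) (F : set_system T) (r : seq I)
    (P : pred I) (g : I -> T -> K) (a : I -> K) : Filter F ->
  (forall i, P i -> g i x @[x --> F] --> a i) ->
  \sum_(i <- r | P i) g i x @[x --> F] --> \sum_(i <- r | P i) a i.
Proof. by move=> FF; apply: cvg_big; exact: add_continuous. Qed.

Lemma cvg_prodr (K : numFieldType) (T I : Type) (F : set_system T) (r : seq I)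
    (P : pred I) (g : I -> T -> K) (a : I -> K) : Filter F ->
  (forall i, P i -> g i x @[x --> F] --> a i) ->
  \prod_(i <- r | P i) g i x @[x --> F] --> \prod_(i <- r | P i) a i.
Proof. by move=> FF; apply: cvg_big; exact: mul_continuous. Qed.

Lemma sub_count_eq (T : eqType) (a b : pred T) (s : seq T) :
  (forall x, x \in s -> a x -> b x) -> (count b s <= count a s)%N ->
  forall x, x \in s -> b x -> a x.
Proof.
elim: s => //= y s IH ab le x.
have le' : (count a s <= count b s)%N.
  have {}ab z : z \in s -> a z -> b z by move=> zs; apply: ab; rewrite inE zs orbT.
  elim: s ab {IH le} => //= z s IH ab; apply: leq_add.
    by case: (a z) (ab z (mem_head _ _)) => //= ->.
  by apply: IH => w ws; apply: ab; rewrite inE ws orbT.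
have aby : (a y <= b y)%N by case: (a y) (ab y (mem_head _ _)) => //= ->.
have abE : a y = b y :> nat by apply/eqP; rewrite eqn_leq aby; lia.
rewrite inE => /orP[/eqP->|xs]; first by move: abE; case: (a y); case: (b y).
apply: IH xs => [z zs|]; first by apply: ab; rewrite inE zs orbT.
by rewrite -(leq_add2l (a y)) {1}abE.
Qed.

Section Polyhedra.
Variables (R : realType) (n : nat).
Implicit Types (u v x y z : 'rV[R]_n) (C : seq ('rV[R]_n * R)).

Lemma dotDr u x y : dot u (x + y) = dot u x + dot u y.
Proof. by rewrite /dot -big_split; apply: eq_bigr => i _; rewrite mxE mulrDr. Qed.

Lemma dotZr u (a : R) x : dot u (a *: x) = a * dot u x.
Proof. by rewrite /dot mulr_sumr; apply: eq_bigr => i _; rewrite mxE mulrCA. Qed.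

Lemma dotNr u x : dot u (- x) = - dot u x.
Proof. by rewrite -scaleN1r dotZr mulN1r. Qed.

Lemma dotBr u x y : dot u (x - y) = dot u x - dot u y.
Proof. by rewrite dotDr dotNr. Qed.

Lemma dot0r u : dot u 0 = 0.
Proof. by rewrite -(scale0r 0) dotZr mul0r. Qed.

Lemma dotC u x : dot u x = dot x u.
Proof. by apply: eq_bigr => i _; rewrite mulrC. Qed.

Lemma dot_delta i x : dot (delta_mx 0 i) x = x 0 i.
Proof.
rewrite /dot (bigD1 i) //= big1 ?addr0; first by rewrite mxE !eqxx mul1r.
by move=> l /negPf li; rewrite mxE li andbF mul0r.
Qed.

Lemma dot_sumr (I : Type) (r : seq I) (X : I -> 'rV[R]_n) u :
  dot u (\sum_(i <- r) X i) = \sum_(i <- r) dot u (X i).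
Proof.
elim: r => [|i r IH]; first by rewrite !big_nil dot0r.
by rewrite !big_cons dotDr IH.
Qed.

Lemma dot_ge0 u x : orthant u -> orthant x -> 0 <= dot u x.
Proof. by move=> u0 x0; apply: sumr_ge0 => i _; rewrite mulr_ge0. Qed.

Lemma dot_le u v x : orthant x -> (forall i, u 0 i <= v 0 i) -> dot u x <= dot v x.
Proof. by move=> x0 uv; apply: ler_sum => i _; rewrite ler_wpM2r. Qed.

Definition polyhedron C : set 'rV[R]_n :=
  [set x | forall c, c \in C -> c.2 <= dot c.1 x].

Definition minimizes u (Q : set 'rV[R]_n) x : Prop :=
  Q x /\ forall y, Q y -> dot u x <= dot u y.

(** Moving in a direction that no tight constraint forbids is possible for a
    positive time, since the slack of the others is positive. *)
Lemma small_step C x v : polyhedron C x ->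
  (forall c, c \in C -> dot c.1 x = c.2 -> 0 <= dot c.1 v) ->
  exists2 d : R, 0 < d & forall s, 0 <= s <= d -> polyhedron C (x + s *: v).
Proof.
elim: C => [|c C IH] Cx Cv; first by exists 1 => // s _ c.
have [||d d0 dP] := IH.
- by move=> e eC; apply: Cx; rewrite inE eC orbT.
- by move=> e eC; apply: Cv; rewrite inE eC orbT.
have [cv|cv] := leP 0 (dot c.1 v).
  exists d => // s sd e; rewrite inE => /orP[/eqP->|]; last exact: dP.
  rewrite dotDr dotZr; have := Cx c (mem_head _ _).
  by have := mulr_ge0 (proj1 (andP sd)) cv; lra.
have cx : c.2 < dot c.1 x.
  rewrite lt_neqAle Cx ?mem_head // andbT; apply/eqP => cx.
  by have := Cv c (mem_head _ _) (esym cx); rewrite leNgt cv.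
exists (Num.min d ((dot c.1 x - c.2) / - dot c.1 v)).
  by rewrite lt_min d0 divr_gt0 ?subr_gt0 // oppr_gt0.
move=> s; rewrite le_min => /and3P[s0 sd sc] e; rewrite inE => /orP[/eqP->|].
  rewrite dotDr dotZr; move: sc; rewrite ler_pdivlMr ?oppr_gt0 //; lra.
by apply: dP; rewrite s0.
Qed.

(** The set of minimizers of a linear form on a polyhedron is cut out by the
    constraints that are tight at one minimizer [x]: from [x] one can go a
    little in the direction opposite to [y]. *)
Lemma minimizes_tight C u x y : minimizes u (polyhedron C) x -> polyhedron C y ->
  (forall c, c \in C -> dot c.1 x = c.2 -> dot c.1 y = c.2) ->
  minimizes u (polyhedron C) y.
Proof.
move=> [Cx xmin] Cy xy; split=> // z Cz; apply: le_trans (xmin z Cz).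
have [c cC cx|d d0 dP] := @small_step C x (x - y) Cx.
  by rewrite dotBr cx xy // subrr.
have /dP/xmin : 0 <= d <= d by rewrite lexx ltW.
rewrite dotDr dotZr dotBr lerDl pmulr_rge0 //; lra.
Qed.

(** Only finitely many sets of constraints occur as sets of tight constraints:
    one representative of each suffices to test any linear form. *)
Lemma tight_representatives C : exists V : seq 'rV[R]_n,
  (forall v, v \in V -> polyhedron C v) /\
  (forall x, polyhedron C x -> exists2 v, v \in V &
     forall c, c \in C -> (dot c.1 v == c.2) = (dot c.1 x == c.2)).
Proof.
pose bits x := map_tuple (fun c => dot c.1 x == c.2) (in_tuple C).
pose pk (b : (size C).-tuple bool) : seq 'rV[R]_n :=
  if pselect (exists x, polyhedron C x /\ bits x = b) is left e
  then [:: projT1 (cid e)] else [::].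
exists (flatten [seq pk b | b <- enum {: (size C).-tuple bool}]); split.
  move=> v /flattenP[s /mapP[b _ ->]]; rewrite /pk.
  case: pselect => // e; rewrite inE => /eqP->.
  by case: (cid e) => w [].
move=> x Cx; have e : exists y, polyhedron C y /\ bits y = bits x by exists x.
exists (projT1 (cid e)).
  apply/flattenP; exists (pk (bits x)); first by apply: map_f; rewrite mem_enum.
  rewrite /pk; case: pselect => [e'|]; last by [].
  by rewrite (Prop_irrelevance e' e) mem_head.
case: (cid e) => v [_ /(congr1 val)/= vx] c cC.
by move/eq_in_map: vx => /(_ c cC).
Qed.

Lemma dot_continuous u : continuous (fun x => dot u x).
Proof.
move=> x; rewrite /dot; apply: (@cvg_sumr _ _ _ (nbhs x)) => i _.
by apply: cvgM; [exact: cvg_cst|exact: coord_continuous].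
Qed.

Lemma polyhedron_closed C : closed (polyhedron C).
Proof.
have -> : polyhedron C = \bigcap_(c in [set c | c \in C]) [set x | c.2 <= dot c.1 x].
  by apply/seteqP; split.
apply: closed_bigI => c _.
apply: (@preimage_closed _ _ (fun x => dot c.1 x) [set t | c.2 <= t]).
  by move=> x _; exact: dot_continuous.
exact: closed_ge.
Qed.

Lemma polyhedron_compact C (M : R) :
  (forall x, polyhedron C x -> forall i, `|x 0 i| <= M) -> compact (polyhedron C).
Proof.
move=> CM; apply: bounded_closed_compact; last exact: polyhedron_closed.
exists (Num.max M 0); split; first exact: num_real.
move=> N MN x /CM xM; have N0 : 0 <= N by move: MN; rewrite gt_max => /andP[_ /ltW].
rewrite /= /Num.norm /= mx_normrE; apply/bigmax_leP; split=> // -[i j] _ /=.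
rewrite ord1; apply: le_trans (xM j) _.
by move: MN; rewrite gt_max => /andP[/ltW].
Qed.

Lemma coord_le_norm x i : `|x 0 i| <= `|x|.
Proof.
rewrite [leRHS]/Num.norm /= mx_normrE.
exact: (le_bigmax _ (fun ij : 'I_1 * 'I_n => `|x ij.1 ij.2|) (0, i)).
Qed.

Lemma exists_minimizes_bounded C u (M : R) : polyhedron C !=set0 ->
  (forall x, polyhedron C x -> forall i, `|x 0 i| <= M) ->
  exists x, minimizes u (polyhedron C) x.
Proof.
move=> C0 /polyhedron_compact cC.
have [|x xC xmin] := @EVT_min_rV R n (fun x => dot u x) _ C0 cC.
  by apply: continuous_subspaceT; exact: dot_continuous.
by exists x; split; [exact: set_mem|move=> y Cy; apply: xmin; exact: mem_set].
Qed.

(** The part of the polyhedron where a positive form is at most a given value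
    is bounded. *)
Lemma exists_minimizes C u : polyhedron C !=set0 -> polyhedron C `<=` @orthant R n ->
  (forall i, 0 < u 0 i) -> exists x, minimizes u (polyhedron C) x.
Proof.
move=> [x0 Cx0] Cpos u0; pose K := dot u x0.
have uge0 : orthant u by move=> i; exact: ltW.
have [||x [Cx xmin]] := @exists_minimizes_bounded ((- u, - K) :: C) u
    (\sum_i K / u 0 i).
- by exists x0 => c; rewrite inE => /orP[/eqP->|/Cx0//]; rewrite /= dotC dotNr dotC.
- move=> x Cx i; have xC : polyhedron C x by move=> c cC; apply: Cx; rewrite inE cC orbT.
  have := Cx _ (mem_head _ _); rewrite /= dotC dotNr dotC lerN2 => xK.
  have x0' := Cpos _ xC.
  have uxi l : u 0 l * x 0 l <= K.
    apply: le_trans xK; rewrite /dot (bigD1 l) //= lerDl sumr_ge0 // => j _.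
    by rewrite mulr_ge0.
  rewrite ger0_norm // (bigD1 i) //=; apply: ler_wpDr.
    apply: sumr_ge0 => j _; rewrite divr_ge0 //.
    by apply: le_trans (uxi j); rewrite mulr_ge0.
  by rewrite ler_pdivlMr // mulrC.
exists x; split=> [c cC|y Cy]; first by apply: Cx; rewrite inE cC orbT.
have [yK|/ltW Ky] := leP (dot u y) K.
  apply: xmin => c; rewrite inE => /orP[/eqP->|/Cy//].
  by rewrite /= dotC dotNr dotC lerN2.
apply: le_trans Ky; apply: xmin => c; rewrite inE => /orP[/eqP->|/Cx0//].
by rewrite /= dotC dotNr dotC.
Qed.

(** A minimizer with the fewest tight constraints is in the relative interior of
    the face: the constraints tight at its midpoint with another minimizer are
    those tight at both. *)
Lemma relative_interior_minimizer C u : (exists x, minimizes u (polyhedron C) x) ->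
  exists2 x, minimizes u (polyhedron C) x &
    forall y, minimizes u (polyhedron C) y <->
      polyhedron C y /\ forall c, c \in C -> dot c.1 x = c.2 -> dot c.1 y = c.2.
Proof.
move=> ex; pose nt x := count (fun c => dot c.1 x == c.2) C.
have exk : exists k, `[< exists2 x, minimizes u (polyhedron C) x & nt x = k >].
  by case: ex => x xm; exists (nt x); apply/asboolP; exists x.
case: (ex_minnP exk) => k /asboolP[x xm xk] kmin.
exists x => // y; split=> [ym|[]]; last exact: minimizes_tight.
split=> [|c cC cx]; first by case: ym.
have [Cx xmin] := xm; have [Cy ymin] := ym.
pose z := 2^-1 *: x + 2^-1 *: y.
have dz v : dot v z = 2^-1 * dot v x + 2^-1 * dot v y by rewrite dotDr !dotZr.
have zm : minimizes u (polyhedron C) z.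
  split=> [e eC|w Cw].
    by rewrite dz; have := Cx e eC; have := Cy e eC; lra.
  by rewrite dz; have := xmin w Cw; have := ymin w Cw; lra.
have sub e : e \in C -> dot e.1 z == e.2 -> dot e.1 x == e.2 /\ dot e.1 y == e.2.
  move=> eC /eqP; rewrite dz => ez; have := Cx e eC; have := Cy e eC.
  by move=> ye xe; split; apply/eqP; lra.
have kz : (nt x <= nt z)%N by rewrite xk; apply: kmin; apply/asboolP; exists z.
have /(_ c cC) := sub_count_eq (fun e eC ez => proj1 (sub e eC ez)) kz.
by rewrite cx eqxx => /(_ isT) /(sub c cC)[_ /eqP].
Qed.
End Polyhedra.

(** * C-face diagrams as lower boundaries of polyhedra *)

Section Upper.
Variables (R : realType) (n : nat).
Implicit Types (u v x y z s : 'rV[R]_n) (J : seq 'rV[rat]_n) (l w : 'rV[rat]_n).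

Definition upper_constraints J : seq ('rV[R]_n * R) :=
  [seq (map_mx ratr l, 1) | l <- J] ++ [seq (delta_mx 0 i, 0) | i <- enum 'I_n].

(** The polyhedron that the diagram bounds from below. *)
Definition upper J : set 'rV[R]_n := polyhedron (upper_constraints J).

Lemma upperP J x :
  upper J x <-> @orthant R n x /\ forall l, l \in J -> 1 <= pairing l x.
Proof.
split=> [Jx|[x0 Jx] c].
  split=> [i|l lJ].
    rewrite -dot_delta; apply: (Jx (delta_mx 0 i, 0)); rewrite mem_cat.
    by apply/orP; right; apply: map_f; rewrite mem_enum.
  by apply: (Jx (map_mx ratr l, 1)); rewrite mem_cat map_f.
rewrite mem_cat => /orP[/mapP[l lJ ->]|/mapP[i _ ->]] /=; first exact: Jx.
by rewrite dot_delta.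
Qed.

Lemma tight_form J l : l \in J -> (map_mx ratr l, 1) \in upper_constraints J.
Proof. by move=> lJ; rewrite mem_cat map_f. Qed.

Lemma tight_coord J i : (delta_mx 0 i, 0) \in upper_constraints J.
Proof. by rewrite mem_cat orbC map_f // mem_enum. Qed.

Lemma pairing_ge0 l x : positive_form l -> @orthant R n x -> 0 <= pairing l x.
Proof.
by move=> l0 x0; apply: dot_ge0 => // i; rewrite mxE ler0q ltW.
Qed.

Lemma upper_add J x y : (forall l, l \in J -> positive_form l) ->
  upper J x -> orthant y -> upper J (x + y).
Proof.
move=> J0 /upperP[x0 Jx] y0; apply/upperP; split=> [i|l lJ].
  by rewrite mxE addr_ge0.
by rewrite /pairing dotDr ler_wpDr ?Jx //; apply: pairing_ge0 => //; apply: J0.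
Qed.

Lemma diagram_upper J : diagram J `<=` upper J.
Proof. by move=> x [x0 Jx _]; apply/upperP. Qed.

Lemma diagramP J x : diagram J x <->
  upper J x /\ exists2 l, l \in J & pairing l x = 1.
Proof. by rewrite upperP; split=> [[]|[[]]]. Qed.

Lemma upper_axis J : (forall l, l \in J -> positive_form l) ->
  exists2 c : R, 0 < c & forall i, upper J (c *: delta_mx 0 i).
Proof.
move=> J0; pose f l := \sum_i (ratr (l 0 i) : R)^-1.
have li l i : l \in J -> 0 < (ratr (l 0 i) : R) by move=> lJ; rewrite ltr0q J0.
have f0 l : l \in J -> 0 <= f l.
  by move=> lJ; apply: sumr_ge0 => i _; rewrite invr_ge0 ltW // li.
pose c := 1 + \sum_(l <- J) f l.
have c1 : 1 <= c by rewrite lerDl big_seq sumr_ge0.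
exists c; first by apply: lt_le_trans c1.
move=> i; apply/upperP; split=> [j|l lJ].
  by rewrite !mxE mulr_ge0 ?ler0n // (le_trans ler01).
rewrite /pairing dotZr dotC dot_delta mxE -ler_pdivrMr ?li // mul1r.
rewrite /c (perm_big _ (perm_to_rem lJ)) big_cons /= addrCA /f (bigD1 i) //= -addrA lerDl.
rewrite !addr_ge0 ?ler01 //.
  by apply: sumr_ge0 => j _; rewrite invr_ge0 ltW // li.
by rewrite big_seq; apply: sumr_ge0 => k /mem_rem /f0.
Qed.

Lemma upper_mass J : J != [::] -> (forall l, l \in J -> positive_form l) ->
  exists2 b : R, 0 < b & forall x, upper J x -> b <= \sum_i x 0 i.
Proof.
case: J => // l J _ J0; have lJ : l \in l :: J by exact: mem_head.
pose a : R := 1 + \sum_i ratr (l 0 i).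
have l0 i : 0 <= (ratr (l 0 i) : R) by rewrite ler0q ltW // J0.
have a0 : 0 < a by rewrite ltr_pwDl // sumr_ge0.
exists a^-1; rewrite ?invr_gt0 // => x /upperP[x0 /(_ l lJ) Jx].
rewrite -[_^-1]mul1r ler_pdivrMr //; apply: le_trans Jx _.
rewrite /pairing /dot mulr_suml; apply: ler_sum => i _.
rewrite mxE mulrC ler_wpM2l // ?x0 // /a (bigD1 i) //= addrCA lerDl.
by rewrite addr_ge0 ?ler01 // sumr_ge0.
Qed.

Lemma upper_orthant J : upper J `<=` @orthant R n.
Proof. by move=> x /upperP[]. Qed.

(** Dividing a point of the polyhedron by the smallest value of the forms in
    [J] brings it down to the diagram. *)
Lemma upper_diagram J : J != [::] -> (forall l, l \in J -> positive_form l) ->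
  [set x + y | x in diagram J & y in @orthant R n] = upper J.
Proof.
move=> Jn J0; apply/seteqP; split=> [_ [x /diagram_upper Jx [y y0 <-]]|x Jx].
  exact: upper_add.
have /upperP[x0 Jl] := Jx.
have [l lJ lmin] : exists2 l, l \in J & forall m, m \in J -> pairing l x <= pairing m x.
  case: J Jn {J0 Jx Jl} => // l J _.
  elim: J l => [l|m J IH l].
    by exists l; rewrite ?mem_head // => m; rewrite inE => /eqP->.
  have [a aJ amin] := IH m.
  have [la|/ltW al] := leP (pairing l x) (pairing a x).
    exists l; rewrite ?mem_head // => b; rewrite inE => /orP[/eqP->//|/amin].
    exact: le_trans.
  exists a; first by rewrite inE aJ orbT.
  by move=> b; rewrite inE => /orP[/eqP->//|/amin].
have lx0 : 0 < pairing l x by apply: lt_le_trans (Jl l lJ).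
exists ((pairing l x)^-1 *: x).
  split=> [i|m mJ|]; first by rewrite mxE mulr_ge0 // invr_ge0 ltW.
    by rewrite /pairing dotZr mulrC ler_pdivlMr // mul1r lmin.
  by exists l => //; rewrite /pairing dotZr mulVf // gt_eqF.
exists (x - (pairing l x)^-1 *: x); last by rewrite addrC subrK.
move=> i; rewrite !mxE subr_ge0 ler_piMl // invf_le1 // Jl //.
Qed.

(** A minimizer of a positive form cannot be shrunk. *)
Lemma minimizer_tight J s x : J != [::] -> (forall i, 0 < s 0 i) ->
  minimizes s (upper J) x -> exists2 l, l \in J & pairing l x = 1.
Proof.
move=> Jn s0 [Jx xmin]; have /upperP[x0 Jl] := Jx.
case: (pselect (exists2 l, l \in J & pairing l x = 1)) => // no; exfalso.
have [c|d d0 dP] := small_step (v := - x) Jx.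
  rewrite mem_cat => /orP[/mapP[l lJ ->]|/mapP[i _ ->]] /=.
    by move=> lx; case: no; exists l.
  by rewrite dotNr => ->; rewrite oppr0.
have /dP/xmin : 0 <= d <= d by rewrite lexx ltW.
rewrite dotDr dotZr dotNr lerDl mulrN oppr_ge0 pmulr_rle0 // => sx.
have sge0 : orthant s by move=> i; exact: ltW.
have xE i : x 0 i = 0.
  have : s 0 i * x 0 i <= dot s x.
    by rewrite /dot (bigD1 i) //= lerDl sumr_ge0 // => j _; rewrite mulr_ge0.
  move=> /le_trans /(_ sx); rewrite pmulr_rle0 // => xi.
  by apply/eqP; rewrite eq_le xi x0.
case: J Jn Jl {Jx xmin dP no} => // l J _ /(_ l (mem_head _ _)).
by rewrite /pairing /dot big1 ?ler10 // => i _; rewrite xE mulr0.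
Qed.

(** The constraints tight at a relative interior point of the set of minimizers
    cut it out; as the form is positive, not all of them are equations of
    coordinate hyperplanes. *)
Lemma minimizers_face J D s : (0 < n)%N -> presents J D -> (forall i, 0 < s 0 i) ->
  is_face D [set x | minimizes s (upper J) x].
Proof.
move=> n0 [Jn J0 ->] s0.
have [|x xm xface] := @relative_interior_minimizer _ _ (upper_constraints J) s.
  apply: exists_minimizes => //; last exact: upper_orthant.
  have [c _ cJ] := upper_axis J0; exists (c *: delta_mx 0 (Ordinal n0)); exact: cJ.
exists J, [set i | x 0 i != 0]%SET, [seq l <- J | pairing l x == 1]; split=> //.
- by have [l lJ lx] := minimizer_tight Jn s0 xm; rewrite -has_filter; apply/hasP;
  exists l; rewrite ?lx.
- by move=> l; rewrite mem_filter => /andP[].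
- by exists x.
apply/seteqP; split=> [y ym|y [yD yI yl]] /=.
  have [Jy ytight] := (xface y).1 ym.
  split.
  - by apply/diagramP; split=> //; exact: minimizer_tight ym.
  - move=> i; rewrite inE negbK => /eqP xi.
    by rewrite -dot_delta; apply: (ytight (delta_mx 0 i, 0));
      rewrite ?tight_coord // dot_delta.
  - move=> l; rewrite mem_filter => /andP[/eqP lx lJ].
    by apply: (ytight (map_mx ratr l, 1)); rewrite ?tight_form.
apply/xface; split; first exact: diagram_upper.
move=> c; rewrite mem_cat => /orP[/mapP[l lJ ->]|/mapP[i _ ->]] /=.
  by move=> lx; apply: yl; rewrite mem_filter lJ andbT; apply/eqP.
by rewrite !dot_delta => xi; apply: yI; rewrite inE negbK xi.
Qed.

End Upper.

(** * Fourier-Motzkin elimination and Minkowski sums *)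

Section FourierMotzkin.
Variables (R : realType) (n : nat) (V : finType).

(** [(a, b, c)] stands for the inequality [0 <= a.x + b.y - c] in the unknowns
    [x], which are kept, and [y], which are to be eliminated. *)
Definition ineq := ('rV[rat]_n * {ffun V -> rat} * rat)%type.

Implicit Types (e f : ineq) (S : seq ineq) (x : 'rV[R]_n) (y : V -> R).

Definition slack e x y : R :=
  pairing e.1.1 x + \sum_v ratr (e.1.2 v) * y v - ratr e.2.

Definition Ineq (a : 'rV[rat]_n) (b : V -> rat) (c : rat) : ineq := (a, finfun b, c).

Lemma slack_Ineq a b c x y :
  slack (Ineq a b c) x y = pairing a x + \sum_v ratr (b v) * y v - ratr c.
Proof. by rewrite /slack /=; under eq_bigr do rewrite ffunE. Qed.

Definition solves S x y : Prop := forall e, e \in S -> 0 <= slack e x y.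

Definition combine (k m : rat) e f : ineq :=
  (k *: e.1.1 + m *: f.1.1, [ffun v => k * e.1.2 v + m * f.1.2 v], k * e.2 + m * f.2).

Lemma slack_combine k m e f x y :
  slack (combine k m e f) x y = ratr k * slack e x y + ratr m * slack f x y.
Proof.
have pE : pairing (k *: e.1.1 + m *: f.1.1) x
        = ratr k * pairing e.1.1 x + ratr m * pairing f.1.1 x.
  rewrite /pairing !(dotC _ x) -!dotZr -dotDr; congr dot.
  by apply/rowP => i; rewrite !mxE rmorphD !rmorphM.
have sE : \sum_v ratr ((combine k m e f).1.2 v) * y v
   = ratr k * (\sum_v ratr (e.1.2 v) * y v) + ratr m * (\sum_v ratr (f.1.2 v) * y v).
  rewrite !mulr_sumr -big_split; apply: eq_bigr => v _ /=.
  by rewrite ffunE rmorphD !rmorphM mulrDl !mulrA.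
by rewrite /slack sE /= pE rmorphD !rmorphM /=; ring.
Qed.

Definition update y (v : V) (t : R) : V -> R := fun u => if u == v then t else y u.

Lemma slack_update e x y v t :
  slack e x (update y v t) = slack e x (update y v 0) + ratr (e.1.2 v) * t.
Proof.
rewrite /slack (bigD1 v) //= [in RHS](bigD1 v) //= /update eqxx.
set A := \sum_(u | u != v) _; set B := \sum_(u | u != v) _.
have -> : A = B by apply: eq_bigr => u /negPf->.
by rewrite mulr0 add0r; ring.
Qed.

Lemma slack_updateE e x y v t : e.1.2 v = 0 -> slack e x (update y v t) = slack e x y.
Proof.
move=> ev; rewrite /slack; congr (_ + _ - _); apply: eq_bigr => u _.
by rewrite /update; case: eqP => // ->; rewrite ev rmorph0 !mul0r.
Qed.

Lemma between (L U : seq R) : (forall l u, l \in L -> u \in U -> l <= u) ->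
  exists t, (forall l, l \in L -> l <= t) /\ (forall u, u \in U -> t <= u).
Proof.
elim: L => [_|l L IH LU].
  elim: U => [|u U [t [_ tU]]]; first by exists 0.
  exists (Num.min u t); split=> // w.
  by rewrite inE => /orP[/eqP->|/tU]; rewrite ge_min ?lexx // => ->; rewrite orbT.
have [|t [Lt tU]] := IH; first by move=> k u kL uU; apply: LU; rewrite // inE kL orbT.
exists (Num.max l t); split=> [w|u uU].
  by rewrite inE => /orP[/eqP->|/Lt]; rewrite le_max ?lexx // => ->; rewrite orbT.
by rewrite ge_max tU // andbT LU // mem_head.
Qed.

(** A value for one unknown exists exactly when each of its lower bounds is
    below each of its upper bounds. *)
Lemma eliminate_one S v : exists S',
  [/\ forall e, e \in S' -> e.1.2 v = 0,
      forall u, (forall e, e \in S -> e.1.2 u = 0) -> forall e, e \in S' -> e.1.2 u = 0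
    & forall x y, (exists t, solves S x (update y v t)) <-> solves S' x y].
Proof.
pose Sp := [seq e : ineq <- S | 0 < e.1.2 v];
  pose Sn := [seq e : ineq <- S | e.1.2 v < 0].
pose cmb (e f : ineq) := combine (- f.1.2 v) (e.1.2 v) e f.
exists ([seq e : ineq <- S | e.1.2 v == 0] ++ [seq cmb e f | e <- Sp, f <- Sn]); split.
- move=> e; rewrite mem_cat mem_filter => /orP[/andP[/eqP//]|].
  by case/allpairsP => -[e1 e2] [_ _ ->] /=; rewrite ffunE mulNr mulrC addNr.
- move=> u uS e; rewrite mem_cat mem_filter => /orP[/andP[_ /uS//]|].
  case/allpairsP => -[e1 e2] /=;
    rewrite !mem_filter => -[/andP[_ /uS h1] /andP[_ /uS h2] ->].
  by rewrite ffunE h1 h2 !mulr0 addr0.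
move=> x y; split=> [[t St] e|Sy].
  rewrite mem_cat mem_filter => /orP[/andP[/eqP ev /St]|].
    by rewrite slack_updateE.
  case/allpairsP => -[e1 e2] /=;
    rewrite !mem_filter => -[/andP[p1 /St s1] /andP[p2 /St s2] ->].
  rewrite -(@slack_updateE _ x y v t); last by rewrite ffunE mulNr mulrC addNr.
  by rewrite slack_combine addr_ge0 // mulr_ge0 // ler0q ?oppr_ge0 ltW.
pose a (e : ineq) := slack e x (update y v 0); pose b (e : ineq) : R := ratr (e.1.2 v).
have [_ _ /mapP[e eS ->] /mapP[f fS ->]|t [Lt tU]] :=
    @between [seq - a e / b e | e <- Sp] [seq a f / - b f | f <- Sn].
  have := Sy (cmb e f); rewrite mem_cat allpairs_f ?orbT // => /(_ isT).
  rewrite -(@slack_updateE _ x y v 0); last by rewrite ffunE mulNr mulrC addNr.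
  rewrite slack_combine rmorphN /= -/(a e) -/(a f) -/(b e) -/(b f).
  move: eS fS; rewrite !mem_filter => /andP[e0 _] /andP[f0 _] h.
  rewrite ler_pdivrMr ?ltr0q // mulrAC ler_pdivlMr ?oppr_gt0 ?ltrq0 //; lra.
exists t => e eS; rewrite slack_update -/(a e) -/(b e).
have [ev|ev|ev] := ltgtP (e.1.2 v) 0.
- have /tU : a e / - b e \in [seq a f / - b f | f <- Sn].
    by apply/mapP; exists e; rewrite // mem_filter ev.
  rewrite ler_pdivlMr ?oppr_gt0 ?ltrq0 //; lra.
- have /Lt : - a e / b e \in [seq - a e / b e | e <- Sp].
    by apply/mapP; exists e; rewrite // mem_filter ev.
  rewrite ler_pdivrMr ?ltr0q //; lra.
rewrite /b ev rmorph0 mul0r addr0 /a slack_updateE //.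
by apply: Sy; rewrite mem_cat mem_filter ev eqxx eS.
Qed.

(** The unknowns are eliminated one after the other; inequalities that do not
    involve an unknown only produce inequalities that do not involve it. *)
Lemma projection_inequalities S : exists C : seq ('rV[rat]_n * rat), forall x,
  (exists y, solves S x y) <-> (forall c, c \in C -> ratr c.2 <= pairing c.1 x).
Proof.
suff [S' [S0 SE]] : exists S', (forall v, v \in enum V -> forall e, e \in S' -> e.1.2 v
  = 0)
    /\ forall x, (exists y, solves S x y) <-> (exists y, solves S' x y).
  exists [seq (e.1.1, e.2) | e : ineq <- S'] => x; rewrite SE.
  have sE e y : e \in S' -> slack e x y = pairing e.1.1 x - ratr e.2.
    move=> eS; rewrite /slack big1 ?addr0 // => v _.
    by rewrite S0 ?mem_enum // rmorph0 mul0r.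
  split=> [[y Sy] c /mapP[e eS ->] /=|Cx].
    by rewrite -subr_ge0 -(sE e y) //; apply: Sy.
  exists (fun=> 0) => e eS; rewrite sE // subr_ge0.
  exact: (Cx (e.1.1, e.2) (map_f _ eS)).
elim: (enum V) => [|v vs [S' [S0 SE]]]; first by exists S.
have [S'' [h1 h2 h3]] := eliminate_one S' v; exists S''; split.
  by move=> u; rewrite inE => /orP[/eqP->|/S0/h2].
move=> x; rewrite SE; split=> -[y Sy].
  exists y; apply/h3; exists (y v); move=> e eS; rewrite (_ : update y v (y v) = y);
    first exact: Sy.
  by apply/funext => u; rewrite /update; case: eqP => // ->.
by have [t St] := (h3 x y).2 Sy; exists (update y v t).
Qed.

End FourierMotzkin.

Section MinkowskiSum.
Variables (R : realType) (n p : nat) (J : 'I_p -> seq 'rV[rat]_n).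
Implicit Types (x y : 'rV[R]_n).

Lemma msum_inequalities : exists C : seq ('rV[rat]_n * rat), forall x,
  Defs.msum (fun j => @upper R n (J j)) x <->
  (forall c, c \in C -> ratr c.2 <= pairing c.1 x).
Proof.
pose V : finType := ('I_p * 'I_n)%type.
pose dl (i : 'I_n) : 'rV[rat]_n := delta_mx 0 i.
pose eJ (j : 'I_p) (l : 'rV[rat]_n) : ineq n V :=
  Ineq 0 (fun v : V => (v.1 == j)%:R * l 0 v.2) 1.
pose eV (u : V) : ineq n V := Ineq 0 (fun v : V => (v == u)%:R) 0.
pose eL (i : 'I_n) : ineq n V := Ineq (dl i) (fun v : V => - (v.2 == i)%:R) 0.
pose eG (i : 'I_n) : ineq n V := Ineq (- dl i) (fun v : V => (v.2 == i)%:R) 0.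
pose S : seq (ineq n V) := flatten [seq [seq eJ j l | l <- J j] | j <- enum 'I_p]
  ++ [seq eV v | v <- enum V] ++ [seq eL i | i <- enum 'I_n] ++ [seq eG i | i <- enum
    'I_n].
have [C CE] := projection_inequalities R S; exists C => x; rewrite -CE.
have p0 : pairing (0 : 'rV[rat]_n) x = 0.
  by rewrite /pairing dotC (_ : map_mx _ _ = 0) ?dot0r //; apply/rowP => i;
    rewrite !mxE rmorph0.
have pdl i : pairing (dl i) x = x 0 i.
  rewrite /pairing (_ : map_mx _ _ = delta_mx 0 i) ?dot_delta //.
  by apply/rowP => j; rewrite !mxE; case: (_ && _); rewrite ?rmorph0 ?rmorph1.
have pNdl i : pairing (- dl i) x = - x 0 i.
  rewrite -pdl /pairing (_ : map_mx ratr (- dl i) = - map_mx ratr (dl i)) ?(dotC _ x)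
    ?dotNr //.
  by apply/rowP => j; rewrite !mxE rmorphN.
have sJ j l (y : V -> R) : slack (eJ j l) x y = pairing l (\row_i y (j, i)) - 1.
  rewrite slack_Ineq p0 add0r rmorph1; congr (_ - _).
  rewrite (bigID (fun v => v.1 == j)) /= [X in _ + X]big1 ?addr0; last first.
    by move=> v /negPf vj; rewrite vj mul0r rmorph0 mul0r.
  rewrite /pairing /dot (reindex_onto (fun i => (j, i)) snd) /=;
    last by move=> [a b] /= /eqP->.
  by apply: eq_big => [i|i _]; rewrite ?eqxx // !mxE mul1r.
have sV u (y : V -> R) : slack (eV u) x y = y u.
  rewrite slack_Ineq p0 add0r rmorph0 subr0.
  rewrite (bigD1 u) //= eqxx rmorph1 mul1r big1 ?addr0 // => v /negPf vw.
  by rewrite vw rmorph0 mul0r.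
have sG i (y : V -> R) : slack (eG i) x y = \sum_j y (j, i) - x 0 i.
  rewrite slack_Ineq pNdl rmorph0 subr0 addrC; congr (_ + _).
  rewrite (bigID (fun v => v.2 == i)) /= [X in _ + X]big1 ?addr0; last first.
    by move=> v /negPf vj; rewrite vj rmorph0 mul0r.
  rewrite (reindex_onto (fun j => (j, i)) fst) /=; last by move=> [a b] /= /eqP->.
  by apply: eq_big => [j|j _]; rewrite ?eqxx // rmorph1 mul1r.
have sL i (y : V -> R) : slack (eL i) x y = x 0 i - \sum_j y (j, i).
  rewrite -opprB -sG !slack_Ineq pdl pNdl rmorph0 !subr0 opprD opprK; congr (_ + _).
  by rewrite -sumrN; apply: eq_bigr => v _; rewrite rmorphN mulNr.
have SJ j l : l \in J j -> eJ j l \in S.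
  move=> lJ; rewrite mem_cat; apply/orP; left; apply/flattenP.
  exists [seq eJ j l | l <- J j]; last exact: map_f.
  by apply: (map_f (fun j => [seq eJ j l | l <- J j])); rewrite mem_enum.
have SV v : eV v \in S by rewrite !mem_cat; apply/or4P/Or42; rewrite map_f ?mem_enum.
have SL i : eL i \in S by rewrite !mem_cat; apply/or4P/Or43; rewrite map_f ?mem_enum.
have SG i : eG i \in S by rewrite !mem_cat; apply/or4P/Or44; rewrite map_f ?mem_enum.
split=> [[y yJ xE]|[y Sy]].
  have xi i : x 0 i = \sum_j y j 0 i by rewrite xE summxE.
  exists (fun v => y v.1 0 v.2) => e; rewrite !mem_cat => /or4P[].
  - case/flattenP => s /mapP[j _ ->] /mapP[l lJ ->]; rewrite sJ subr_ge0.
    have /upperP[_ /(_ l lJ)] := yJ j.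
    by rewrite (_ : \row_i _ = y j) //; apply/rowP => i; rewrite mxE.
  - by case/mapP => v _ ->; rewrite sV; have /upperP[] := yJ v.1.
  - by case/mapP => i _ ->; rewrite sL xi subrr.
  - by case/mapP => i _ ->; rewrite sG xi subrr.
exists (fun j => \row_i y (j, i)) => [j|].
  apply/upperP; split=> [i|l lJ]; first by rewrite mxE -sV Sy.
  by rewrite -subr_ge0 -sJ Sy ?SJ.
apply/rowP => i; rewrite summxE.
have -> : \sum_j (\row_i y (j, i)) 0 i = \sum_j y (j, i) by apply: eq_bigr => j _;
  rewrite mxE.
by apply/eqP; rewrite eq_le -subr_ge0 -sG -[X in _ && X]subr_ge0 -sL !Sy.
Qed.

(** As the sum is stable under adding nonnegative vectors, the inequalities
    that describe it have nonnegative coefficients; those with a positive right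
    hand side even have positive coefficients, because the sum meets all
    coordinate axes, and the others follow from nonnegativity. *)
Lemma msum_upper : (0 < p)%N -> (0 < n)%N ->
  (forall j, J j != [::] /\ forall l, l \in J j -> positive_form l) ->
  exists JS, [/\ JS != [::], forall l, l \in JS -> positive_form l &
    Defs.msum (fun j => @upper R n (J j)) = upper JS].
Proof.
move=> p0 n0 JP; have [C CE] := msum_inequalities.
have J0 j l : l \in J j -> positive_form l by case: (JP j) => _; apply.
pose Q := Defs.msum (fun j => @upper R n (J j)).
have j0 : 'I_p := Ordinal p0; have i0 : 'I_n := Ordinal n0.
have Qadd x y : Q x -> orthant y -> Q (x + y).
  move=> [z zJ ->] y0; exists (fun j => z j + (j == j0)%:R *: y).
    by move=> j; apply: upper_add => // [l|i]; [exact: J0|rewrite mxE mulr_ge0 ?ler0n].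
  rewrite big_split /=; congr (_ + _); rewrite (bigD1 j0) //= eqxx scale1r big1 ?addr0 //.
  by move=> j /negPf->; rewrite scale0r.
have Qpos x : Q x -> orthant x.
  move=> [z zJ ->] i; rewrite summxE; apply: sumr_ge0 => j _.
  by have /upperP[] := zJ j.
have [c cJ] : exists c : 'I_p -> R, forall j, 0 < c j /\ forall i, upper (J j) (c j *:
  delta_mx 0 i).
  have /choice[c cP] : forall j, exists c : R, 0 < c /\ forall i, upper (J j) (c *:
    delta_mx 0 i).
    by move=> j; have [c c0 cP] := @upper_axis R n (J j) (@J0 j); exists c.
  by exists c.
pose a := \sum_j c j.
have Qax i : Q (a *: delta_mx 0 i).
  by exists (fun j => c j *: delta_mx 0 i); [move=> j; case: (cJ j)|rewrite scaler_suml].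
have Q0 : ~ Q 0.
  move=> [z zJ z0]; have zE i : z j0 0 i = 0.
    have := congr1 (fun x : 'rV_n => x 0 i) z0; rewrite summxE mxE => /esym /eqP.
    rewrite psumr_eq0 => [/allP/(_ j0)|j _]; last by have /upperP[] := zJ j.
    by rewrite mem_index_enum => /(_ isT) /eqP.
  have := JP j0;
    case: (J j0) (zJ j0) => [_ []//|l s /upperP[_ /(_ l (mem_head _ _))] h _].
  by move: h; rewrite /pairing /dot big1 ?ler10 // => i _; rewrite zE mulr0.
have delta0 i : @orthant R n (delta_mx 0 i) by move=> j; rewrite mxE ler0n.
have pd e i (t : R) : pairing e (t *: delta_mx 0 i) = ratr (e 0 i) * t.
  by rewrite /pairing dotZr dotC dot_delta mxE mulrC.
have C0 e : e \in C -> forall i, 0 <= e.1 0 i.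
  move=> eC i; rewrite leNgt; apply/negP => ei.
  have ei' : ratr (e.1 0 i) < 0 :> R by rewrite ltrq0.
  pose b : R := pairing e.1 (a *: delta_mx 0 i0) - ratr e.2.
  have b0 : 0 <= b by rewrite subr_ge0; exact: (CE _).1 (Qax i0) e eC.
  pose t := (b + 1) / - ratr (e.1 0 i).
  have t0 : 0 <= t by apply: divr_ge0; [exact: addr_ge0|rewrite oppr_ge0 ltW].
  have := (CE _).1 (Qadd _ (t *: delta_mx 0 i) (Qax i0) _) e eC.
  have -> : pairing e.1 (a *: delta_mx 0 i0 + t *: delta_mx 0 i) = b + ratr e.2 - (b + 1).
    have pdt : dot (map_mx ratr e.1) (t *: delta_mx 0 i) = ratr (e.1 0 i) * t by exact:
      pd.
    rewrite /pairing dotDr pdt; congr (_ + _); first by rewrite /b subrK.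
    by rewrite /t; field; rewrite lt_eqF.
  move=> h; have : ratr e.2 <= b + ratr e.2 - (b + 1) :> R.
    by apply: h => j; rewrite mxE mulr_ge0 ?delta0.
  lra.
pose JS := [seq e.2^-1 *: e.1 | e <- C & 0 < e.2].
have pS (e : 'rV[rat]_n * rat) (x : 'rV[R]_n) : pairing (e.2^-1 *: e.1) x = (ratr
  e.2)^-1 * pairing e.1 x.
  rewrite /pairing (_ : map_mx _ _ = (ratr e.2)^-1 *: map_mx ratr e.1) ?(dotC _ x)
    ?dotZr //.
  by apply/rowP => i; rewrite !mxE rmorphM fmorphV.
have JSpos l : l \in JS -> positive_form l.
  case/mapP => e; rewrite mem_filter => /andP[e0 eC] -> i.
  rewrite mxE mulr_gt0 ?invr_gt0 // lt_neqAle C0 // andbT eq_sym; apply/eqP => ei.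
  have := (CE _).1 (Qax i) e eC; rewrite pd ei rmorph0 mul0r leNgt => /negP; apply.
  by rewrite ltr0q.
have QE : Q = upper JS.
  apply/seteqP; split=> x.
    move=> Qx; apply/upperP; split; first exact: Qpos.
    move=> l /mapP[e]; rewrite mem_filter => /andP[e0 eC] ->.
    rewrite pS mulrC ler_pdivlMr ?ltr0q // mul1r; exact: (CE x).1 Qx e eC.
  move=> /upperP[x0 xJ]; apply/CE => e eC.
  have [e0|e0] := ltP 0 e.2.
    have := xJ (e.2^-1 *: e.1); rewrite pS mulrC ler_pdivlMr ?ltr0q // mul1r; apply.
    by apply: (map_f (fun e : 'rV[rat]_n * rat => e.2^-1 *: e.1)); rewrite mem_filter e0.
  apply: (@le_trans _ _ 0); first by rewrite lerq0.
  by apply: dot_ge0 => // i; rewrite mxE ler0q C0.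
exists JS; split=> //; apply/eqP => JS0; apply: Q0; rewrite QE JS0.
by apply/upperP; split=> // i; rewrite mxE.
Qed.

End MinkowskiSum.

(** A face of the polyhedron is compact exactly when the form it minimizes is
    positive, and a positive form is minimized only where some constraint of
    the presentation is tight. *)
Lemma diagram_sum_presents (R : realType) (n p : nat) (D : 'I_p -> set 'rV[R]_n)
    (J : 'I_p -> seq 'rV[rat]_n) : (0 < p)%N -> (0 < n)%N ->
  (forall j, presents (J j) (D j)) ->
  exists2 JS, presents JS (diagram_sum D) &
    Defs.msum (fun j => @upper R n (J j)) = upper JS.
Proof.
move=> p0 n0 DJ; have [j|JS [JSn JS0 JSE]] := @msum_upper R n p J p0 n0.
  by case: (DJ j).
exists JS => //; split=> //.
have QE : Defs.msum (fun j => [set nu + u | nu in D j & u in @orthant R n]) = upper JS.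
  rewrite -JSE; congr Defs.msum; apply/funext => j.
  by have [Jn J0 ->] := DJ j; apply: upper_diagram.
rewrite /diagram_sum QE; apply/seteqP; split=> x.
  case=> E [[_ [u EE]] cE Ex].
  have [Qx xmin] : minimizes u (upper JS) x by move: Ex; rewrite EE.
  have line i (t : R) : 0 <= t -> upper JS (x + t *: delta_mx 0 i).
    by move=> t0; apply: upper_add => // j; rewrite !mxE mulr_ge0 // ler0n.
  have ud i (t : R) : dot u (x + t *: delta_mx 0 i) = dot u x + t * u 0 i.
    by rewrite dotDr dotZr (dotC u (delta_mx 0 i)) dot_delta.
  apply/diagramP; split=> //; apply: (@minimizer_tight _ _ _ u) => // i.
  have ui : 0 <= u 0 i.
    by have := xmin _ (line i 1 ler01); rewrite ud mul1r lerDl.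
  rewrite lt_neqAle ui andbT eq_sym; apply/eqP => ui0.
  have Et t : 0 <= t -> E (x + t *: delta_mx 0 i).
    move=> t0; rewrite EE; split; first exact: line.
    by move=> y Qy; rewrite ud ui0 mulr0 addr0; exact: xmin.
  have [M [_ /(_ (`|M| + 1))]] := compact_bounded cE.
  have M1 : M < `|M| + 1 by rewrite (le_lt_trans (ler_norm M)) // ltrDl.
  move=> /(_ M1) EM.
  have x0 : 0 <= x 0 i by have /upperP[] := Qx.
  have t0 : 0 <= `|M| + 2 by rewrite addr_ge0.
  have := le_trans (coord_le_norm _ i) (EM _ (Et _ t0)).
  rewrite !mxE !eqxx mulr1 ger0_norm ?addr_ge0 //; lra.
move=> /diagramP[Jx [l lJ lx]].
exists [set y | upper JS y /\ pairing l y = 1]; split=> //; last first.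
- have -> : [set y | upper JS y /\ pairing l y = 1] =
            polyhedron ((- map_mx ratr l, - 1) :: upper_constraints R JS).
    apply/seteqP; split=> y.
      move=> [Jy ly] c; rewrite inE => /orP[/eqP->|/Jy//].
      by rewrite /= dotC dotNr dotC -/(pairing l y) ly.
    move=> yC; have Jy : upper JS y by move=> c cC; apply: yC; rewrite inE cC orbT.
    split=> //; apply/eqP; rewrite eq_le; have /upperP[_ /(_ l lJ) ->] := Jy.
    have := yC _ (mem_head _ _); rewrite /= dotC dotNr dotC lerN2 => le.
    by rewrite andbT.
  apply: (@polyhedron_compact _ _ _ (\sum_i (ratr (l 0 i) : R)^-1)) => y yC i.
  have /upperP[y0 _] : upper JS y by move=> c cC; apply: yC; rewrite inE cC orbT.
  have li k : 0 < (ratr (l 0 k) : R) by rewrite ltr0q; apply: JS0.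
  rewrite ger0_norm //; apply: (@le_trans _ _ (ratr (l 0 i))^-1); last first.
    by rewrite (bigD1 i) //= lerDl sumr_ge0 // => k _; rewrite invr_ge0 ltW.
  rewrite -[_^-1]mul1r ler_pdivlMr //.
  have := yC _ (mem_head _ _); rewrite /= dotC dotNr dotC lerN2; apply: le_trans.
  rewrite /dot (bigD1 i) //= mxE mulrC lerDl sumr_ge0 // => k _.
  by rewrite mxE mulr_ge0 // ltW.
- split; first by exists x.
  exists (map_mx ratr l); apply/seteqP; split=> y [Jy].
    move=> ly; split=> // z /upperP[_ /(_ l lJ)].
    by rewrite -[dot _ y]/(pairing l y) ly.
  move=> /(_ x Jx); rewrite -[dot _ x]/(pairing l x) lx => ly; split=> //.
  by apply/eqP; rewrite eq_le ly; have /upperP[_ /(_ l lJ)] := Jy.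
Qed.

(** * Facets and the degree conditions *)

Section Facets.
Variables (R : realType) (n : nat).
Hypothesis n0 : (0 < n)%N.
Implicit Types (x y z u v : 'rV[R]_n) (J : seq 'rV[rat]_n) (l w : 'rV[rat]_n).

(** A subfamily of least size that cuts out the same polyhedron will do. *)
Lemma irredundant_forms J : exists J0,
  [/\ {subset J0 <= J}, @upper R n J0 = upper J &
    forall l, l \in J0 -> exists2 z, @upper R n [seq m <- J0 | m != l] z & pairing l z
      < 1].
Proof.
pose good k := `[< exists J0, [/\ {subset J0 <= J}, @upper R n J0 = upper J & size J0 =
  k] >].
have ex : exists k, good k by exists (size J); apply/asboolP; exists J; split.
case: (ex_minnP ex) => k /asboolP[J0 [sJ0 uJ0 szJ0]] kmin; exists J0; split=> // l lJ0.
apply: contrapT => no; pose J1 := [seq m <- J0 | m != l].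
have : good (size J1).
  apply/asboolP; exists J1; split=> // [m|]; first by rewrite mem_filter => /andP[_ /sJ0].
  rewrite -uJ0; apply/seteqP; split=> x /upperP[x0 xJ]; apply/upperP; split=> // m mJ.
    have [->|ml] := eqVneq m l; last by apply: xJ; rewrite mem_filter ml.
    rewrite leNgt; apply/negP => lx; apply: no; exists x => //.
    exact/upperP.
  by apply: xJ; move: mJ; rewrite mem_filter => /andP[].
move/kmin; rewrite -szJ0 leqNgt => /negP; apply.
by rewrite size_filter -(count_predC (fun m => m != l) J0) -[ltnLHS]addn0 ltn_add2l
  -has_count; apply/hasP; exists l; rewrite //= negbK.
Qed.

Lemma row_free_scale (m : nat) (B : 'M[R]_(m, n)) (d : 'I_m -> R) :
  (forall i, d i != 0) -> row_free B -> row_free (\matrix_i (d i *: row i B)).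
Proof.
move=> d0 Bf; have -> : \matrix_i (d i *: row i B) = diag_mx (\row_i d i) *m B.
  by apply/matrixP => i j; rewrite mul_diag_mx !mxE.
have dU : diag_mx (\row_i d i) \in unitmx.
  by rewrite unitmxE det_diag unitfE; apply/prodf_neq0 => i _; rewrite mxE.
by rewrite /row_free mxrankMfree // mxrank_unit.
Qed.

(** An irredundant form [l] is tight at a point [q] where no other constraint
    is: such a point lies on a segment from a point that violates [l] only to a
    point where all constraints are strict. Around [q] the face is a full
    neighbourhood of [q] in a hyperplane. *)
Lemma irredundant_point J l : l \in J -> (forall m, m \in J -> positive_form m) ->
  (exists2 z, @upper R n [seq m <- J | m != l] z & pairing l z < 1) ->
  exists q : 'rV[R]_n, [/\ forall i, 0 < q 0 i, pairing l q = 1 &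
    forall m, m \in J -> m != l -> 1 < pairing m q].
Proof.
move=> lJ J0 [z /upperP[z0 zJ] lz].
have [c c0 cJ] := @upper_axis R n J J0.
pose u : 'rV[R]_n := const_mx (2 * c).
have i0 : 'I_n := Ordinal n0.
have u0 i : 0 < u 0 i by rewrite mxE mulr_gt0.
have uJ m : m \in J -> 1 < pairing m u.
  move=> mJ; have /upperP[_ /(_ m mJ)] := cJ i0.
  rewrite /pairing dotZr dotC dot_delta => h.
  have : dot (map_mx ratr m) ((2 * c) *: delta_mx 0 i0) <= dot (map_mx ratr m) u.
    rewrite ![dot (map_mx _ _) _]dotC; apply: dot_le => [i|i];
      first by rewrite mxE ler0q ltW // J0.
    rewrite !mxE; case: (_ && _); rewrite ?mulr1 ?mulr0 // mulr_ge0 // ltW //.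
  apply: lt_le_trans; rewrite dotZr dotC dot_delta; lra.
pose s := (1 - pairing l z) / (pairing l u - pairing l z).
have den : 0 < pairing l u - pairing l z by have := uJ l lJ; lra.
have s0 : 0 < s by rewrite divr_gt0 // subr_gt0.
have s1 : s < 1 by rewrite ltr_pdivrMr // mul1r; have := uJ l lJ; lra.
pose q := (1 - s) *: z + s *: u.
have pq m : pairing m q = (1 - s) * pairing m z + s * pairing m u by rewrite /pairing
  dotDr !dotZr.
exists q; split=> [i||m mJ ml].
- rewrite !mxE; have := z0 i; have : 0 < s * u 0 i by rewrite mulr_gt0.
  rewrite mxE => su zi; apply: ltr_wpDl => //; rewrite mulr_ge0 //; lra.
- rewrite pq;
  have sE : s * (pairing l u - pairing l z) = 1 - pairing l z by rewrite divfK ?gt_eqF.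
  lra.
rewrite pq; have zm : 1 <= pairing m z by apply: zJ; rewrite mem_filter ml.
have um := uJ m mJ.
have h1 : 0 <= (1 - s) * (pairing m z - 1) by rewrite mulr_ge0 // subr_ge0 // ltW.
have h2 : 0 < s * (pairing m u - 1) by rewrite mulr_gt0 // subr_gt0.
lra.
Qed.

Section Presented.
Variables (J : seq 'rV[rat]_n) (D : set 'rV[R]_n) (P : set 'rV[rat]_n).
Hypothesis JD : presents J D.
Hypothesis DP : weight_system D P.

(** The facet of an irredundant form [l] is a neighbourhood of a point in the
    hyperplane where [l] is 1. Its weight vector is constant there, so that it is
    proportional to [l]. *)
Lemma facet_forms : exists J0,
  [/\ {subset J0 <= J}, @upper R n J0 = upper J &
    forall l, l \in J0 -> exists2 w, P w & exists c : R,
      [/\ 0 < c, forall x, pairing w x = c * pairing l x & wdeg w D = c%:E]].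
Proof.
have [Jn J0 DE] := JD; have [J1 [sJ1 uJ1 irr]] := irredundant_forms J.
exists J1; split=> // l lJ1; have lJ := sJ1 l lJ1.
have J10 m : m \in J1 -> positive_form m by move/sJ1/J0.
have [q [q0 lq qJ]] := irredundant_point lJ1 J10 (irr l lJ1).
have Jq : upper J q.
  rewrite -uJ1; apply/upperP; split=> [i|m mJ]; first exact: ltW.
  by have [->|/(qJ m mJ)/ltW//] := eqVneq m l; rewrite lq.
pose Delta := [set x : 'rV[R]_n | upper J x /\ pairing l x = 1].
have Dq : Delta q by split.
have DeltaD x : Delta x -> D x by move=> [Jx lx]; rewrite DE; apply/diagramP;
  split=> //; exists l.
have step v : pairing l v = 0 -> exists2 d, 0 < d & Delta (q + d *: v).
  move=> lv; have Jq1 : upper J1 q by rewrite uJ1.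
  have [e|d d0 /(_ d)] := small_step (v := v) Jq1.
    rewrite mem_cat => /orP[/mapP[m mJ ->]|/mapP[i _ ->]] /=.
      have [->|ml mq] := eqVneq m l; first by rewrite -[dot _ v]/(pairing l v) lv.
      by have := qJ m mJ ml; rewrite /pairing mq ltxx.
    by rewrite dot_delta => qi; have := q0 i; rewrite qi ltxx.
  rewrite lexx ltW // => /(_ isT) h; exists d => //; split; first by rewrite -uJ1.
  by rewrite /pairing dotDr dotZr -[dot _ v]/(pairing l v) lv mulr0 addr0.
have ln0 : (map_mx ratr l : 'rV[R]_n) != 0.
  apply/eqP => l0; have : pairing l q = 0 by rewrite /pairing l0 dotC dot0r.
  by rewrite lq => /eqP; rewrite oner_eq0.
have pE (x : 'rV[R]_n) : x *m (map_mx ratr l)^T = (pairing l x)%:M.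
  apply/rowP => i; rewrite !mxE ord1 eqxx mulr1n /pairing /dot.
  by apply: eq_bigr => k _; rewrite !mxE mulrC.
have rk : \rank (kermx (map_mx ratr l : 'rV[R]_n)^T) = n.-1.
  by rewrite mxrank_ker mxrank_tr rank_rV ln0 subn1.
have fD : facet D Delta.
  split.
    exists J, [set: 'I_n]%SET, [:: l]; split=> //.
    - by move=> m; rewrite inE => /eqP->.
    - by exists q.
    apply/seteqP; split=> x.
      move=> Dx; split; first exact: DeltaD.
        by move=> i; rewrite inE.
      by move=> m; rewrite inE => /eqP->; case: Dx.
    by move=> [Dx _ /(_ l (mem_head _ _)) lx]; split=> //; move: Dx;
      rewrite DE => /diagram_upper.
  split.
    pose B0 := row_base (kermx (map_mx ratr l : 'rV[R]_n)^T).
    have [B [Bf BE]] : exists B : 'M[R]_(n.-1, n), row_free B /\ forall i, pairing l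
      (row i B) = 0.
      rewrite -rk; exists B0; split; first exact: row_base_free.
      move=> i; have : row i B0 *m (map_mx ratr l)^T = 0.
        by apply/sub_kermxP; apply: submx_trans (row_sub i B0) _; rewrite eq_row_base.
      by rewrite pE => /matrixP/(_ 0 0); rewrite !mxE eqxx mulr1n.
    have /choice[d dP] : forall i, exists d, d != 0 /\ Delta (q + d *: row i B).
      by move=> i; have [d d0 dD] := step _ (BE i); exists d; rewrite gt_eqF.
    exists q, (\matrix_i (d i *: row i B)); split=> // [i|].
      by rewrite rowK; case: (dP i).
    by apply: row_free_scale => // i; case: (dP i).
  case=> x0 [M [[_ lx0] MD /eqP Mr]].
  suff /mxrankS : (M <= kermx (map_mx ratr l : 'rV[R]_n)^T)%MS by rewrite Mr rk ltnn.
  apply/sub_kermxP/row_matrixP => i; rewrite row_mul pE row0.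
  have [_] := MD i; rewrite /pairing dotDr => h.
  apply/matrixP => a b; rewrite !ord1 !mxE eqxx mulr1n.
  by move: lx0 h; rewrite /pairing => ->; lra.
have [w [[Pw wD] _]] := DP.2 _ fD.
have wd x : Delta x -> (pairing w x)%:E = wdeg w D by rewrite -wD => -[].
have [w0 _] := DP.1 w Pw.
exists w => //; exists (pairing w q); split; last by rewrite wd.
- rewrite /pairing /dot (bigD1 (Ordinal n0)) //= ltr_pwDl ?mulr_gt0 ?mxE ?ltr0q //.
  by apply: sumr_ge0 => i _; rewrite mxE; apply: mulr_ge0; rewrite ?ler0q ltW.
move=> x; pose v := x - pairing l x *: q.
have lv : pairing l v = 0 by rewrite /pairing dotBr dotZr -[dot _ q]/(pairing l q) lq
  mulr1 subrr.
have [d d0 Dd] := step v lv.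
have := etrans (wd _ Dd) (esym (wd _ Dq)); case;
  rewrite /pairing dotDr dotZr /v dotBr dotZr.
move/(congr1 (fun t => t - dot (map_mx ratr w) q)); rewrite addrAC subrr add0r => /eqP.
by rewrite mulf_eq0 gt_eqF //= subr_eq0 mulrC => /eqP.
Qed.

Lemma upper_of_degrees x : orthant x ->
  (forall w, P w -> (wdeg w D <= (pairing w x)%:E)%E) -> upper J x.
Proof.
move=> x0 xP; have [J0 [_ <- J0P]] := facet_forms; apply/upperP; split=> // l lJ0.
have [w Pw [c [c0 wl wD]]] := J0P l lJ0.
by have := xP w Pw; rewrite wD wl lee_fin ler_pMr.
Qed.

(** Where all irredundant forms exceed 1, a point can be moved a little towards
    the origin inside the polyhedron, whereas points of the diagram cannot. *)
Lemma notin_diagram_of_degrees x : orthant x ->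
  (forall w, P w -> (wdeg w D < (pairing w x)%:E)%E) -> ~ D x.
Proof.
move=> x0 xP; have [Jn Jpos ->] := JD; have [J0 [sJ0 uJ0 J0P]] := facet_forms.
move=> /diagramP[Jx [l lJ lx]]; have Jx0 : upper J0 x by rewrite uJ0.
have [c|d d0 /(_ d)] := small_step (v := - x) Jx0.
  rewrite mem_cat => /orP[/mapP[m mJ ->]|/mapP[i _ ->]] /=.
    have [w Pw [c' [c0 wl wD]]] := J0P m mJ.
    have := xP w Pw; rewrite wD wl lte_fin ltr_pMr // /pairing => mx mx1.
    by rewrite mx1 ltxx in mx.
  by rewrite dotNr => ->; rewrite oppr0.
rewrite lexx ltW // => /(_ isT); rewrite -/(upper J0) uJ0 => /upperP[_ /(_ l lJ)].
by move: lx; rewrite /pairing dotDr dotZr dotNr => ->; lra.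
Qed.

End Presented.
End Facets.

(** * The two ground fields *)

Section Ground.
Variables (R : realType) (k : ground).
Local Notation K := (ground_field R k).

Definition reK : K -> R :=
  match k return ground_field R k -> R with
  | RealK => fun z => z | ComplexK => fun z => complex.Re z end.

Definition imK : K -> R :=
  match k return ground_field R k -> R with
  | RealK => fun=> 0 | ComplexK => fun z => complex.Im z end.

Definition embK : R -> K :=
  match k return R -> ground_field R k with
  | RealK => fun t => t | ComplexK => fun t => Complex t 0 end.

Definition absK (z : K) : R := reK `|z|.

End Ground.

Section GroundTheory.
Variables (R : realType).

Lemma reKD k (x y : ground_field R k) : reK (x + y) = reK x + reK y.
Proof. by case: k x y => //= -[a b] [c d]. Qed.

Lemma imKD k (x y : ground_field R k) : imK (x + y) = imK x + imK y.
Proof. by case: k x y => //= [x y|[a b] [c d]//]; rewrite addr0. Qed.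

Lemma reKM k (x y : ground_field R k) : reK (x * y) = reK x * reK y - imK x * imK y.
Proof. by case: k x y => //= [x y|[a b] [c d]//]; rewrite mulr0 subr0. Qed.

Lemma imKM k (x y : ground_field R k) : imK (x * y) = reK x * imK y + imK x * reK y.
Proof. by case: k x y => //= [x y|[a b] [c d]//]; rewrite mulr0 mul0r addr0. Qed.

Lemma reKN k (x : ground_field R k) : reK (- x) = - reK x.
Proof. by case: k x => //= -[a b]. Qed.

Lemma imKN k (x : ground_field R k) : imK (- x) = - imK x.
Proof. by case: k x => //= [x|[a b]//]; rewrite oppr0. Qed.

Lemma reK0 k : reK (0 : ground_field R k) = 0. Proof. by case: k. Qed.
Lemma imK0 k : imK (0 : ground_field R k) = 0. Proof. by case: k. Qed.

Lemma reK_sum k (I : Type) (r : seq I) (P : pred I) (f : I -> ground_field R k) :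
  reK (\sum_(i <- r | P i) f i) = \sum_(i <- r | P i) reK (f i).
Proof. by apply: big_morph; [exact: reKD|exact: reK0]. Qed.

Lemma imK_sum k (I : Type) (r : seq I) (P : pred I) (f : I -> ground_field R k) :
  imK (\sum_(i <- r | P i) f i) = \sum_(i <- r | P i) imK (f i).
Proof. by apply: big_morph; [exact: imKD|exact: imK0]. Qed.

Lemma embKD k (a b : R) : embK k (a + b) = embK k a + embK k b.
Proof. by case: k => //=; apply/eqP; rewrite eq_complex /= addr0 !eqxx. Qed.

Lemma embKM k (a b : R) : embK k (a * b) = embK k a * embK k b.
Proof. by case: k => //=; apply/eqP;
  rewrite eq_complex /= !mulr0 mul0r subr0 addr0 !eqxx. Qed.

Lemma embK0 k : embK k (0 : R) = 0. Proof. by case: k. Qed.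
Lemma embK1 k : embK k (1 : R) = 1. Proof. by case: k. Qed.

Lemma embK_prod k (I : Type) (r : seq I) (P : pred I) (f : I -> R) :
  embK k (\prod_(i <- r | P i) f i) = \prod_(i <- r | P i) embK k (f i).
Proof. by apply: big_morph; [exact: embKM|exact: embK1]. Qed.

Lemma embKX k (a : R) m : embK k (a ^+ m) = embK k a ^+ m.
Proof. by elim: m => [|m IH]; rewrite ?expr0 ?embK1 // !exprS embKM IH. Qed.

Lemma reK_emb k (a : R) : reK (embK k a) = a. Proof. by case: k. Qed.
Lemma imK_emb k (a : R) : imK (embK k a) = 0. Proof. by case: k. Qed.

Lemma embK_eq0 k (a : R) : (embK k a == 0) = (a == 0).
Proof. by case: k => //=; rewrite eq_complex /= eqxx andbT. Qed.

Lemma reK_embM k (a : R) (x : ground_field R k) : reK (embK k a * x) = a * reK x.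
Proof. by rewrite reKM reK_emb imK_emb mul0r subr0. Qed.

Lemma absKE k (x : ground_field R k) : `|x| = embK k (absK x).
Proof.
by rewrite /absK; case: k x => //= x; apply/eqP; rewrite eq_complex /= !eqxx.
Qed.

Lemma embK_le k (a b : R) : (embK k a <= embK k b) = (a <= b).
Proof. by case: k => //=; rewrite lecE /= eqxx. Qed.

Lemma embK_lt k (a b : R) : (embK k a < embK k b) = (a < b).
Proof. by case: k => //=; rewrite ltcE /= eqxx. Qed.

Lemma absK_ge0 k (x : ground_field R k) : 0 <= absK x.
Proof. by rewrite -(embK_le k) embK0 -absKE. Qed.

Lemma embK_inj k : injective (@embK R k).
Proof. by move=> a b /(congr1 (@reK R k)); rewrite !reK_emb. Qed.

Lemma absKM k (x y : ground_field R k) : absK (x * y) = absK x * absK y.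
Proof. by apply: (@embK_inj k); rewrite embKM -!absKE normrM. Qed.

Lemma absK_add k (x y : ground_field R k) : absK (x + y) <= absK x + absK y.
Proof. by rewrite -(embK_le k) embKD -!absKE ler_normD. Qed.

Lemma absK_eq0 k (x : ground_field R k) : (absK x == 0) = (x == 0).
Proof. by rewrite -(embK_eq0 k) -absKE normr_eq0. Qed.

Lemma absK_gt0 k (x : ground_field R k) : (0 < absK x) = (x != 0).
Proof. by rewrite lt_neqAle absK_ge0 andbT eq_sym absK_eq0. Qed.

Lemma absK0 k : absK (0 : ground_field R k) = 0.
Proof. by apply/eqP; rewrite absK_eq0. Qed.

Lemma absK_sqr k (x : ground_field R k) : absK x ^+ 2 = reK x ^+ 2 + imK x ^+ 2.
Proof.
rewrite /absK; case: k x => /= [x|[a b]];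
  first by rewrite expr0n addr0 real_normK ?num_real.
by rewrite sqr_sqrtr // addr_ge0 ?sqr_ge0.
Qed.

Lemma absK_emb k (a : R) : absK (embK k a) = `|a|.
Proof.
by apply/eqP;
  rewrite -(@eqrXn2 _ 2) ?absK_ge0 // absK_sqr reK_emb imK_emb expr0n addr0 real_normK
    ?num_real.
Qed.

Lemma absKN k (x : ground_field R k) : absK (- x) = absK x.
Proof. by rewrite /absK normrN. Qed.

Lemma absK_re k (x : ground_field R k) : `|reK x| <= absK x.
Proof.
rewrite -(@ler_pXn2r _ 2) ?nnegrE ?absK_ge0 // absK_sqr real_normK ?num_real //.
by rewrite lerDl sqr_ge0.
Qed.

Lemma absK_im k (x : ground_field R k) : `|imK x| <= absK x.
Proof.
rewrite -(@ler_pXn2r _ 2) ?nnegrE ?absK_ge0 // absK_sqr real_normK ?num_real //.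
by rewrite lerDr sqr_ge0.
Qed.

Lemma absK_le k (x : ground_field R k) : absK x <= `|reK x| + `|imK x|.
Proof.
rewrite -(@ler_pXn2r _ 2) ?nnegrE ?absK_ge0 ?addr_ge0 // absK_sqr sqrrD.
rewrite -(real_normK (num_real (reK x))) -(real_normK (num_real (imK x))).
by rewrite addrAC lerDl mulrn_wge0 // mulr_ge0.
Qed.

Lemma ground_ext k (x y : ground_field R k) : reK x = reK y -> imK x = imK y -> x = y.
Proof. by case: k x y => //= -[a b] [c d] /= -> ->. Qed.

Section Convergence.
Variables (k : ground) (T : Type) (F : set_system T).
Hypothesis FF : Filter F.
Local Notation K := (ground_field R k).
Implicit Types (f : T -> K) (z : K).

Lemma cvgKP f z : f t @[t --> F] --> z <->
  forall e : R, 0 < e -> \forall t \near F, absK (z - f t) < e.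
Proof.
split=> [/cvgrPdist_lt h e e0|h].
  have {}h := h (embK k e); rewrite -(embK0 k) embK_lt in h.
  by apply: filterS (h e0) => t; rewrite absKE embK_lt.
apply/cvgrPdist_lt => e e0.
have eE : e = embK k (absK e) by rewrite -absKE gtr0_norm.
move: e0; rewrite eE -(embK0 k) embK_lt => /h.
by apply: filterS => t; rewrite absKE embK_lt.
Qed.

Lemma cvg_reK f z : f t @[t --> F] --> z -> reK (f t) @[t --> F] --> reK z.
Proof.
move=> /cvgKP h; apply/cvgrPdist_lt => e /h; apply: filterS => t.
by apply: le_lt_trans; rewrite -reKN -reKD absK_re.
Qed.

Lemma cvg_imK f z : f t @[t --> F] --> z -> imK (f t) @[t --> F] --> imK z.
Proof.
move=> /cvgKP h; apply/cvgrPdist_lt => e /h; apply: filterS => t.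
by apply: le_lt_trans; rewrite -imKN -imKD absK_im.
Qed.

Lemma cvg_ground f z : reK (f t) @[t --> F] --> reK z ->
  imK (f t) @[t --> F] --> imK z -> f t @[t --> F] --> z.
Proof.
move=> /cvgrPdist_lt hr /cvgrPdist_lt hi; apply/cvgKP => e e0.
have e2 : 0 < e / 2 by rewrite divr_gt0.
apply: filterS2 (hr _ e2) (hi _ e2) => t; rewrite -reKN -reKD -imKN -imKD => h1 h2.
by apply: le_lt_trans (absK_le _) _; lra.
Qed.

Lemma cvg_embK (f : T -> R) (a : R) : f t @[t --> F] --> a ->
  embK k (f t) @[t --> F] --> embK k a.
Proof.
move=> h; apply: cvg_ground; rewrite ?reK_emb ?imK_emb.
  by under eq_cvg do rewrite reK_emb.
by under eq_cvg do rewrite imK_emb; exact: cvg_cst.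
Qed.

End Convergence.

End GroundTheory.

Section Coordinates.
Variables (R : realType) (n : nat).

(** A variable and its conjugate carry the same weight. *)
Definition var_index (k : ground) : 'I_(rdim k n) -> 'I_n :=
  match k return 'I_(rdim k n) -> 'I_n with
  | RealK => fun i => i
  | ComplexK => fun i => match @fintype.split n n i with inl a => a | inr a => a end
  end.

Definition scale_point k (s : 'I_n -> R) (x : 'rV[ground_field R k]_n) :
  'rV[ground_field R k]_n := \row_i (embK k (s i) * x 0 i).

Lemma cvg_exprn (C : numFieldType) (T : Type) (F : set_system T) (FF : Filter F)
    (f : T -> C) (l : C) m : f t @[t --> F] --> l -> f t ^+ m @[t --> F] --> l ^+ m.
Proof.
move=> fl; elim: m => [|m IH]; first by under eq_cvg do rewrite expr0; exact: cvg_cst.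
by under eq_cvg do rewrite exprS; rewrite exprS; exact: cvgM.
Qed.

Lemma formal_scale k s (x : 'rV[ground_field R k]_n) i :
  formal_point (scale_point s x) i = embK k (s (var_index i)) * formal_point x i.
Proof.
case: k x i => /= x i; first by rewrite mxE.
case: fintype.split => a; rewrite mxE // rmorphM /=; congr (_ * _).
by rewrite oppr0.
Qed.

Lemma exponentE k (m : multinom (rdim k n)) a :
  exponent R m 0 a = \sum_(i | var_index i == a) (m i)%:R.
Proof.
case: k m => m; rewrite mxE /=; first by rewrite (eq_bigl (pred1 a)) ?big_pred1_eq.
rewrite big_split_ord /= natrD; congr (_ + _).
  rewrite (eq_bigl (pred1 a)) ?big_pred1_eq // => i.
  by rewrite -[lshift n i]/(unsplit (inl i)) unsplitK.
rewrite (eq_bigl (pred1 a)) ?big_pred1_eq // => i.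
by rewrite -[rshift n i]/(unsplit (inr i)) unsplitK.
Qed.

Lemma exponent_ge0 k (m : multinom (rdim k n)) : @orthant R n (exponent R m).
Proof. by move=> a; rewrite exponentE sumr_ge0. Qed.

Lemma dot_exponent k (m : multinom (rdim k n)) (s : 'rV[R]_n) :
  dot s (exponent R m) = \sum_i s 0 (var_index i) * (m i)%:R.
Proof.
rewrite /dot (partition_big (@var_index k) predT) //=; apply: eq_bigr => a _.
rewrite exponentE mulr_sumr; apply: eq_big => [i|i /eqP->] //=.
Qed.

Lemma formal_cvg k (T : Type) (F : set_system T) (FF : Filter F)
    (f : T -> 'rV[ground_field R k]_n) (y : 'rV[ground_field R k]_n) i :
  (forall a, f t 0 a @[t --> F] --> y 0 a) ->
  formal_point (f t) i @[t --> F] --> formal_point y i.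
Proof.
case: k f y i => /= f y i fy; first exact: fy.
case: fintype.split => a; first exact: fy.
apply/(@cvgKP R ComplexK T F FF) => e e0.
apply: filterS ((@cvgKP R ComplexK T F FF _ _).1 (fy a) e e0) => t.
suff -> : absK (k := ComplexK) (conjc (y 0 a) - conjc (f t 0 a)) =
          absK (k := ComplexK) (y 0 a - f t 0 a) by [].
apply/eqP; rewrite -(@eqrXn2 _ 2) ?absK_ge0 // !absK_sqr /=.
by case: (y 0 a) => u v; case: (f t 0 a) => u' v' /=; apply/eqP; ring.
Qed.

Lemma of_realK k : cancel (@of_real R k n) (@to_real R k n).
Proof.
case: k => //= u; rewrite -[RHS]hsubmxK; congr row_mx.
  by apply/rowP => i; rewrite !mxE.
by apply/rowP => i; rewrite !mxE.
Qed.

Lemma to_realK k : cancel (@to_real R k n) (@of_real R k n).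
Proof.
case: k => //= x; apply/rowP => i; rewrite mxE row_mxKl row_mxKr !mxE.
by case: (x 0 i).
Qed.

Lemma to_real_sqr k (x : 'rV[ground_field R k]_n) :
  \sum_i to_real x 0 i ^+ 2 = \sum_a absK (x 0 a) ^+ 2.
Proof.
under [RHS]eq_bigr do rewrite absK_sqr.
case: k x => /= x; first by apply: eq_bigr => i _; rewrite expr0n addr0.
rewrite big_split_ord big_split /=; congr (_ + _); apply: eq_bigr => i _.
  by rewrite row_mxEl mxE.
by rewrite row_mxEr mxE.
Qed.

(** Covectors on the real vector space underlying K^n are represented by vectors
    of K^n, so that they can be rescaled componentwise like the map itself. *)
Lemma linear_form_re k (c : 'cV[R]_(rdim k n)) : exists a : 'rV[ground_field R k]_n,
  forall z, (to_real z *m c) 0 0 = reK (\sum_j a 0 j * z 0 j).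
Proof.
case: k c => c.
  exists c^T => z; rewrite mxE; apply: eq_bigr => j _; rewrite mxE; exact: mulrC.
exists (\row_j Complex (c (lshift n j) 0) (- c (rshift n j) 0)) => z.
rewrite mxE big_split_ord reK_sum; under [RHS]eq_bigr do rewrite reKM.
rewrite [RHS]big_split /=; congr (_ + _); apply: eq_bigr => j _.
  by rewrite row_mxEl !mxE /= mulrC.
by rewrite row_mxEr !mxE /=; ring.
Qed.

Lemma re_linear_form k (a : 'rV[ground_field R k]_n) : exists c : 'cV[R]_(rdim k n),
  forall z, (to_real z *m c) 0 0 = reK (\sum_j a 0 j * z 0 j).
Proof.
case: k a => a.
  exists a^T => z; rewrite mxE; apply: eq_bigr => j _; rewrite mxE; exact: mulrC.
exists (col_mx (map_mx (@complex.Re R) a)^T (- map_mx (@complex.Im R) a)^T) => z.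
rewrite mxE big_split_ord reK_sum; under [RHS]eq_bigr do rewrite reKM.
rewrite [RHS]big_split /=; congr (_ + _); apply: eq_bigr => j _.
  by rewrite row_mxEl col_mxEu !mxE /= mulrC.
by rewrite row_mxEr col_mxEd !mxE /=; ring.
Qed.

Lemma re_linear_form_eq0 k (a : 'rV[ground_field R k]_n) :
  (forall z : 'rV_n, reK (\sum_j a 0 j * z 0 j) = 0) -> a = 0.
Proof.
move=> h; apply/rowP => j; rewrite mxE; apply/eqP; rewrite -absK_eq0 -sqrf_eq0.
have aj (b : ground_field R k) : reK (a 0 j * b) = 0.
  have := h (b *: delta_mx 0 j); rewrite (bigD1 j) //= big1 ?addr0.
    by rewrite !mxE !eqxx mulr1.
  by move=> i /negPf ij; rewrite !mxE ij andbF !mulr0.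
rewrite absK_sqr; have := aj 1; rewrite mulr1 => ->; rewrite expr0n add0r.
case: k a h aj => /= a h aj; first by rewrite expr0n.
have := etrans (esym (@reKM R ComplexK (a 0 j) (Complex 0 1))) (aj (Complex 0 1)).
rewrite /= mulr0 sub0r mulr1 => /eqP.
by rewrite oppr_eq0 => /eqP->; rewrite expr0n.
Qed.

End Coordinates.

Section UltraLimits.
Variables (R : realType) (T : Type) (U : set_system T).
Hypothesis UF : UltraFilter U.

Lemma ultra_app (S : Type) (f : T -> S) : UltraFilter (f @ U).
Proof.
split=> [|G PG fG]; first exact: fmap_proper_filter.
apply/seteqP; split=> A //; last exact: fG.
move=> GA; have [//|nA] := in_ultra_setVsetC (f @^-1` A) UF.
exfalso; apply: (@filter_not_empty _ G); rewrite -(setICr A).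
by apply: filterI => //; exact: fG.
Qed.

Lemma ultra_cvg_bounded (f : T -> R) (M : R) : (\forall t \near U, `|f t| <= M) ->
  exists2 l, `|l| <= M & f t @[t --> U] --> l.
Proof.
move=> fM; have := @segment_compact R (- M) M; rewrite compact_ultra.
move=> /(_ (f @ U) (ultra_app f)) [|l [lM fl]].
  by apply: filterS fM => t; rewrite /= in_itv /= -ler_norml.
by exists l => //; move: lM; rewrite /= in_itv /= -ler_norml.
Qed.

Lemma ultra_cvg_ground k (f : T -> ground_field R k) (M : R) :
  (\forall t \near U, absK (f t) <= M) -> exists l : ground_field R k, f t @[t --> U]
    --> l.
Proof.
move=> fM.
have [|a _ fa] := @ultra_cvg_bounded (fun t => reK (f t)) M.
  by apply: filterS fM => t; apply: le_trans (absK_re _).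
have [|b _ fb] := @ultra_cvg_bounded (fun t => imK (f t)) M.
  by apply: filterS fM => t; apply: le_trans (absK_im _).
case: k f fM fa fb => f fM fa fb; first by exists a.
by exists (Complex a b); apply: (@cvg_ground R ComplexK).
Qed.

(** Because of this dichotomy no subsequences have to be extracted. *)
Lemma ultra_bounded_or_pinfty (f : T -> R) :
  (exists M, \forall t \near U, `|f t| <= M) \/
  (forall M, \forall t \near U, M < `|f t|).
Proof.
have [|no] := pselect (exists M, \forall t \near U, `|f t| <= M); first by left.
right=> M; have [h|h] := in_ultra_setVsetC [set t | `|f t| <= M] UF.
  by case: no; exists M.
by apply: filterS h => t /= /negP; rewrite -ltNge.
Qed.

End UltraLimits.

(** * Singular points of real and mixed polynomial maps *)

Section Singular.
Variables (R : realType).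

Lemma is_diff_sum (V W : normedModType R) (I : Type) (r : seq I)
    (f df : I -> V -> W) (x : V) : (forall i, is_diff x (f i) (df i)) ->
  is_diff x (\sum_(i <- r) f i) (\sum_(i <- r) df i).
Proof.
move=> h; elim: r => [|i r IH]; rewrite ?big_nil ?big_cons; first exact: is_diff_cst.
exact: is_diffD.
Qed.

Lemma is_diff_coord N (u : 'rV[R]_N) (j : 'I_N) :
  is_diff u (fun v : 'rV[R]_N => v 0 j : R) (fun v => v 0 j).
Proof.
have @f : {linear 'rV[R]_N -> R}.
  by exists (fun v : 'rV[R]_N => v 0 j); do 2![eexists]; do ?[constructor];
     rewrite ?mxE// => ? *; rewrite ?mxE//; move=> ?; rewrite !mxE.
have fc : continuous f by exact: coord_continuous.
rewrite (_ : (fun v : 'rV[R]_N => v 0 j) = f) //.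
by apply: DiffDef; [exact: linear_differentiable|rewrite diff_lin].
Qed.

Lemma is_diff_row N M (u : 'rV[R]_N) (G dG : 'rV[R]_N -> 'rV[R]_M) :
  (forall b, is_diff u (fun v => G v 0 b : R) (fun v => dG v 0 b)) -> is_diff u G dG.
Proof.
move=> h.
have E (H : 'rV[R]_N -> 'rV[R]_M) :
    H = \sum_b (fun v => H v 0 b *: (delta_mx 0 b : 'rV[R]_M)).
  by apply/funext => v; rewrite fct_sumE [LHS]row_sum_delta.
rewrite (E G) (E dG); apply: is_diff_sum => b.
exact: (@is_diff_comp _ _ _ _ _ _ _ _ u (h b) (is_diff_scalel _ _)).
Qed.

Variables (k : ground) (n : nat).
Local Notation K := (ground_field R k).
Local Notation N := (rdim k n).
Implicit Types (g : mpoly N K) (x h : 'rV[K]_n) (u v : 'rV[R]_N).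

(** The real differential of a mixed polynomial function, from the formal
    derivatives with respect to the variables and to their conjugates. *)
Definition dpoly g x h : K :=
  \sum_i meval (formal_point x) (mderiv i g) * formal_point h i.

(** Products mix real and imaginary parts, so that an induction has to
    differentiate both at the same time. *)
Definition has_dpoly g := forall u,
  is_diff u (fun v => reK (meval (formal_point (of_real v)) g))
            (fun v => reK (dpoly g (of_real u) (of_real v))) /\
  is_diff u (fun v => imK (meval (formal_point (of_real v)) g))
            (fun v => imK (dpoly g (of_real u) (of_real v))).

Lemma has_dpolyC (c : K) : has_dpoly (mpolyC N c).
Proof.
move=> u; have d0 v : dpoly (mpolyC N c) (of_real u) (of_real v) = 0.
  by rewrite /dpoly big1 // => i _; rewrite mderivC meval0 mul0r.
split.
  rewrite (_ : (fun v => reK (dpoly _ _ _)) = 0); last by apply/funext => v;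
    rewrite d0 reK0.
  rewrite (_ : (fun v => _) = cst (reK c)); first exact: is_diff_cst.
  by apply/funext => v; rewrite mevalC.
rewrite (_ : (fun v => imK (dpoly _ _ _)) = 0); last by apply/funext => v;
  rewrite d0 imK0.
rewrite (_ : (fun v => _) = cst (imK c)); first exact: is_diff_cst.
by apply/funext => v; rewrite mevalC.
Qed.

Lemma re_formal_coord i : exists (a : R) j, forall v : 'rV[R]_N,
  reK (formal_point (of_real v) i) = a * v 0 j.
Proof.
case: k i => /= i; first by exists 1, i => v; rewrite mul1r.
case: fintype.split => a; exists 1, (lshift n a) => v; rewrite mul1r !mxE //=.
Qed.

Lemma im_formal_coord i : exists (a : R) j, forall v : 'rV[R]_N,
  imK (formal_point (of_real v) i) = a * v 0 j.
Proof.
case: k i => /= i; first by exists 0, i => v; rewrite mul0r.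
case: fintype.split => a; first by exists 1, (rshift n a) => v; rewrite mul1r !mxE.
by exists (- 1), (rshift n a) => v; rewrite mulN1r !mxE.
Qed.

Lemma has_dpolyX i : has_dpoly (mpolyX K (mnm1 i)).
Proof.
move=> u; have dE v : dpoly (mpolyX K (mnm1 i)) (of_real u) (of_real v) = formal_point
  (of_real v) i.
  rewrite /dpoly (bigD1 i) //= big1 ?addr0 => [|j /negPf ji].
    rewrite mderivX mnm1E eqxx scale1r mevalX big1 ?mul1r // => l _.
    by rewrite mnmBE subnn expr0.
  by rewrite mderivX mnm1E eq_sym ji scale0r meval0 mul0r.
have lin (a : R) j : is_diff u (fun v : 'rV[R]_N => a * v 0 j) (fun v => a * v 0 j).
  exact: (is_diffZ a (is_diff_coord u j)).
split.
  have [a [j aE]] := re_formal_coord i.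
  rewrite [X in is_diff u X _](_ : _ = (fun v => a * v 0 j)); last first.
    by apply/funext => v; rewrite mevalXU aE.
  by rewrite [X in is_diff u _ X](_ : _ = (fun v => a * v 0 j)) //; apply/funext => v;
    rewrite dE aE.
have [a [j aE]] := im_formal_coord i.
rewrite [X in is_diff u X _](_ : _ = (fun v => a * v 0 j)); last first.
  by apply/funext => v; rewrite mevalXU aE.
by rewrite [X in is_diff u _ X](_ : _ = (fun v => a * v 0 j)) //; apply/funext => v;
  rewrite dE aE.
Qed.

Lemma dpolyD g g' x h : dpoly (g + g') x h = dpoly g x h + dpoly g' x h.
Proof.
rewrite /dpoly -big_split; apply: eq_bigr => i _.
by rewrite mderivD mevalD mulrDl.
Qed.

Lemma dpolyM g g' x h : dpoly (g * g') x h =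
  meval (formal_point x) g * dpoly g' x h + meval (formal_point x) g' * dpoly g x h.
Proof.
rewrite /dpoly !mulr_sumr -big_split; apply: eq_bigr => i _ /=.
by rewrite mderivM mevalD !mevalM; ring.
Qed.

Lemma dpolyZ (c : K) g x h : dpoly (c *: g) x h = c * dpoly g x h.
Proof.
by rewrite /dpoly mulr_sumr; apply: eq_bigr => i _; rewrite mderivZ mevalZ mulrA.
Qed.

Lemma has_dpolyD g g' : has_dpoly g -> has_dpoly g' -> has_dpoly (g + g').
Proof.
move=> hg hg' u; have [r1 i1] := hg u; have [r2 i2] := hg' u; split.
  have := is_diffD r1 r2; congr (is_diff _ _ _); apply/funext => v.
    by rewrite mevalD reKD.
  by rewrite dpolyD reKD.
have := is_diffD i1 i2; congr (is_diff _ _ _); apply/funext => v.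
  by rewrite mevalD imKD.
by rewrite dpolyD imKD.
Qed.

Lemma has_dpolyM g g' : has_dpoly g -> has_dpoly g' -> has_dpoly (g * g').
Proof.
move=> hg hg' u; have [r1 i1] := hg u; have [r2 i2] := hg' u; split.
  have := is_diffB (is_diffM r1 r2) (is_diffM i1 i2); congr (is_diff _ _ _);
    apply/funext => v.
    by rewrite mevalM reKM.
  by rewrite dpolyM reKD !reKM !fctE /GRing.scale /=; ring.
have := is_diffD (is_diffM r1 i2) (is_diffM i1 r2); congr (is_diff _ _ _);
  apply/funext => v.
  by rewrite mevalM imKM.
by rewrite dpolyM imKD !imKM !fctE /GRing.scale /=; ring.
Qed.

Lemma has_dpoly_all g : has_dpoly g.
Proof.
have hX m : has_dpoly (mpolyX K m).
  rewrite mpolyXE_id; elim/big_rec: _ => [|i g' _ hg']; first exact: has_dpolyC.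
  apply: has_dpolyM => //; elim: (m i) => [|d IH]; first by rewrite expr0;
    exact: has_dpolyC.
  by rewrite exprS; apply: has_dpolyM => //; exact: has_dpolyX.
elim/mpolyind: g => [|c m g _ _ hg]; first by rewrite -mpolyC0; exact: has_dpolyC.
by apply: has_dpolyD => //; rewrite -mul_mpolyC; apply: has_dpolyM => //;
  exact: has_dpolyC.
Qed.

End Singular.

Definition dmap R k n p (f : poly_map R k n p) x h : 'rV[ground_field R k]_p :=
  \row_j dpoly (f j) x h.

Lemma is_diff_poly_map R k n p (f : poly_map R k n p) u :
  is_diff u (@to_real R k p \o peval f \o @of_real R k n)
            (fun v => to_real (dmap f (of_real u) (of_real v))).
Proof.
apply: is_diff_row => b; case: k f u b => f u b.
  have := (has_dpoly_all (f b) u).1; congr (is_diff _ _ _); apply/funext => v /=;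
    by rewrite mxE.
rewrite -(splitK b); case: (fintype.split b) => j.
  have := (has_dpoly_all (f j) u).1; congr (is_diff _ _ _); apply/funext => v;
    by rewrite /= row_mxEl !mxE.
have := (has_dpoly_all (f j) u).2; congr (is_diff _ _ _); apply/funext => v;
  by rewrite /= row_mxEr !mxE.
Qed.

(** A point is singular when some nonzero real linear form vanishes on the image
    of the differential; such forms are the real parts of K-linear forms. *)
Lemma singularP (R : realType) k n p (f : poly_map R k n p) x :
  singular_locus f x <-> exists2 a : 'rV[ground_field R k]_p, a != 0 &
    forall h, reK (\sum_j a 0 j * dpoly (f j) x h) = 0.
Proof.
set G := @to_real R k p \o peval f \o @of_real R k n.
have dG : is_diff (to_real x) G (fun v => to_real (dmap f x (of_real v))).
  by have := is_diff_poly_map f (to_real x); rewrite to_realK.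
have JE v : v *m jacobian G (to_real x) = to_real (dmap f x (of_real v)).
  by rewrite /jacobian mul_rV_lin1 diff_val.
have dE (c : 'cV[R]_(rdim k p)) (a : 'rV_p) :
    (forall z, (to_real z *m c) 0 0 = reK (\sum_j a 0 j * z 0 j)) ->
    jacobian G (to_real x) *m c = 0 <-> forall h, reK (\sum_j a 0 j * dpoly (f j) x h)
      = 0.
  move=> cE; split=> [Jc h|ah].
    have := congr1 (fun A => (to_real h *m A) 0 0) Jc.
    rewrite /= mulmx0 mulmxA JE to_realK cE mxE => <-; congr reK.
    by apply: eq_bigr => j _; rewrite mxE.
  apply/row_matrixP => i; rewrite rowE mulmxA JE row0.
  apply/matrixP => a' b'; rewrite !ord1 cE mxE -[RHS](ah (of_real (delta_mx 0 i))).
  by congr reK; apply: eq_bigr => j _; rewrite mxE.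
split=> [sing|[a a0 ah]].
  have : ~~ row_free (jacobian G (to_real x))^T.
    by rewrite /row_free mxrank_tr ltn_eqF.
  rewrite -kermx_eq0 => /rowV0Pn[c /sub_kermxP ck c0].
  have [a aE] := linear_form_re c^T; exists a.
    apply: contra c0 => /eqP a0; apply/eqP/trmx_inj; rewrite trmx0.
    apply/colP => i; rewrite mxE; have := aE (of_real (delta_mx 0 i)).
    rewrite of_realK -rowE !mxE => ->.
    by rewrite a0 big1 ?reK0 // => j _; rewrite mxE mul0r.
  apply/(dE _ _ aE); apply: trmx_inj; by rewrite trmx_mul trmxK ck trmx0.
have [c cE] := re_linear_form a.
have /(dE _ _ cE) Jc := ah.
rewrite /singular_locus /= ltn_neqAle rank_leq_col andbT; apply/eqP => full.
have /row_freeP[B JB] : row_free (jacobian G (to_real x))^T by rewrite /row_free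
  mxrank_tr full.
have c0 : c = 0.
  have := congr1 (fun A => B^T *m A) Jc; rewrite /= mulmx0 mulmxA.
  by rewrite -(trmxK (jacobian _ _)) -trmx_mul JB trmx1 mul1mx.
case/eqP: a0; apply: re_linear_form_eq0 => z.
by rewrite -cE c0 mulmx0 mxE.
Qed.

(** * Real-analytic coefficients *)

Section Analytic.
Variable R : realType.

Lemma dist_lim_le k (S : nat -> ground_field R k) (l b : ground_field R k) (B : R) :
  S N @[N --> \oo] --> l -> (\forall N \near \oo, absK (S N - b) <= B) -> absK (l - b)
    <= B.
Proof.
move=> /cvgKP Sl SB; apply/ler_addgt0Pr => e e0.
have [N [h1 h2]] := filter_ex (filterI (Sl e e0) SB).
rewrite -(subrK (S N) l) -addrA; apply: le_trans (absK_add _ _) _.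
by rewrite (addrC B); apply: lerD => //; exact: ltW.
Qed.

Lemma geometric_sum_le (q : R) d : 0 <= q <= 1 / 2 -> \sum_(j < d) q ^+ j <= 2.
Proof.
move=> /andP[q0 q2]; suff : \sum_(j < d) q ^+ j + 2 * q ^+ d <= 2.
  by apply: le_trans; rewrite lerDl mulr_ge0 // exprn_ge0.
elim: d => [|d IH]; first by rewrite big_ord0 expr0; lra.
rewrite big_ord_recr /= exprS; have := exprn_ge0 d q0.
have : q * q ^+ d <= 1 / 2 * q ^+ d by rewrite ler_wpM2r ?exprn_ge0.
lra.
Qed.

Lemma power_series_tail (c : nat -> R) (r M u : R) m N : 0 < r -> `|u| <= r / 2 ->
  (forall i, `|c i * r ^+ i| <= M) -> (m <= N)%N ->
  `|\sum_(i < N) c i * u ^+ i - \sum_(i < m) c i * u ^+ i| <= 2 * M * (`|u| / r) ^+ m.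
Proof.
move=> r0 ur cM mN; pose q := `|u| / r.
have q0 : 0 <= q by rewrite divr_ge0 // ltW.
have q2 : q <= 1 / 2 by rewrite ler_pdivrMr //; lra.
have M0 : 0 <= M by apply: le_trans (cM 0%N).
have -> : \sum_(i < N) c i * u ^+ i =
    \sum_(i < m) c i * u ^+ i + \sum_(i < N - m) c (m + i)%N * u ^+ (m + i).
  by rewrite -[in LHS](subnKC mN) big_split_ord.
rewrite addrC addKr.
apply: le_trans (ler_norm_sum _ _ _) _.
have ct i : `|c i * u ^+ i| <= M * q ^+ i.
  have -> : `|c i * u ^+ i| = `|c i * r ^+ i| * q ^+ i.
    rewrite !normrM !normrX (gtr0_norm r0) /q expr_div_n -mulrA; congr (_ * _).
    by rewrite mulrCA divff ?mulr1 // expf_neq0 // gt_eqF.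
  by rewrite ler_wpM2r // exprn_ge0.
apply: (@le_trans _ _ (\sum_(i < N - m) M * q ^+ m * q ^+ i)).
  by apply: ler_sum => i _; apply: le_trans (ct _) _; rewrite exprD mulrA.
rewrite -mulr_sumr; apply: le_trans (ler_wpM2l _ (geometric_sum_le _ _)) _.
- by rewrite mulr_ge0 // exprn_ge0.
- by rewrite q0.
by rewrite mulrC mulrA.
Qed.

(** The terms of the power series at one point away from the centre are bounded,
    hence closer to the centre the series is dominated by a geometric one. *)
Lemma real_analytic_taylor (g : R -> R) (a : R) : real_analytic_R g ->
  exists c : nat -> R, exists r M : R, [/\ 0 < r, 0 <= M & forall m u, `|u| <= r / 2 ->
    `|g (a + u) - \sum_(i < m) c i * u ^+ i| <= M * (`|u| / r) ^+ m].
Proof.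
move=> /(_ a)[c /nbhs_ballP[d /= d0 cd]]; pose r := d / 2.
have r0 : 0 < r by rewrite divr_gt0.
have cv u : `|u| <= r -> (fun N => \sum_(i < N) c i * u ^+ i) @ \oo --> g (a + u).
  move=> ur; have := cd (a + u); rewrite /ball /= opprD addNKr normrN => /(_ _).
  rewrite [a + u - a]addrC addKr; apply; apply: le_lt_trans ur _.
  by rewrite /r; move: d0 => /=; lra.
have [M cM] : exists M, forall i, `|c i * r ^+ i| <= M.
  have [|M [_ /(_ (`|M| + 1))]] := @cvg_seq_bounded R _ (fun N => \sum_(i < N) c i * r
    ^+ i).
    by apply/cvg_ex; exists (g (a + r)); apply: cv; rewrite gtr0_norm.
  have M1 : M < `|M| + 1 by rewrite (le_lt_trans (ler_norm M)) // ltrDl.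
  move=> /(_ M1) SM; exists (2 * (`|M| + 1)) => i.
  have -> : c i * r ^+ i = \sum_(j < i.+1) c j * r ^+ j - \sum_(j < i) c j * r ^+ j.
    by rewrite big_ord_recr /= [RHS]addrC addKr.
  apply: le_trans (ler_normB _ _) _.
  by have := SM i.+1 I; have := SM i I; rewrite /=; lra.
exists c, r, (2 * M); split=> // [|m u ur];
  first by rewrite mulr_ge0 // (le_trans _ (cM 0%N)).
apply: (@dist_lim_le RealK _ _ _ _ (cv u _)); first by apply: le_trans ur _; move: r0;
  lra.
by exists m => // N /= mN; apply: power_series_tail.
Qed.

Lemma real_analytic_continuous (g : R -> R) : real_analytic_R g -> continuous g.
Proof.
move=> ga a; have [c [r [M [r0 M0 gT]]]] := real_analytic_taylor a ga.
have ga0 : g a = c 0%N.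
  have := gT 1%N 0; rewrite normr0 mul0r expr1 mulr0 big_ord1 expr0 mulr1 addr0.
  have r2 : 0 <= r / 2 by rewrite divr_ge0 // ltW.
  by move=> /(_ r2); rewrite normr_le0 subr_eq0 => /eqP.
apply/cvgrPdist_le => e e0; apply/nbhs_ballP.
exists (Num.min (r / 2) (e * r / (M + 1))) => /=.
  by rewrite lt_min !divr_gt0 ?mulr_gt0 // ltr_wpDl.
move=> t; rewrite /ball /= lt_min => /andP[/ltW tr te].
have := gT 1%N (t - a); rewrite subrKC big_ord1 expr0 mulr1 -ga0 expr1.
rewrite (distrC a) in tr te; move=> /(_ tr) h; rewrite distrC; apply: le_trans h _.
move: te; rewrite ltr_pdivlMr ?ltr_wpDl // => te.
rewrite mulrA ler_pdivrMr //.
apply: le_trans (ltW te); rewrite mulrC ler_wpM2l //; lra.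
Qed.

(** If a power series vanishes at points that accumulate at its centre, then its
    first nonzero coefficient would dominate the others there. *)
Lemma accumulating_zeros (g : R -> R) (a : R) : real_analytic_R g ->
  (forall e, 0 < e -> exists u, [/\ 0 < `|u|, `|u| < e & g (a + u) = 0]) ->
  exists2 e, 0 < e & forall u, `|u| < e -> g (a + u) = 0.
Proof.
move=> ga acc; have [c [r [M [r0 M0 gT]]]] := real_analytic_taylor a ga.
have r2 : 0 < r / 2 by rewrite divr_gt0.
have c0 i : c i = 0.
  elim/ltn_ind: i => i IH; apply/eqP; apply: contraT => ci.
  have ci0 : 0 < `|c i| by rewrite normr_gt0.
  pose e := Num.min (r / 2) (`|c i| * r ^+ i.+1 / (M + 1)).
  have [|u [u0 ue gu]] := acc e.
    by rewrite lt_min r2 divr_gt0 ?mulr_gt0 ?exprn_gt0 // ltr_wpDl.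
  move: ue; rewrite lt_min => /andP[/ltW ur]; rewrite ltr_pdivlMr ?ltr_wpDl // => ue.
  have := gT i.+1 u ur; rewrite gu sub0r normrN big_ord_recr /= big1 ?add0r => [|j _];
    last first.
    by rewrite IH // mul0r.
  rewrite normrM normrX expr_div_n mulrA ler_pdivlMr ?exprn_gt0 // => h.
  have : `|c i| * r ^+ i.+1 * `|u| ^+ i <= M * `|u| * `|u| ^+ i.
    by rewrite -mulrA (mulrC (r ^+ _)) mulrA -[M * _ * _]mulrA -exprS.
  rewrite ler_pM2r ?exprn_gt0 // => h2.
  by have := lt_le_trans ue h2; rewrite ltNge mulrC ler_wpM2l ?lerDl.
exists (r / 2) => // u /ltW ur; apply/eqP; rewrite -normr_le0.
have q2 : `|u| / r <= 2^-1 by rewrite ler_pdivrMr // mulrC.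
have gm m : `|g (a + u)| <= M * (2^-1) ^+ m.
  have := gT m u ur; rewrite big1 ?subr0 => [|j _]; last by rewrite c0 mul0r.
  move/le_trans; apply; apply: ler_wpM2l => //; apply: lerXn2r => //;
    rewrite nnegrE ?invr_ge0 //.
  by rewrite divr_ge0 // ltW.
rewrite normr_le0; apply/eqP.
have hl : (fun m => M * GRing.exp (2^-1 : R) m) @ \oo --> M * 0.
  apply: cvgM; first exact: cvg_cst.
  by apply: cvg_expr; rewrite ger0_norm ?invf_lt1 // ltr1n.
rewrite mulr0 in hl; apply/eqP; rewrite -normr_le0.
by apply: (cvgr_to_ge hl); exact: nearW.
Qed.

(** Identity theorem: the interior of the zero set is open and closed. *)
Lemma real_analytic_eq0 (g : R -> R) (O : set R) : real_analytic_R g ->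
  open O -> O !=set0 -> (forall t, O t -> g t = 0) -> forall t, g t = 0.
Proof.
move=> ga oO [b Ob] gO.
pose Z := [set a : R | exists2 e, 0 < e & forall u, `|u| < e -> g (a + u) = 0].
suff ZT : Z = setT.
  move=> t; have [e e0 /(_ 0)] : Z t by rewrite ZT.
  by rewrite normr0 addr0; apply.
have Zo : open Z.
  rewrite openE => a [e e0 ae]; apply/nbhs_ballP; exists (e / 2);
    first by rewrite /= divr_gt0.
  move=> a' /=; rewrite /ball /= => aa'; exists (e / 2); first by rewrite divr_gt0.
  move=> u ue; rewrite -(subrKC a a') -addrA; apply: ae.
  apply: le_lt_trans (ler_normD _ _) _; rewrite distrC in aa'; lra.
have Zc : closed Z.
  move=> a aZ; have [//|nZa] := pselect (Z a).
  apply: accumulating_zeros => // e e0.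
  have [|a' [Za' aa']] := aZ (ball a e); first exact: nbhsx_ballx.
  exists (a' - a); rewrite subrKC; split.
  - rewrite normr_gt0 subr_eq0; apply/eqP => aE; apply: nZa; by rewrite -aE.
  - by move: aa'; rewrite /ball /= distrC.
  by have [d d0 /(_ 0)] := Za'; rewrite normr0 addr0; apply.
have : connected [set: R] by apply/connected_intervalP.
apply; [|by exists Z; rewrite // setTI|by exists Z; rewrite // setTI].
exists b; have /nbhs_ballP[e e0 eO] : nbhs b O by apply: open_nbhs_nbhs.
exists e => // u ue; apply/gO/eO; by rewrite /ball /= opprD addNKr normrN.
Qed.

(** By Baire's theorem, one of the closed sets where all coefficients of degree
    above a given bound vanish has interior points. *)
Lemma uniform_vanishing (X : Type) (deg : X -> nat) (c : X -> R -> R) :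
  (forall i, real_analytic_R (c i)) ->
  (forall t, exists N, forall i, (N < deg i)%N -> c i t = 0) ->
  exists N, forall i, (N < deg i)%N -> forall t, c i t = 0.
Proof.
move=> ca cN; pose A N := [set t : R | forall i, (N < deg i)%N -> c i t = 0].
have Acl N : closed (A N).
  have -> : A N = \bigcap_(i in [set i | (N < deg i)%N]) [set t | c i t = 0].
    by apply/seteqP; split.
  apply: closed_bigI => i _.
  apply: (@preimage_closed _ _ (c i) [set 0]); last exact: closed_eq.
  by move=> t _; exact: real_analytic_continuous.
have [N nd] : exists N, ~ dense (~` A N).
  apply: contrapT => /forallNP nd.
  have : dense (\bigcap_N (~` A N)).
    by apply: (@Baire R R) => N; split; [rewrite openC|apply: contrapT].
  move=> /(_ setT (ex_intro _ 0 I) openT)[t [_ tA]].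
  by have [N tN] := cN t; exact: (tA N I).
exists N => i Ni; move: nd;
  rewrite /dense => /existsNP[W] /not_implyP[On] /not_implyP[oO OA].
apply: (real_analytic_eq0 (ca i) oO On) => t Ot.
apply: contrapT => ct; apply: OA; exists t; split=> // h; exact/ct/h.
Qed.


Lemma cvg_eq_fun (T : Type) (S : nbhsType) (F : set_system T) (f g : T -> S) (l : S) :
  (forall t, f t = g t) -> f t @[t --> F] --> l -> g t @[t --> F] --> l.
Proof. by move=> /funext->. Qed.

Lemma sum_expr0 (C : numFieldType) (f : nat -> C) N :
  (0 < N)%N -> \sum_(j < N) f j * 0 ^+ j = f 0%N.
Proof.
case: N => // N _; rewrite big_ord_recl expr0 mulr1 big1 ?addr0 // => j _.
by rewrite exprS mul0r mulr0.
Qed.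

Local Notation K := (ground_field R ComplexK).

Lemma embK_real (u : R) : embK ComplexK u = (u%:C)%C. Proof. by []. Qed.

Lemma emb_le_re (s : R) (M : K) : embK ComplexK s <= M -> s <= reK M.
Proof. by case: M => x y; rewrite /= lecE /= => /andP[_]. Qed.

(** The definition of analyticity with real radii and real bounds. *)
Lemma real_analytic_C_series (g : K -> K) (a : K) : real_analytic_C g ->
  exists c : nat -> nat -> K, exists2 d : R, 0 < d & forall u v, `|u| + `|v| < d ->
   (exists M, forall N, \sum_(i < N) \sum_(j < N)
      absK (c i j * embK ComplexK u ^+ i * embK ComplexK v ^+ j) <= M) /\
   (\sum_(i < N) \sum_(j < N)
      c i j * embK ComplexK u ^+ i * embK ComplexK v ^+ j @[N --> \oo] -->
      g (a + (Complex u v : K))).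
Proof.
move=> /(_ a)[c /nbhs_ballP[d0 /= d00 cd]].
have d0E : d0 = embK ComplexK (absK (k := ComplexK) d0) by rewrite -absKE gtr0_norm.
have dpos : 0 < absK (k := ComplexK) d0 by rewrite -(embK_lt ComplexK) embK0 -d0E.
exists c, (absK (k := ComplexK) d0) => // u v uv.
have /cd : ball a d0 (a + (Complex u v : K)).
  rewrite /ball /= opprD addNKr normrN.
  have uv' : absK (Complex u v : K) < absK (k := ComplexK) d0 by apply: le_lt_trans uv;
    exact: absK_le.
  rewrite -(embK_lt ComplexK) -d0E in uv'.
  by rewrite [X in X < _](@absKE R ComplexK).
have -> : a + (Complex u v : K) - a = Complex u v by rewrite addrC addKr.
rewrite -complexRe -complexIm /= -!embK_real => -[[M h1] h2]; split; last exact: h2.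
exists (reK (k := ComplexK) M) => N.
apply: (@emb_le_re _ M); apply: le_trans (h1 N).
rewrite (big_morph _ (embKD ComplexK) (embK0 R ComplexK)) le_eqVlt; apply/orP; left;
  apply/eqP.
apply: eq_bigr => i _; rewrite (big_morph _ (embKD ComplexK) (embK0 R ComplexK)).
by apply: eq_bigr => j _; rewrite -absKE.
Qed.

Definition axis_point (b : bool) (y t : R) : K :=
  if b then Complex t y else Complex y t.

(** On lines parallel to the axes the double series reduces to a simple one. *)
Lemma real_analytic_axis_series (g : K -> K) b y (a : R) : real_analytic_C g ->
  exists d : nat -> K, \forall t \near a,
    \sum_(i < N) d i * embK ComplexK ((t - a) ^+ i) @[N --> \oo] --> g (axis_point b y t).
Proof.
move=> ga; have [c [d d0 cd]] := real_analytic_C_series (axis_point b y a) ga.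
exists (fun i => if b then c i 0%N else c 0%N i).
apply/nbhs_ballP; exists d => [//|t ta]; have {}ta : `|t - a| < d by rewrite distrC.
have [|_ h] := cd (if b then t - a else 0) (if b then 0 else t - a).
  by case: (b); rewrite ?normr0 ?addr0 ?add0r.
have -> : axis_point b y t = axis_point b y a +
    (Complex (if b then t - a else 0) (if b then 0 else t - a) : K).
  by apply: (@ground_ext _ ComplexK); rewrite ?reKD ?imKD /axis_point; case: (b) => /=;
    ring.
apply: cvg_eq_fun h => -[|N]; first by rewrite !big_ord0.
case: (b); rewrite embK0.
  apply: eq_bigr => i _; rewrite embKX.
  exact: (@sum_expr0 K (fun j => c i j * embK ComplexK (t - a) ^+ i)).
rewrite exchange_big; apply: eq_bigr => j _; rewrite embKX -mulr_suml; congr (_ * _).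
exact: (@sum_expr0 K (fun i => c i j)).
Qed.

Lemma real_analytic_re_axis (g : K -> K) b y : real_analytic_C g ->
  real_analytic_R (fun t => reK (g (axis_point b y t))).
Proof.
move=> ga a; have [d dP] := real_analytic_axis_series b y a ga.
exists (fun i => reK (d i)); apply: filterS dP => t dt.
apply: (cvg_eq_fun _ (cvg_reK _ dt)) => N.
rewrite reK_sum; apply: eq_bigr => i _.
by rewrite reKM reK_emb imK_emb mulr0 subr0.
Qed.

Lemma real_analytic_im_axis (g : K -> K) b y : real_analytic_C g ->
  real_analytic_R (fun t => imK (g (axis_point b y t))).
Proof.
move=> ga a; have [d dP] := real_analytic_axis_series b y a ga.
exists (fun i => imK (d i)); apply: filterS dP => t dt.
apply: (cvg_eq_fun _ (cvg_imK _ dt)) => N.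
rewrite imK_sum; apply: eq_bigr => i _.
by rewrite imKM reK_emb imK_emb mulr0 add0r.
Qed.

(** Shrinking both real coordinates by a factor [s] shrinks every term but the
    constant one by at least this factor. *)
Lemma double_series_dist (c : nat -> nat -> K) (r s M u v : R) : 0 <= r -> 0 <= s <= 1 ->
  (forall N, \sum_(i < N) \sum_(j < N)
      absK (c i j * embK ComplexK r ^+ i * embK ComplexK r ^+ j) <= M) ->
  `|u| <= s * r -> `|v| <= s * r -> forall N, (0 < N)%N ->
  absK (\sum_(i < N) \sum_(j < N)
      c i j * embK ComplexK u ^+ i * embK ComplexK v ^+ j - c 0%N 0%N) <= s * M.
Proof.
move=> r0 /andP[s0 s1] cM us vs N N0.
have sr0 : 0 <= s * r by rewrite mulr_ge0.
pose T i j := c i j * embK ComplexK u ^+ i * embK ComplexK v ^+ j.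
pose B i j := absK (c i j * embK ComplexK r ^+ i * embK ComplexK r ^+ j).
have absX (w : R) i : absK (embK ComplexK w ^+ i) = `|w| ^+ i.
  by rewrite -embKX absK_emb normrX.
have BE i j : B i j = absK (c i j) * r ^+ i * r ^+ j.
  by rewrite /B !absKM !absX ger0_norm.
have TB i j : (0 < i + j)%N -> absK (T i j) <= s * B i j.
  move=> ij; rewrite /T !absKM !absX BE.
  apply: (@le_trans _ _ (absK (c i j) * (s * r) ^+ i * (s * r) ^+ j)).
    apply: ler_pM; rewrite ?mulr_ge0 ?exprn_ge0 ?absK_ge0 //.
      by apply: ler_wpM2l; rewrite ?absK_ge0 // lerXn2r ?nnegrE.
    by rewrite lerXn2r ?nnegrE.
  have -> : absK (c i j) * (s * r) ^+ i * (s * r) ^+ j =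
            s ^+ (i + j) * (absK (c i j) * r ^+ i * r ^+ j) by rewrite !exprMn exprD;
              ring.
  apply: ler_wpM2r; first by rewrite !mulr_ge0 ?exprn_ge0 ?absK_ge0.
  by case: (i + j)%N ij => // m _; rewrite exprS ler_piMr // exprn_ile1.
have B0 i j : 0 <= B i j by exact: absK_ge0.
have abs_sum (I : Type) (l : seq I) (P : pred I) (F : I -> K) :
    absK (\sum_(i <- l | P i) F i) <= \sum_(i <- l | P i) absK (F i).
  elim/big_rec2: _ => [|i x y _ yx]; first by rewrite absK0.
  by apply: le_trans (absK_add _ _) _; rewrite lerD2l.
case: N N0 => // N _;
  apply: (@le_trans _ _ (s * \sum_(i < N.+1) \sum_(j < N.+1) B i j)); last first.
  by rewrite ler_wpM2l.
have -> : \sum_(i < N.+1) \sum_(j < N.+1) T i j = c 0%N 0%N +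
    (\sum_(j < N) T 0%N (bump 0 j) + \sum_(i < N) \sum_(j < N.+1) T (bump 0 i) j).
  by rewrite big_ord_recl big_ord_recl /= {1}/T !expr0 !mulr1 addrA.
rewrite [X in absK X]addrC addKr.
rewrite [in leRHS]big_ord_recl [X in s * (X + _)]big_ord_recl -addrA mulrDr.
apply: le_trans (absK_add _ _) _; rewrite mulrDr ler_wpDl ?mulr_ge0 //.
apply: lerD; apply: le_trans (abs_sum _ _ _ _) _; rewrite mulr_sumr;
  apply: ler_sum => i _.
  by apply: TB.
apply: le_trans (abs_sum _ _ _ _) _; rewrite mulr_sumr; apply: ler_sum => j _.
by apply: TB.
Qed.

Lemma real_analytic_C_continuous (g : K -> K) : real_analytic_C g -> continuous g.
Proof.
move=> ga a; have [c [d d0 cd]] := real_analytic_C_series a ga.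
pose r := d / 3; have r0 : 0 < r by rewrite divr_gt0.
have [|[M cM] _] := cd r r; first by rewrite gtr0_norm // /r; lra.
have M0 : 0 <= M by apply: le_trans (cM 0%N); rewrite big_ord0.
have dist s u v : 0 <= s <= 1 -> `|u| <= s * r -> `|v| <= s * r ->
    absK (g (a + (Complex u v : K)) - c 0%N 0%N) <= s * M.
  move=> s01 us vs; have [s0 s1] := andP s01.
  have [|_ h] := cd u v.
    have : s * r <= r by rewrite ler_piMl // ltW.
    rewrite /r; move: us vs; rewrite /r; lra.
  apply: (dist_lim_le h); exists 1%N => // N /= N0.
  exact: (double_series_dist (ltW r0) s01 cM us vs N0).
have ga0 : g a = c 0%N 0%N.
  have := dist 0 0 0; rewrite lexx ler01 normr0 mul0r lexx mul0r => /(_ isT isT isT).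
  rewrite (_ : a + _ = a); last by apply: (@ground_ext _ ComplexK);
    rewrite ?reKD ?imKD /= addr0.
  by move=> h; apply/eqP; rewrite -subr_eq0 -absK_eq0 eq_le h absK_ge0.
apply/(@cvgKP R ComplexK _ (nbhs a) _) => e e0.
pose s := Num.min 1 (e / (2 * (M + 1))).
have M1 : 0 < 2 * (M + 1) by rewrite mulr_gt0 // ltr_wpDl.
have s0 : 0 < s by rewrite lt_min ltr01 divr_gt0.
have s1 : s <= 1 by rewrite ge_min lexx.
have se : s * M < e.
  have : s <= e / (2 * (M + 1)) by rewrite ge_min lexx orbT.
  rewrite ler_pdivlMr // => h.
  have : 0 <= s * M by rewrite mulr_ge0 // ltW.
  move: h; rewrite mulrA mulrDr mulr1; move: s0 e0; nra.
have : \forall z \near a, absK (a - z) < s * r.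
  apply: (@cvgKP R ComplexK _ (nbhs a) _ id a).1; first exact: cvg_id.
  by rewrite mulr_gt0.
apply: filterS => z; rewrite -absKN opprB => za.
apply: le_lt_trans se; rewrite ga0 -absKN opprB.
have -> : z = a + (Complex (reK (z - a)) (imK (z - a)) : K).
  by apply: (@ground_ext _ ComplexK); rewrite ?reKD ?imKD ?reKN ?imKN /=; ring.
apply: dist; first by rewrite ltW.
  by apply: le_trans (absK_re _) (ltW za).
by apply: le_trans (absK_im _) (ltW za).
Qed.

End Analytic.

Lemma real_analytic_cvg (R : realType) k (g : ground_field R k -> ground_field R k) :
  real_analytic g -> continuous g.
Proof.
case: k g => g ga; first exact: real_analytic_continuous.
exact: real_analytic_C_continuous.
Qed.

(** For complex parameters, the theorem on the line applies first along the
    horizontal lines and then, to the family of all restrictions to vertical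
    lines, along these. *)
Lemma uniform_vanishing_ground (R : realType) k (X : Type) (deg : X -> nat)
    (c : X -> ground_field R k -> ground_field R k) :
  (forall i, real_analytic (c i)) ->
  (forall t, exists N, forall i, (N < deg i)%N -> c i t = 0) ->
  exists N, forall i, (N < deg i)%N -> forall t, c i t = 0.
Proof.
case: k c => c ca cN; first exact: uniform_vanishing.
have hor y : exists N, forall i, (N < deg i)%N -> forall t, c i (Complex t y) = 0.
  have [|t|N NP] := @uniform_vanishing R (bool * X)%type (fun bi => deg bi.2)
     (fun bi t => (if bi.1 then @reK R ComplexK else @imK R ComplexK)
                    (c bi.2 (axis_point true y t))).
  - by move=> [[] i];
    [exact: real_analytic_re_axis (ca i)|exact: real_analytic_im_axis (ca i)].
  - have [N NP] := cN (Complex t y); exists N => -[b i] /= /NP ->.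
    by case: b; rewrite ?reK0 ?imK0.
  exists N => i Ni t; apply: (@ground_ext R ComplexK).
    by apply: etrans (NP (true, i) Ni t) _; rewrite reK0.
  by apply: etrans (NP (false, i) Ni t) _; rewrite imK0.
have [|y|N NP] := @uniform_vanishing R (bool * X * R)%type (fun bi => deg bi.1.2)
   (fun bi t => (if bi.1.1 then @reK R ComplexK else @imK R ComplexK)
                  (c bi.1.2 (axis_point false bi.2 t))).
- by move=> [[[] i] x];
  [exact: real_analytic_re_axis (ca i)|exact: real_analytic_im_axis (ca i)].
- have [N NP] := hor y; exists N => -[[b i] x] /= /NP h.
  rewrite h.
  by case: b; rewrite ?reK0 ?imK0.
exists N => i Ni [x y]; apply: (@ground_ext R ComplexK).
  by apply: etrans (NP (true, i, x) Ni y) _; rewrite reK0.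
by apply: etrans (NP (false, i, x) Ni y) _; rewrite imK0.
Qed.

(** * Weights attached to points near the origin *)

Section Weights.
Variables (R : realType) (n : nat).
Implicit Types (s t v x y : 'rV[R]_n) (J : seq 'rV[rat]_n).

Lemma seq_argmin (T : eqType) (f : T -> R) (s : seq T) : s != [::] ->
  exists2 a, a \in s & forall b, b \in s -> f a <= f b.
Proof.
case: s => // x0 s _; elim: s x0 => [|z s IH] x0.
  by exists x0; rewrite ?mem_head // => b; rewrite inE => /eqP->.
have [a aJ amin] := IH z.
have [la|/ltW al] := leP (f x0) (f a).
  exists x0; rewrite ?mem_head // => b; rewrite inE => /orP[/eqP->//|/amin].
  exact: le_trans.
exists a; first by rewrite inE aJ orbT.
by move=> b; rewrite inE => /orP[/eqP->//|/amin].
Qed.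

(** Given weights [t] on the coordinates in [I], extended by infinity, the
    weights can be lowered, without lowering the minimum over the polyhedron,
    until every coordinate is positive at some minimizer: take weights of
    minimal sum among those with the same minimum. *)
Lemma lowered_weight J : J != [::] -> (forall l, l \in J -> positive_form l) ->
  exists2 kappa : R, 0 < kappa & forall (tau : R) (I : {set 'I_n}) t, 0 < tau ->
    I != finset.set0 -> (forall i, i \in I -> tau <= t 0 i) -> exists t' v0,
    [/\ forall i, kappa * tau <= t' 0 i, forall i, i \in I -> t' 0 i <= t 0 i,
        minimizes t' (upper J) v0,
        forall i, v0 0 i != 0 -> i \in I /\ t' 0 i = t 0 i
      & forall i, exists2 v, minimizes t' (upper J) v & 0 < v 0 i].
Proof.
move=> Jn J0; have [c c0 cJ] := @upper_axis R n J J0.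
have [b b0 bJ] := @upper_mass R n J Jn J0.
have [V [VJ Vrep]] := tight_representatives (@upper_constraints R n J).
exists (b / c); first by rewrite divr_gt0.
move=> tau I t tau0 In tI.
(* The points on the axes bound every single weight from below. *)
pose W := V ++ [seq c *: delta_mx 0 i | i <- enum 'I_n].
have WJ w : w \in W -> upper J w.
  by rewrite mem_cat => /orP[/VJ//|/mapP[i _ ->]].
have W0 w i : w \in W -> 0 <= w 0 i by move=> /WJ/upper_orthant.
have Wax i : c *: delta_mx 0 i \in W.
  by rewrite mem_cat orbC; apply/orP; left;
    apply: (map_f (fun i => c *: delta_mx 0 i)); rewrite mem_enum.
pose WI := [seq w : 'rV[R]_n <- W | [forall i, (w 0 i != 0) ==> (i \in I)]].
have [|v0 v0W v0min] := @seq_argmin _ (dot t) WI.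
  have [i iI] := set0Pn _ In; rewrite -has_filter; apply/hasP;
    exists (c *: delta_mx 0 i) => //.
  apply/forallP => l; apply/implyP; rewrite !mxE eqxx /=.
  by have [->|_] := eqVneq l i; [rewrite iI; case: (_ != _)|rewrite mulr0 eqxx].
move: v0W; rewrite mem_filter => /andP[/forallP v0I v0W].
have {}v0I i : v0 0 i != 0 -> i \in I by move=> h; have := v0I i; rewrite h.
pose d := dot t v0.
have dtau : tau * b <= d.
  have := bJ _ (WJ _ v0W); rewrite -(ler_pM2l tau0) => /le_trans; apply.
  rewrite mulr_sumr; apply: ler_sum => i _.
  have [->|h] := eqVneq (v0 0 i) 0; first by rewrite !mulr0.
  by rewrite ler_wpM2r ?W0 ?tI ?v0I.
have d0 : 0 < d by apply: lt_le_trans dtau; rewrite mulr_gt0.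
pose cpos (i : 'I_n) : 'rV[R]_n * R := (delta_mx 0 i, 0).
pose cI (i : 'I_n) : 'rV[R]_n * R := (- delta_mx 0 i, - t 0 i).
pose cW (w : 'rV[R]_n) : 'rV[R]_n * R := (w, d).
pose S := [seq cpos i | i <- enum 'I_n] ++ [seq cI i | i <- enum I] ++ [seq cW w | w <-
  W].
have SP x : polyhedron S x <-> [/\ orthant x, forall i, i \in I -> x 0 i <= t 0 i
                                & forall w, w \in W -> d <= dot w x].
  split=> [Sx|[h1 h2 h3] e].
    split=> [i|i iI|w wW].
    - have := Sx (cpos i); rewrite /= dot_delta; apply.
      by rewrite mem_cat map_f ?mem_enum.
    - have := Sx (cI i); rewrite /= dotC dotNr dotC dot_delta lerN2; apply.
      by rewrite !mem_cat; apply/or3P; apply: Or32; rewrite map_f ?mem_enum.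
    - by apply: (Sx (cW w)); rewrite !mem_cat; apply/or3P; apply: Or33; rewrite map_f.
  rewrite !mem_cat => /or3P[/mapP[i _ ->]|/mapP[i iI ->]|/mapP[w wW ->]] /=.
  - by rewrite dot_delta.
  - by rewrite dotC dotNr dotC dot_delta lerN2 h2 // -mem_enum.
  - exact: h3.
pose one : 'rV[R]_n := const_mx 1.
have [|||t' [St' t'min]] := @exists_minimizes _ _ S one.
(* Weights outside [I] can be taken large: the weight [B] on a single nonzero
   coordinate of a point of [W] gives it a value of at least [d]. *)
- pose B := \sum_(w <- W) \sum_i d * (w 0 i)^-1.
  have Bw w i : w \in W -> d * (w 0 i)^-1 <= B.
    move=> wW; rewrite /B (perm_big _ (perm_to_rem wW)) big_cons /= (bigD1 i) //=
      -addrA lerDl.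
    rewrite addr_ge0 //.
      by apply: sumr_ge0 => l _; rewrite mulr_ge0 ?invr_ge0 ?W0 // ltW.
    rewrite big_seq; apply: sumr_ge0 => u /mem_rem uW; apply: sumr_ge0 => l _.
    by rewrite mulr_ge0 ?invr_ge0 ?W0 // ltW.
  have B0 : 0 <= B.
    rewrite /B big_seq; apply: sumr_ge0 => u uW; apply: sumr_ge0 => l _.
    by rewrite mulr_ge0 ?invr_ge0 ?W0 // ltW.
  pose x : 'rV[R]_n := \row_i if i \in I then t 0 i else B.
  have x0 : orthant x.
    move=> i; rewrite mxE; case: ifPn => // iI; apply: le_trans (tI i iI); exact: ltW.
  exists x; apply/SP; split=> // [i iI|w wW]; first by rewrite mxE iI.
  have [/forallP wI|] := boolP [forall i, (w 0 i != 0) ==> (i \in I)].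
    apply: le_trans (v0min w _) _; first by rewrite mem_filter wW andbT; apply/forallP.
    rewrite dotC; apply: ler_sum => i _; rewrite mxE.
    have [->|wi] := eqVneq (w 0 i) 0; first by rewrite !mul0r.
    by have := wI i; rewrite wi /= => ->.
  rewrite negb_forall => /existsP[ i]; rewrite negb_imply => /andP[wi iI].
  have wi0 : 0 < w 0 i by rewrite lt_neqAle eq_sym wi W0.
  rewrite /dot (bigD1 i) //= mxE (negPf iI); apply: ler_wpDr.
    by apply: sumr_ge0 => l _; rewrite mulr_ge0 // W0.
  by have := Bw w i wW; rewrite ler_pdivrMr // mulrC.
- by move=> x /SP[].
- by move=> i; rewrite mxE.
have /SP[t'0 t'I t'W] := St'.
have t'ge i : b / c * tau <= t' 0 i.
  have := t'W _ (Wax i); rewrite dotC dotZr dotC dot_delta => /(le_trans dtau).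
  by rewrite mulrAC ler_pdivrMr // mulrC [t' 0 i * c]mulrC.
have t'pos i : 0 < t' 0 i by apply: lt_le_trans (t'ge i); rewrite mulr_gt0 // divr_gt0.
have sub i : 0 <= (t 0 i - t' 0 i) * v0 0 i.
  have [->|h] := eqVneq (v0 0 i) 0; first by rewrite mulr0.
  by rewrite mulr_ge0 ?W0 // subr_ge0 t'I ?v0I.
have sumE : \sum_i (t 0 i - t' 0 i) * v0 0 i = d - dot t' v0.
  by rewrite /d /dot -sumrB; apply: eq_bigr => i _; rewrite mulrBl.
have dE : dot t' v0 = d.
  have le2 : d <= dot t' v0 by rewrite dotC t'W.
  apply/eqP; rewrite eq_le le2 andbT -subr_ge0 -sumE.
  exact: sumr_ge0.
have v0eq i : v0 0 i != 0 -> t' 0 i = t 0 i.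
  move=> vi; have := sumE; rewrite dE subrr => /eqP.
  rewrite psumr_eq0 => [/allP/(_ i (mem_index_enum i))|l _]; last exact: sub.
  by rewrite /= mulf_eq0 (negPf vi) orbF subr_eq0 => /eqP->.
have Jmin y : upper J y -> d <= dot t' y.
  move=> Jy; have [||z [Jz zmin]] := @exists_minimizes _ _ (upper_constraints R J) t' _
    _ t'pos.
  - by exists y.
  - exact: upper_orthant.
  have [w wV wz] := Vrep z Jz.
  have wm : minimizes t' (upper J) w.
    apply: (minimizes_tight (x := z)) => //; first exact: VJ.
    by move=> e eJ /eqP ez; apply/eqP; rewrite wz.
  apply: le_trans (proj2 wm y Jy); rewrite dotC; apply: t'W.
  by rewrite mem_cat wV.
exists t', v0; split=> //.
- by split=> [|y Jy]; [exact: WJ|rewrite dE; exact: Jmin].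
- by move=> i vi; split; [exact: v0I|exact: v0eq].
move=> i; apply: contrapT => no.
have no' w : w \in W -> dot w t' = d -> w 0 i = 0.
  move=> wW wd; apply/eqP; rewrite eq_le W0 // andbT leNgt; apply/negP => wi; apply: no.
  exists w => //; split; first exact: WJ.
  by move=> y Jy; rewrite dotC wd; exact: Jmin.
(* If no minimizer involves the coordinate [i], its weight can be lowered. *)
have [e|h h0 /(_ h)] := small_step (v := - delta_mx 0 i) St'.
  rewrite !mem_cat => /or3P[/mapP[l _ ->]|/mapP[l _ ->]|/mapP[w wW ->]] /=.
  - rewrite !dot_delta !mxE eqxx /= => tl; have [li|li] := eqVneq l i.
      by have := t'pos l; rewrite tl ltxx.
    by rewrite oppr0.
  - by move=> _; rewrite dotNr dotC dotNr dot_delta !mxE opprK ler0n.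
  - by move=> /(no' w wW) wi; rewrite dotNr dotC dot_delta wi oppr0.
rewrite lexx ltW // => /(_ isT) /t'min;
  rewrite dotDr dotZr dotNr (dotC one (delta_mx 0 i)) dot_delta mxE.
lra.
Qed.

(** A minimizer over a Minkowski sum is a sum of minimizers, since changing one
    summand changes the value of a linear form accordingly. *)
Lemma minimizes_msum p (Q : 'I_p -> set 'rV[R]_n) s :
  [set x | minimizes s (Defs.msum Q) x] =
  Defs.msum (fun j => [set x | minimizes s (Q j) x]).
Proof.
apply/seteqP; split=> x.
  move=> [[y yQ ->] ymin]; exists y => // j; split; first exact: yQ.
  move=> z Qz.
  have /ymin : Defs.msum Q (\sum_l (if l == j then z else y l)).
    by exists (fun l => if l == j then z else y l) => // l; case: eqP => [->|].
  rewrite !dot_sumr (bigD1 j) //= [leRHS](bigD1 j) //= eqxx.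
  rewrite [X in _ <= _ + X](eq_bigr (fun l => dot s (y l))) ?lerD2r // => l /negPf->.
  by [].
move=> [y yQ ->]; split; first by exists y => // j; case: (yQ j).
move=> _ [z zQ ->]; rewrite !dot_sumr; apply: ler_sum => j _.
by have [_] := yQ j; apply.
Qed.

End Weights.

Section Correction.
Variables (R : realType) (n : nat) (T : Type) (U : set_system T).
Hypothesis UF : UltraFilter U.

Lemma ultra_finite (X : eqType) (s : seq X) (A : X -> set T) :
  (\forall t \near U, exists2 x, x \in s & A x t) -> exists2 x, x \in s & U (A x).
Proof.
elim: s => [h|x s IH h].
  by have [t [x]] := filter_ex h.
have [Ax|nAx] := in_ultra_setVsetC (A x) UF; first by exists x; rewrite ?mem_head.
have [|y ys Ay] := IH; last by exists y; rewrite // inE ys orbT.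
apply: filterS2 h nAx => t [y]; rewrite inE => /orP[/eqP->//|ys Ay _].
by exists y.
Qed.

(** If finitely many linear forms stay bounded along weights [t], then [t]
    differs by something bounded from weights where they vanish: project with
    the pseudoinverse of the matrix of these forms. *)
Lemma bounded_correction (t : T -> 'rV[R]_n) (L : seq 'rV[R]_n) :
  (forall z, z \in L -> exists M, \forall a \near U, `|dot (t a) z| <= M) ->
  exists r : T -> 'rV[R]_n, exists2 r0 : 'rV[R]_n,
    forall i, r a 0 i @[a --> U] --> r0 0 i &
    forall a z, z \in L -> dot (t a) z = dot (r a) z.
Proof.
move=> Lb; pose A : 'M[R]_(n, size L) := \matrix_(i, j) L`_j 0 i.
have AE (u : 'rV[R]_n) j : (u *m A) 0 j = dot u L`_j.
  by rewrite mxE; apply: eq_bigr => i _; rewrite mxE.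
have tL j : exists l, (t a *m A) 0 j @[a --> U] --> (l : R).
  have [M tM] := Lb L`_j (mem_nth 0 (ltn_ord j)).
  have [|l _ tl] := @ultra_cvg_bounded R _ U UF (fun a => (t a *m A) 0 j) M.
    by apply: filterS tM => a; rewrite AE.
  by exists l.
have [l tl] := choice tL.
exists (fun a => t a *m A *m pinvmx A), (\row_i \sum_j l j * pinvmx A j i) => [i|a z zL].
  rewrite mxE; under eq_cvg do rewrite mxE.
  by apply: cvg_sumr => j _; apply: cvgM; [exact: tl|exact: cvg_cst].
have zi : (index z L < size L)%N by rewrite index_mem.
have := AE (t a) (Ordinal zi); have := AE (t a *m A *m pinvmx A) (Ordinal zi).
by rewrite mulmxKpV ?submxMl //= nth_index // => -> ->.
Qed.

End Correction.

(** * Rescaling polynomial maps *)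

Section Rescaling.
Variables (R : realType) (k : ground) (n : nat).
Local Notation K := (ground_field R k).
Local Notation N := (rdim k n).
Implicit Types (g : mpoly N K) (m : multinom N) (s : 'rV[R]_n) (x h : 'rV[K]_n).

Definition rescale s x : 'rV[K]_n := scale_point (fun i => expR (s 0 i)) x.

Lemma rescaleK s : cancel (rescale s) (rescale (- s)).
Proof.
move=> x; apply/rowP => i; rewrite !mxE mulrA -embKM -expRD addNr expR0.
by rewrite embK1 mul1r.
Qed.

Lemma mevalX_mul (u v : 'I_N -> K) m :
  meval (fun i => u i * v i) (mpolyX K m) = meval u (mpolyX K m) * meval v (mpolyX K m).
Proof.
by rewrite !mevalX -big_split; apply: eq_bigr => i _; rewrite exprMn.
Qed.

Lemma meval_weights s m :
  meval (fun i => embK k (expR (s 0 (var_index i)))) (mpolyX K m) =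
  embK k (expR (dot s (exponent R m))).
Proof.
rewrite mevalX dot_exponent expR_sum embK_prod; apply: eq_bigr => i _.
by rewrite -embKX -expRM_natr.
Qed.

Lemma meval_rescale s x m :
  meval (formal_point (rescale s x)) (mpolyX K m) =
  embK k (expR (dot s (exponent R m))) * meval (formal_point x) (mpolyX K m).
Proof.
rewrite -meval_weights -mevalX_mul; apply: meval_eq => i.
exact: formal_scale.
Qed.

Lemma dpoly_rescale s x h m :
  dpoly (mpolyX K m) (rescale s x) (rescale s h) =
  embK k (expR (dot s (exponent R m))) * dpoly (mpolyX K m) x h.
Proof.
rewrite /dpoly mulr_sumr; apply: eq_bigr => i _.
rewrite mderivX !mevalZ; have [->|mi] := eqVneq (m i) 0%N.
  by rewrite !mul0r mulr0.
rewrite [formal_point (rescale s h) i]formal_scale.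
have -> : meval (formal_point (rescale s x)) (mpolyX K (mnm_sub m (mnm1 i))) =
  meval (fun i => embK k (expR (s 0 (var_index i)))) (mpolyX K (mnm_sub m (mnm1 i))) *
  meval (formal_point x) (mpolyX K (mnm_sub m (mnm1 i))).
  by rewrite -mevalX_mul; apply: meval_eq => l; exact: formal_scale.
have mE : mpolyX K m = mpolyX K (mnm_sub m (mnm1 i)) * mpolyX K (mnm1 i).
  by rewrite -mpolyXD submK // lep1mP.
by rewrite -meval_weights mE mevalM mevalXU; ring.
Qed.

Lemma mcoeff_truncation g (A : set 'rV[R]_n) m :
  mcoeff m (truncation g A) = if `[< A (exponent R m) >] then mcoeff m g else 0.
Proof.
rewrite /truncation raddf_sum /=.
under eq_bigr do rewrite mcoeffZ mcoeffX.
have [mg|mg] := boolP (m \in msupp g); last first.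
  rewrite (memN_msupp_eq0 mg) if_same big1_seq // => m' /andP[_ m'g].
  by case: eqP m'g mg => [->->|_ _ _]; rewrite ?mulr0.
rewrite -big_filter; case: ifPn => Am.
  rewrite (bigD1_seq m) ?filter_uniq ?msupp_uniq ?mem_filter ?Am //= eqxx mulr1 big1
    ?addr0 //.
  by move=> m' /negPf->; rewrite mulr0.
rewrite big1_seq // => m' /andP[_]; rewrite mem_filter => /andP[Am' _].
by case: eqP Am' Am => [->->|_ _ _]; rewrite ?mulr0.
Qed.

Lemma msize_truncation g A : (msize (truncation g A) <= msize g)%N.
Proof.
rewrite [leqLHS]msizeE; apply/bigmax_leqP_seq => m;
  rewrite mcoeff_msupp mcoeff_truncation.
by case: ifP => [_|_]; rewrite ?eqxx // -mcoeff_msupp => /msize_mdeg_lt.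
Qed.

Lemma meval_expansion M g x : (msize g <= M)%N ->
  meval (formal_point x) g = \sum_(m : bmultinom N M)
    mcoeff m g * meval (formal_point x) (mpolyX K m).
Proof.
move=> gM; rewrite [in LHS](mpolywE gM) raddf_sum; apply: eq_bigr => m _.
exact: mevalZ.
Qed.

Lemma dpoly_expansion M g x h : (msize g <= M)%N ->
  dpoly g x h = \sum_(m : bmultinom N M) mcoeff m g * dpoly (mpolyX K m) x h.
Proof.
move=> gM; rewrite [in LHS](mpolywE gM).
elim/big_rec2: _ => [|m a b _ <-]; last by rewrite dpolyD dpolyZ.
by rewrite /dpoly big1 // => i _; rewrite mderiv0 meval0 mul0r.
Qed.

Lemma dpolyX_cvg (T : Type) (F : set_system T) (FF : Filter F) (y : T -> 'rV[K]_n)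
    (y0 h : 'rV[K]_n) m : (forall i, y a 0 i @[a --> F] --> y0 0 i) ->
  dpoly (mpolyX K m) (y a) h @[a --> F] --> dpoly (mpolyX K m) y0 h.
Proof.
move=> yy; apply: cvg_sumr => i _; apply: cvgM; last exact: cvg_cst.
rewrite mderivX mevalZ; under eq_cvg do rewrite mevalZ mevalX.
rewrite mevalX; apply: cvgM; first exact: cvg_cst.
apply: cvg_prodr => l _; apply: cvg_exprn; exact: formal_cvg yy.
Qed.

Lemma mevalX_cvg (T : Type) (F : set_system T) (FF : Filter F) (y : T -> 'rV[K]_n)
    (y0 : 'rV[K]_n) m : (forall i, y a 0 i @[a --> F] --> y0 0 i) ->
  meval (formal_point (y a)) (mpolyX K m) @[a --> F] -->
  meval (formal_point y0) (mpolyX K m).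
Proof.
move=> yy; under eq_cvg do rewrite mevalX.
rewrite mevalX; apply: cvg_prodr => l _; apply: cvg_exprn; exact: formal_cvg yy.
Qed.

End Rescaling.

(** * The face selected by points approaching the origin *)

Lemma near_seq (T : Type) (U : set_system T) (UF : Filter U) (X : eqType) (s : seq X)
    (A : X -> T -> Prop) : (forall x, x \in s -> \forall a \near U, A x a) ->
  \forall a \near U, forall x, x \in s -> A x a.
Proof.
elim: s => [_|x s IH h]; first exact: nearW.
have [|h1 h2] := (h x (mem_head _ _), IH _); first by move=> y ys; apply: h;
  rewrite inE ys orbT.
by apply: filterS2 h1 h2 => a ax as' y; rewrite inE => /orP[/eqP->|/as'].
Qed.

Section Selection.
Variables (R : realType) (k : ground) (n p : nat).
Local Notation K := (ground_field R k).
Variables (J : 'I_p -> seq 'rV[rat]_n) (JS : seq 'rV[rat]_n).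
Hypothesis n0 : (0 < n)%N.
Hypothesis Jpos : forall j l, l \in J j -> positive_form l.
Hypothesis JSn : JS != [::].
Hypothesis JSpos : forall l, l \in JS -> positive_form l.
Hypothesis QE : Defs.msum (fun j => @upper R n (J j)) = upper JS.
Variables (T : Type) (U : set_system T).
Hypothesis UF : UltraFilter U.
Variable x : T -> 'rV[K]_n.
Hypothesis x_neq0 : forall a, x a != 0.
Hypothesis x_cvg : \sum_i absK (x a 0 i) @[a --> U] --> (0 : R).

Let sg a : R := \sum_i absK (x a 0 i).
Let tau a : R := - ln (sg a).
Let supp_pt a : {set 'I_n} := [set i | x a 0 i != 0]%SET.
(** The orders of magnitude of the coordinates; the entries outside [supp_pt a]
    stand for infinite ones. *)
Let t a : 'rV[R]_n := \row_i - ln (absK (x a 0 i)).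

Let sg_gt0 a : 0 < sg a.
Proof.
have [i xi] : exists i, x a 0 i != 0.
  apply: contrapT => /forallNP h; case/eqP: (x_neq0 a); apply/rowP => i; rewrite mxE.
  by have /negP := h i; rewrite negbK => /eqP.
rewrite /sg (bigD1 i) //= ltr_pwDl ?absK_gt0 //.
by apply: sumr_ge0 => l _; exact: absK_ge0.
Qed.

Let sg_lt (e : R) : 0 < e -> \forall a \near U, sg a < e.
Proof. by move=> e0; apply: (cvgr_lt _ x_cvg). Qed.

Let tau_pinfty (B : R) : \forall a \near U, B < tau a.
Proof.
apply: filterS (sg_lt (expR_gt0 (- B))) => a sa; rewrite /tau ltrNr.
by rewrite -[- B]expRK ltr_ln ?posrE ?expR_gt0.
Qed.

Let tau_le a i : i \in supp_pt a -> tau a <= t a 0 i.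
Proof.
rewrite inE => xi; rewrite mxE lerN2 ler_ln ?posrE ?absK_gt0 //.
rewrite /sg (bigD1 i) //= lerDl; apply: sumr_ge0 => l _; exact: absK_ge0.
Qed.

Definition lowers kappa a (t' : 'rV[R]_n) : Prop :=
  [/\ forall i, kappa * tau a <= t' 0 i, 0 < tau a,
     forall i, i \in supp_pt a -> t' 0 i <= t a 0 i,
     exists2 v : 'rV[R]_n, minimizes t' (upper JS) v &
       forall i, v 0 i != 0 -> i \in supp_pt a /\ t' 0 i = t a 0 i
   & forall i, exists2 v : 'rV[R]_n, minimizes t' (upper JS) v & 0 < v 0 i].

Lemma lowered_weights : exists (kappa : R) (t' : T -> 'rV[R]_n), 0 < kappa /\
  \forall a \near U, lowers kappa a (t' a).
Proof.
have [kappa kappa0 kP] := @lowered_weight R n JS JSn JSpos.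
have /choice[t' t'P] : forall a, exists t', 0 < tau a -> lowers kappa a t'.
  move=> a; have [ta|ta] := ltP 0 (tau a); last by exists 0.
  have [||t' [v0 [h1 h2 h3 h4 h5]]] := kP (tau a) (supp_pt a) (t a) ta.
  - apply/set0Pn; apply: contrapT => /forallNP h.
    have := sg_gt0 a; rewrite /sg big1 ?ltxx // => i _.
    by apply/eqP; rewrite absK_eq0; have /negP := h i; rewrite inE negbK.
  - exact: tau_le.
  by exists t' => _; split=> //; exists v0.
by exists kappa, t'; split=> //; apply: filterS (tau_pinfty 0) => a; exact: t'P.
Qed.

(** Weights [s a], at bounded distance from those of the points [x a], whose
    minimal face is eventually the same: the points of [E j] and the
    representatives of the faces either stay on this face or move away from it
    to infinity. The rescaled points converge. *)
Lemma face_selection (E : 'I_p -> seq 'rV[R]_n) :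
  (forall j w, w \in E j -> upper (J j) w) ->
  exists (s : T -> 'rV[R]_n) (v : 'I_p -> 'rV[R]_n) (s0 : 'rV[R]_n) (y : 'rV[K]_n),
  [/\ forall i, 0 < s0 0 i,
      forall j w, w \in E j -> minimizes s0 (upper (J j)) w ->
        forall a, dot (s a) w = dot (s a) (v j),
      forall j w, w \in E j -> ~ minimizes s0 (upper (J j)) w ->
        forall B, \forall a \near U, B < dot (s a) w - dot (s a) (v j),
      forall i, rescale (s a) (x a) 0 i @[a --> U] --> y 0 i
    & (forall i, exists2 w, minimizes s0 (upper JS) w & 0 < w 0 i) /\
      exists2 w, minimizes s0 (upper JS) w & forall i, w 0 i != 0 -> y 0 i != 0].
Proof.
move=> EJ; have [kappa [t' [kappa0 t'P]]] := lowered_weights.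
have /choice[V VP] := fun j => @tight_representatives R n (upper_constraints R (J j)).
pose W j := V j ++ E j.
have WJ j w : w \in W j -> upper (J j) w.
  by rewrite mem_cat => /orP[/(VP j).1//|/EJ].
have t'gt0 : \forall a \near U, forall i, 0 < t' a 0 i.
  apply: filterS t'P => a [h1 h2 _ _ _] i; apply: lt_le_trans (h1 i).
  by rewrite mulr_gt0.
have upper_ex j : @upper R n (J j) !=set0.
  have [c _ cJ] := @upper_axis R n (J j) (@Jpos j).
  by exists (c *: delta_mx 0 (Ordinal n0)).
have repmin j (s : 'rV[R]_n) z : minimizes s (upper (J j)) z -> exists2 w, w \in V j &
    minimizes s (upper (J j)) w /\
    forall s', minimizes s' (upper (J j)) w -> minimizes s' (upper (J j)) z.
  move=> zm; have [w wV wz] := (VP j).2 z zm.1.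
  exists w => //.
  have wm : minimizes s (upper (J j)) w.
    apply: (minimizes_tight zm); first exact: (VP j).1.
    by move=> c cJ /eqP cz; apply/eqP; rewrite wz.
  split=> // s' s'm; apply: (minimizes_tight s'm zm.1) => c cJ /eqP cw.
  by apply/eqP; rewrite -wz.
have exmin j (s : 'rV[R]_n) : (forall i, 0 < s 0 i) -> exists2 w, w \in V j & minimizes
  s (upper (J j)) w.
  move=> s0; have [z zm] := exists_minimizes (upper_ex j) (@upper_orthant _ _ _) s0.
  by have [w wV [wm _]] := repmin j s z zm; exists w.
have /choice[v vP] : forall j, exists v, v \in V j /\ \forall a \near U, minimizes (t'
  a) (upper (J j)) v.
  move=> j; have [|v vV vm] := ultra_finite UF (s := V j) (A := fun v a => minimizes
    (t' a) (upper (J j)) v).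
    by apply: filterS t'gt0 => a; exact: exmin.
  by exists v.
(* Gaps are measured from [v j], which is minimal for almost all points. *)
pose L := flatten [seq [seq w - v j | w <- W j] | j <- enum 'I_p].
have LW j w : w \in W j -> w - v j \in L.
  move=> wW; apply/flattenP; exists [seq w - v j | w <- W j]; last exact: map_f.
  by apply: (map_f (fun j => [seq w - v j | w <- W j])); rewrite mem_enum.
pose bnd z := `[< exists B, \forall a \near U, `|dot (t' a) z| <= B >].
have [|r [r0 rr0 rE]] := bounded_correction UF (t := t') (L := [seq z <- L | bnd z]).
  by move=> z; rewrite mem_filter => /andP[/asboolP].
pose s a := t' a - r a.
have dot_s a z : dot (s a) z = dot (t' a) z - dot (r a) z.
  by rewrite dotC dotBr dotC (dotC z).
have r_cvg z : dot (r a) z @[a --> U] --> dot r0 z.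
  by apply: cvg_sumr => i _; apply: cvgM; [exact: rr0|exact: cvg_cst].
have s_bnd a z : z \in L -> bnd z -> dot (s a) z = 0.
  by move=> zL zb; rewrite dot_s rE ?subrr // mem_filter zb.
have t'_unb z : z \in L -> ~~ bnd z -> forall B, \forall a \near U, B < dot (t' a) z.
  move=> /flattenP[_ /mapP[j _ ->] /mapP[w wW ->]] /asboolP zb B.
  have [//|h] := ultra_bounded_or_pinfty UF (fun a => dot (t' a) (w - v j)).
  apply: filterS2 (h B) (vP j).2 => a hB vm; move: hB; rewrite ger0_norm //.
  by rewrite dotBr subr_ge0; apply: vm.2; exact: WJ.
have s_unb z : z \in L -> ~~ bnd z -> forall B, \forall a \near U, B < dot (s a) z.
  move=> zL zb B.
  have rlt : \forall a \near U, dot (r a) z < dot r0 z + 1.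
    by apply: (cvgr_lt _ (r_cvg z)); rewrite ltrDl.
  apply: filterS2 (t'_unb z zL zb (B + (dot r0 z + 1))) rlt => a h1 h2.
  by rewrite dot_s ltrBrDr; apply: lt_trans h1; rewrite ltrD2l.
pose I1 := [set i | `[< \forall a \near U, i \in supp_pt a /\ t' a 0 i = t a 0 i >]]%SET.
have I1P i : i \notin I1 -> \forall a \near U, ~ (i \in supp_pt a /\ t' a 0 i = t a 0 i).
  rewrite inE => /asboolP h.
  by have [//|] := in_ultra_setVsetC [set a | i \in supp_pt a /\ t' a 0 i = t a 0 i] UF.
have s_gt0 i : \forall a \near U, 0 < s a 0 i.
  have rlt : \forall a \near U, r a 0 i < r0 0 i + 1.
    by apply: (cvgr_lt _ (rr0 i)); rewrite ltrDl.
  have := tau_pinfty ((r0 0 i + 1) / kappa);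
    apply: filterS3 rlt t'P => a h1 [h2 _ _ _ _] h3.
  rewrite !mxE subr_gt0; apply: lt_le_trans (h2 i); apply: lt_trans h1 _.
  by move: h3; rewrite ltr_pdivrMr // mulrC.
(* A single index [a0] provides the weights [s0] that define the face. *)
have [a0 [[A1 A2 A3] [A4 A5 A6]]] : exists a,
    [/\ forall i, i \in enum 'I_n -> 0 < s a 0 i,
        forall z, z \in [seq z <- L | ~~ bnd z] -> 0 < dot (s a) z
      & forall z, z \in [seq z <- L | ~~ bnd z] -> 0 < dot (t' a) z] /\
    [/\ forall i, i \in [seq i <- enum 'I_n | i \notin I1] -> ~ (i \in supp_pt a /\ t'
      a 0 i = t a 0 i),
        forall j, j \in enum 'I_p -> minimizes (t' a) (upper (J j)) (v j)
      & lowers kappa a (t' a)].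
  have B1 : \forall a \near U, forall i, i \in enum 'I_n -> 0 < s a 0 i.
    by apply: near_seq => i _; exact: s_gt0.
  have B2 : \forall a \near U, forall z, z \in [seq z <- L | ~~ bnd z] -> 0 < dot (s a) z.
    by apply: near_seq => z; rewrite mem_filter => /andP[zb zL]; exact: s_unb.
  have B3 : \forall a \near U, forall z, z \in [seq z <- L | ~~ bnd z] -> 0 < dot (t'
    a) z.
    by apply: near_seq => z; rewrite mem_filter => /andP[zb zL]; exact: t'_unb.
  have B4 : \forall a \near U, forall i, i \in [seq i <- enum 'I_n | i \notin I1] ->
      ~ (i \in supp_pt a /\ t' a 0 i = t a 0 i).
    by apply: near_seq => i; rewrite mem_filter => /andP[iI _]; exact: I1P.
  have B5 : \forall a \near U, forall j, j \in enum 'I_p -> minimizes (t' a) (upper (J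
    j)) (v j).
    by apply: near_seq => j _; case: (vP j).
  by have [a [[C1 [C2 C3]] [C4 [C5 C6]]]] := filter_ex (filterI (filterI B1 (filterI B2
    B3))
    (filterI B4 (filterI B5 t'P))); exists a.
pose s0 := s a0.
have s0pos i : 0 < s0 0 i by rewrite A1 ?mem_enum.
have A2' z : z \in L -> ~~ bnd z -> 0 < dot s0 z by move=> zL zb;
  rewrite A2 // mem_filter zb.
have A3' z : z \in L -> ~~ bnd z -> 0 < dot (t' a0) z by move=> zL zb;
  rewrite A3 // mem_filter zb.
have A5' j : minimizes (t' a0) (upper (J j)) (v j) by apply: A5; rewrite mem_enum.
have vW j : v j \in W j by rewrite mem_cat (proj1 (vP j)).
have s0v j : minimizes s0 (upper (J j)) (v j).
  have [w wV wm] := exmin j s0 s0pos; split=> [|z Jz]; first exact: WJ.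
  apply: le_trans (wm.2 z Jz).
  have zL : w - v j \in L by apply: LW; rewrite mem_cat wV.
  rewrite -subr_ge0 -dotBr; have [zb|zb] := boolP (bnd (w - v j)); first by rewrite s_bnd.
  by rewrite ltW // A2'.
(* The bounded gaps are exactly those that vanish for the corrected weights. *)
have claimA j w : w \in W j -> minimizes s0 (upper (J j)) w <-> bnd (w - v j).
  move=> wW; have zL := LW j w wW; split=> [wm|zb].
    apply: contraT => zb; have := A2' _ zL zb; rewrite dotBr subr_gt0.
    by rewrite ltNge wm.2 //; exact: WJ.
  split=> [|z Jz]; first exact: WJ.
  have := s_bnd a0 _ zL zb; rewrite dotBr => /eqP; rewrite subr_eq0 => /eqP->.
  exact: (s0v j).2.
(* The correction does not remove minimizers, so the face stays inner. *)
have claimB w : minimizes (t' a0) (upper JS) w -> minimizes s0 (upper JS) w.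
  rewrite -QE => wm;
    have : [set z | minimizes (t' a0) (Defs.msum (fun j => @upper R n (J j))) z] w by [].
  rewrite minimizes_msum => -[y ym wE].
  have : [set z | minimizes s0 (Defs.msum (fun j => @upper R n (J j))) z] w; last by [].
  rewrite minimizes_msum; exists y => // j.
  have [u uV [um urep]] := repmin j _ _ (ym j); apply: urep.
  have uW : u \in W j by rewrite mem_cat uV.
  apply/(claimA j u uW); apply: contraT => zb; have := A3' _ (LW j u uW) zb.
  by rewrite dotBr subr_gt0 ltNge um.2 //; exact: WJ.
have resc a i : rescale (s a) (x a) 0 i = embK k (expR (- r a 0 i)) * rescale (t' a) (x
  a) 0 i.
  by rewrite !mxE mulrA -embKM -expRD addrC.
have abs_resc a i : absK (rescale (t' a) (x a) 0 i) = expR (t' a 0 i) * absK (x a 0 i).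
  by rewrite mxE absKM absK_emb ger0_norm // expR_ge0.
have expt a i : i \in supp_pt a -> expR (t a 0 i) * absK (x a 0 i) = 1.
  rewrite inE => xi; rewrite mxE expRN lnK ?posrE ?absK_gt0 // mulVf //.
  by rewrite absK_eq0.
have /choice[y' y'P] : forall i, exists l : K, rescale (t' a) (x a) 0 i @[a --> U] --> l.
  move=> i; apply: (ultra_cvg_ground UF (M := 1)); apply: filterS t'P => a [_ _ h _ _].
  rewrite abs_resc; have [xi|xi] := boolP (i \in supp_pt a).
    by rewrite -(expt a i xi) ler_wpM2r ?absK_ge0 // ler_expR h.
  by move: xi; rewrite inE negbK => /eqP->; rewrite absK0 mulr0.
exists s, v, s0, (\row_i (embK k (expR (- r0 0 i)) * y' i)); split=> //.
- move=> j w wE wm a; have wW : w \in W j by rewrite mem_cat wE orbT.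
  have := s_bnd a _ (LW j w wW) ((claimA j w wW).1 wm).
  by rewrite dotBr => /eqP; rewrite subr_eq0 => /eqP.
- move=> j w wE wm B; have wW : w \in W j by rewrite mem_cat wE orbT.
  have zb : ~~ bnd (w - v j) by apply/negP => /(claimA j w wW).
  by apply: filterS (s_unb _ (LW j w wW) zb B) => a; rewrite dotBr.
- move=> i; rewrite mxE; under eq_cvg do rewrite resc.
  apply: cvgM (y'P i); apply: cvg_embK.
  apply: (@continuous_cvg _ _ _ U _ (fun a => - r a 0 i) (@expR R) (- r0 0 i));
    first exact: continuous_expR.
  by apply: cvgN; exact: rr0.
case: A6 => _ _ _ [w wm wsupp] inner; split.
  by move=> i; have [u um ui] := inner i; exists u => //; exact: claimB.
exists w => [|i wi]; first exact: claimB.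
have iI1 : i \in I1.
  apply: contraT => iI; have := A4 i; rewrite mem_filter iI mem_enum => /(_ isT) [].
  exact: wsupp.
move: iI1; rewrite inE => /asboolP h.
rewrite mxE; apply: mulf_neq0; first by rewrite embK_eq0 gt_eqF ?expR_gt0.
apply/eqP => yi.
have /cvgKP/(_ 2^-1) := y'P i; rewrite yi invr_gt0 ltr0n => /(_ isT) hy.
have [a [ha1 [ha2 ha3]]] := filter_ex (filterI hy h).
move: ha1; rewrite sub0r absKN abs_resc ha3 expt // => h1.
have {}h1 : (1 : R) < 2^-1 by []; lra.
Qed.

End Selection.

(** * Passing to the limit *)

Section Limit.
Variables (R : realType) (k : ground) (n p : nat).
Local Notation K := (ground_field R k).
Local Notation N := (rdim k n).

Lemma cvg_absK (T : Type) (F : set_system T) (FF : Filter F) (f : T -> K) (l : K) :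
  f a @[a --> F] --> l -> absK (f a) @[a --> F] --> absK l.
Proof. by move=> fl; apply: cvg_reK; exact: cvg_norm. Qed.

Lemma expRN_cvg0 (T : Type) (F : set_system T) (FF : Filter F) (u : T -> R) :
  (forall B, \forall a \near F, B < u a) -> expR (- u a) @[a --> F] --> (0 : R).
Proof.
move=> h; apply/cvgrPdist_lt => e e0; apply: filterS (h (- ln e)) => a ua.
rewrite sub0r normrN ger0_norm ?expR_ge0 //.
by rewrite -[ltRHS]lnK ?posrE // ltr_expR ltrNl.
Qed.

(** Faces selected by positive forms are among those that the nondegeneracy
    conditions refer to. *)
Lemma minimizers_inner_face (D : 'I_p -> set 'rV[R]_n) (J : 'I_p -> seq 'rV[rat]_n)
    (JS : seq 'rV[rat]_n) (s : 'rV[R]_n) : (0 < n)%N ->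
  (forall j, presents (J j) (D j)) -> presents JS (diagram_sum D) ->
  Defs.msum (fun j => @upper R n (J j)) = upper JS -> (forall i, 0 < s 0 i) ->
  (forall i, exists2 w, minimizes s (upper JS) w & 0 < w 0 i) ->
  inner_face_decomposition D [set x | minimizes s (upper JS) x]
    (fun j => [set x | minimizes s (upper (J j)) x]).
Proof.
move=> n0 JD JSD QE s0 inn; split.
- exact: minimizers_face.
- move=> I /properP[_ [i _ iI]] sub; have [w wm wi] := inn i.
  by have := sub w wm i iI => wi0; rewrite wi0 ltxx in wi.
- by move=> j; exact: minimizers_face.
by rewrite -QE minimizes_msum.
Qed.

Section Sums.
Variables (T : Type) (U : set_system T).
Hypothesis UF : UltraFilter U.
Variables (M : nat) (g : T -> mpoly N K) (G : mpoly N K).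
Hypothesis gG : forall m, mcoeff m (g a) @[a --> U] --> mcoeff m G.
Variables (J : seq 'rV[rat]_n) (s : T -> 'rV[R]_n) (v s0 : 'rV[R]_n).
Hypothesis gJ : forall a m, m \in msupp (g a) -> upper J (exponent R m).
Hypothesis face_eq : forall m : bmultinom N M, upper J (exponent R m) ->
  minimizes s0 (upper J) (exponent R m) -> forall a, dot (s a) (exponent R m) = dot (s
    a) v.
Hypothesis face_infty : forall m : bmultinom N M, upper J (exponent R m) ->
  ~ minimizes s0 (upper J) (exponent R m) ->
  forall B, \forall a \near U, B < dot (s a) (exponent R m) - dot (s a) v.

(** After rescaling, only the monomials on the selected face survive. *)
Lemma rescaled_sum_cvg (e : bmultinom N M -> T -> K) (e0 : bmultinom N M -> K) :
  (forall m, e m a @[a --> U] --> e0 m) ->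
  \sum_(m : bmultinom N M) mcoeff m (g a) *
     (embK k (expR (- (dot (s a) (exponent R m) - dot (s a) v))) * e m a) @[a --> U] -->
  \sum_(m : bmultinom N M) mcoeff m (truncation G [set z | minimizes s0 (upper J) z]) *
    e0 m.
Proof.
move=> ee; apply: cvg_sumr => m _; rewrite mcoeff_truncation.
have [mJ|mJ] := pselect (upper J (exponent R m)); last first.
  rewrite asboolF /=; last by case.
  rewrite mul0r; have h a : mcoeff m (g a) = 0.
    by apply: memN_msupp_eq0; apply/negP => /gJ.
  by under eq_cvg do rewrite h mul0r; exact: cvg_cst.
case: asboolP => /= mm.
  apply: cvgM; first exact: gG.
  by under eq_cvg do rewrite face_eq // subrr oppr0 expR0 embK1 mul1r; exact: ee.
rewrite -(mulr0 (mcoeff m G)) -mulrA mul0r.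
apply: cvgM; first exact: gG.
rewrite -[X in _ --> X](mul0r (e0 m)); apply: cvgM; last exact: ee.
rewrite -(embK0 R k); apply: cvg_embK; apply: expRN_cvg0 => B; exact: face_infty.
Qed.

End Sums.

Variables (J : 'I_p -> seq 'rV[rat]_n) (JS : seq 'rV[rat]_n).
Hypothesis n0 : (0 < n)%N.
Variable D : 'I_p -> set 'rV[R]_n.
Hypothesis JD : forall j, presents (J j) (D j).
Hypothesis JSD : presents JS (diagram_sum D).
Hypothesis QE : Defs.msum (fun j => @upper R n (J j)) = upper JS.
Variables (T : Type) (U : set_system T).
Hypothesis UF : UltraFilter U.
Variable x : T -> 'rV[K]_n.
Hypothesis x_neq0 : forall a, x a != 0.
Hypothesis x_cvg : \sum_i absK (x a 0 i) @[a --> U] --> (0 : R).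
Variables (M : nat) (F : T -> poly_map R k n p) (G : poly_map R k n p).
Hypothesis FM : forall a j, (msize (F a j) <= M)%N.
Hypothesis GM : forall j, (msize (G j) <= M)%N.
Hypothesis FG : forall j m, mcoeff m (F a j) @[a --> U] --> mcoeff m (G j).
Hypothesis FJ : forall a j m, m \in msupp (F a j) -> upper (J j) (exponent R m).
Hypothesis x_sing : forall a, singular_locus (F a) (x a).

(** Covectors that annihilate the differentials at the rescaled points can be
    normalized; their limit is not zero and annihilates the differential of the
    face map at the limit point. *)
Lemma singular_limit : exists Delta Deltas (I : {set 'I_n}) y,
  [/\ inner_face_decomposition D Delta Deltas, I != finset.set0,
      Delta `&` coord_subspace I !=set0 &
    [/\ torus I y, singular_locus (face_map G Deltas) y &
       (forall a, zero_locus (F a) (x a)) -> zero_locus (face_map G Deltas) y]].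
Proof.
pose E j := [seq exponent R (bmnm m) | m <- enum {: bmultinom N M} & `[< @upper R n (J
  j) (exponent R (bmnm m)) >]].
have [JSn JS0 _] := JSD.
have EP j (m : bmultinom N M) : upper (J j) (exponent R m) -> exponent R m \in E j.
  move=> mJ; apply: (map_f (fun m : bmultinom N M => exponent R m)).
  by rewrite mem_filter mem_enum andbT; apply/asboolP.
have EJ j w : w \in E j -> upper (J j) w.
  by case/mapP => m; rewrite mem_filter => /andP[/asboolP mJ _] ->.
have Jpos j l : l \in J j -> positive_form l by case: (JD j) => _ h _; exact: h.
have [s [v [s0 [y [s0pos sE sI ycv [inn [w wm wy]]]]]]] :=
  face_selection n0 Jpos JSn JS0 QE UF x_neq0 x_cvg EJ.
pose Deltas j := [set z | minimizes s0 (upper (J j)) z].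
have sum_cvg j := rescaled_sum_cvg UF (M := M) (g := fun a => F a j) (@FG j) (s := s)
  (v := v j) (s0 := s0)
  (fun a m => @FJ a j m) (fun m mJ => sE j _ (EP j m mJ)) (fun m mJ => sI j _ (EP j m
    mJ)).
pose ya a := rescale (s a) (x a).
have xE a : x a = rescale (- s a) (ya a) by rewrite /ya rescaleK.
have wt (a : T) j m : embK k (expR (dot (s a) (v j))) * embK k (expR (dot (- s a)
  (exponent R m))) =
    embK k (expR (- (dot (s a) (exponent R m) - dot (s a) (v j)))) :> K.
  by rewrite -embKM -expRD (dotC (- s a)) dotNr opprB (dotC (exponent R m)).
have GT j : (msize (truncation (G j) (Deltas j)) <= M)%N.
  exact: leq_trans (msize_truncation _ _) (GM j).
have dcvg j h : embK k (expR (dot (s a) (v j))) * dpoly (F a j) (x a) (rescale (- s a) h)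
    @[a --> U] --> dpoly (face_map G Deltas j) y h.
  rewrite (dpoly_expansion y h (GT j)).
  have /sum_cvg H (m : bmultinom N M) : dpoly (mpolyX K m) (ya a) h @[a --> U] -->
    dpoly (mpolyX K m) y h.
    exact: dpolyX_cvg.
  refine (@cvg_eq_fun T K U _ _ _ _ (H j)) => a.
  rewrite (dpoly_expansion _ _ (FM a j)) mulr_sumr; apply: eq_bigr => m _.
  by rewrite [in RHS]xE dpoly_rescale -wt; ring.
have mcvg j : embK k (expR (dot (s a) (v j))) * meval (formal_point (x a)) (F a j)
    @[a --> U] --> meval (formal_point y) (face_map G Deltas j).
  rewrite (meval_expansion y (GT j)).
  have /sum_cvg H (m : bmultinom N M) : meval (formal_point (ya a)) (mpolyX K m) @[a
    --> U] -->
      meval (formal_point y) (mpolyX K m).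
    exact: mevalX_cvg.
  refine (@cvg_eq_fun T K U _ _ _ _ (H j)) => a.
  rewrite (meval_expansion _ (FM a j)) mulr_sumr; apply: eq_bigr => m _.
  by rewrite [in RHS]xE meval_rescale -wt; ring.
exists [set z | minimizes s0 (upper JS) z], Deltas, [set i | y 0 i != 0]%SET, y; split.
- exact: minimizers_inner_face.
- apply/set0Pn; apply: contrapT => /forallNP ynz.
  have [b b0 bJ] := @upper_mass R n JS JSn JS0.
  have := bJ w wm.1; rewrite big1 => [|i _]; first by rewrite leNgt b0.
  apply/eqP; apply: contraT => /wy yi; case: (ynz i); by rewrite inE.
- exists w; split=> // i; rewrite inE negbK => /eqP yi.
  by apply/eqP; apply: contraT => /wy; rewrite yi eqxx.
split.
- by move=> i; rewrite inE.
- have /choice[al alP] : forall a, exists al : 'rV[K]_p, al != 0 /\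
      forall h, reK (\sum_j al 0 j * dpoly (F a j) (x a) h) = 0.
    by move=> a; have /singularP[al al0 ah] := x_sing a; exists al.
  pose be a j : K := embK k (expR (- dot (s a) (v j))) * al a 0 j.
  pose mu a : R := \sum_j absK (be a j).
  have mu0 a : 0 < mu a.
    have [j alj] : exists j, al a 0 j != 0.
      apply: contrapT => /forallNP h; case/eqP: (alP a).1; apply/rowP => i; rewrite mxE.
      by have /negP := h i; rewrite negbK => /eqP.
    rewrite /mu (bigD1 j) //= ltr_pwDl //.
      by rewrite absK_gt0 /be mulf_neq0 // embK_eq0 gt_eqF ?expR_gt0.
    by apply: sumr_ge0 => l _; exact: absK_ge0.
  pose nu a j : K := embK k (mu a)^-1 * be a j.
  have nu_abs a j : absK (nu a j) = (mu a)^-1 * absK (be a j).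
    by rewrite absKM absK_emb ger0_norm // invr_ge0 ltW.
  have nu_sum a : \sum_j absK (nu a j) = 1.
    under eq_bigr do rewrite nu_abs.
    by rewrite -mulr_sumr mulVf // gt_eqF.
  have /choice[nu0 nuP] : forall j, exists l : K, nu a j @[a --> U] --> l.
    move=> j; apply: (ultra_cvg_ground UF (M := 1)); apply: nearW => a.
    rewrite -(nu_sum a) (bigD1 j) //= lerDl; apply: sumr_ge0 => l _; exact: absK_ge0.
  apply/singularP; exists (\row_j nu0 j).
    apply/eqP => nu00.
    have h1 : \sum_j absK (nu a j) @[a --> U] --> \sum_j absK (nu0 j).
      by apply: cvg_sumr => j _; exact: cvg_absK.
    have h2 : \sum_j absK (nu a j) @[a --> U] --> (1 : R).
      by under eq_cvg do rewrite nu_sum; exact: cvg_cst.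
    have e1 : \sum_j absK (nu0 j) = 1 by exact: norm_cvg_unique h1 h2.
    have /eqP := oner_neq0 R; apply; rewrite -e1; apply: big1 => j _.
    by have := congr1 (fun A : 'rV_p => A 0 j) nu00; rewrite !mxE => ->; rewrite absK0.
  move=> h; have h1 : reK (\sum_j nu a j * (embK k (expR (dot (s a) (v j))) *
      dpoly (F a j) (x a) (rescale (- s a) h))) @[a --> U] -->
      reK (\sum_j nu0 j * dpoly (face_map G Deltas j) y h).
    by apply: cvg_reK; apply: cvg_sumr => j _; apply: cvgM.
  have h2 : reK (\sum_j nu a j * (embK k (expR (dot (s a) (v j))) *
      dpoly (F a j) (x a) (rescale (- s a) h))) @[a --> U] --> (0 : R).
    refine (@cvg_eq_fun T _ U _ _ _ _ (cvg_cst _)) => a.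
    rewrite -[LHS](mulr0 (mu a)^-1) -((alP a).2 (rescale (- s a) h)) -reK_embM mulr_sumr.
    congr reK; apply: eq_bigr => j _; rewrite /nu /be.
    have ee : embK k (expR (- dot (s a) (v j))) * embK k (expR (dot (s a) (v j))) = 1
      :> K.
      by rewrite -embKM -expRD addNr expR0 embK1.
    by rewrite -[in LHS](mul1r (al a 0 j)) -ee; ring.
  by under eq_bigr do rewrite mxE; exact: norm_cvg_unique h1 h2.
move=> Fz; apply/rowP => j; rewrite !mxE.
have h2 : embK k (expR (dot (s a) (v j))) * meval (formal_point (x a)) (F a j)
    @[a --> U] --> (0 : K).
  refine (@cvg_eq_fun T _ U _ _ _ _ (cvg_cst _)) => a.
  by have := congr1 (fun A : 'rV_p => A 0 j) (Fz a); rewrite !mxE => ->; rewrite mulr0.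
exact: (norm_cvg_unique (mcvg j) h2).
Qed.

End Limit.

(** * Deformations *)

Section Deformation.
Variables (R : realType) (k : ground) (n p : nat).
Local Notation K := (ground_field R k).
Local Notation N := (rdim k n).
Variables (f : poly_map R k n p) (F : K -> poly_map R k n p).
Variables (D : 'I_p -> set 'rV[R]_n) (P : 'I_p -> set 'rV[rat]_n).
Hypothesis Fdef : deformation f F.
Hypothesis DC : forall j, Cface_diagram (D j).
Hypothesis DP : forall j, weight_system (D j) (P j).
Hypothesis Fdeg : forall j eps w, P j w ->
  (wdeg w (D j) <= wdeg w (supp (F eps j - f j)%R))%E.
Hypothesis fdeg : forall j w, P j w -> (wdeg w (D j) <= wdeg w (supp (f j)))%E.

(** Every single map has finite degree, and analyticity makes the bound
    independent of the parameter. *)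
Lemma deformation_msize : exists M, forall eps j, (msize (F eps j) <= M)%N.
Proof.
have [_ _ Fan] := Fdef.
have [||M MP] := @uniform_vanishing_ground R k ('I_p * multinom N)%type
    (fun jm => mdeg jm.2) (fun jm eps => mcoeff jm.2 (F eps jm.1)).
- by move=> [j m]; exact: Fan.
- move=> eps; exists (\max_j msize (F eps j))%N => -[j m] /= h.
  apply: memN_msupp_eq0; apply: msize_mdeg_ge.
  by apply: leq_trans (ltnW h); exact: (leq_bigmax j).
exists M.+1 => eps j; rewrite msizeE; apply/bigmax_leqP_seq => m mF _.
rewrite ltnS leqNgt; apply/negP => /(MP (j, m)) /(_ eps) /= h.
by move: mF; rewrite mcoeff_msupp h eqxx.
Qed.

Lemma wdeg_supp (g : mpoly N K) w m : m \in msupp g ->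
  (wdeg w (supp g) <= (pairing w (exponent R m))%:E)%E.
Proof. by move=> mg; apply: ereal_inf_lbound; exists (exponent R m) => //; exists m. Qed.

Section Contradiction.
(** Tells whether only the singular points that are zeros matter. *)
Variable weak : bool.
Hypothesis nondeg : forall Delta Deltas (I : {set 'I_n}),
  inner_face_decomposition D Delta Deltas -> I != finset.set0 ->
  Delta `&` coord_subspace I !=set0 ->
  forall y, singular_locus (face_map f Deltas) y ->
    (weak -> zero_locus (face_map f Deltas) y) -> torus I y -> False.

(** The limit parameter matters only through the coefficients on the diagrams,
    and these are the coefficients of [f]. *)
Lemma no_singular_sequence (eps : nat -> K) (x : nat -> 'rV[K]_n) (U : set_system nat)
    (eps0 : K) : UltraFilter U -> eventually `<=` U ->
  (forall a, x a != 0) -> (forall a, euclidean_ball (a.+1%:R^-1 : R) (x a)) ->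
  (forall a, singular_locus (F (eps a)) (x a)) ->
  (forall a, weak -> zero_locus (F (eps a)) (x a)) ->
  eps a @[a --> U] --> eps0 ->
  (forall j m, D j (exponent R m) -> mcoeff m (F eps0 j) = mcoeff m (f j)) -> False.
Proof.
move=> UF evU x_neq0 x_ball x_sing x_zero epscv FfE.
have [F0 _ Fan] := Fdef.
have n0 : (0 < n)%N.
  rewrite lt0n; apply/negP => /eqP n0; case/eqP: (x_neq0 0%N).
  by apply/rowP => -[i ilt]; exfalso; rewrite n0 in ilt.
have p0 : (0 < p)%N.
  rewrite lt0n; apply/negP => /eqP p0; have := x_sing 0%N; rewrite /singular_locus /=.
  by rewrite [X in (_ < X)%N](_ : _ = 0%N) //; rewrite /rdim p0; case: (k).
have [J JD] := choice DC.
have [JS JSD QE] := diagram_sum_presents p0 n0 JD.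
have [M FM] := deformation_msize.
have FJ e j m : m \in msupp (F e j) -> upper (J j) (exponent R m).
  move=> mF; apply: (upper_of_degrees n0 (JD j) (DP j)); first exact: exponent_ge0.
  move=> w Pw; have [mf|mf] := boolP (m \in msupp (f j)).
    by apply: le_trans (fdeg Pw) _; exact: wdeg_supp.
  apply: le_trans (Fdeg e Pw) _; apply: wdeg_supp.
  by rewrite mcoeff_msupp mcoeffB (memN_msupp_eq0 mf) subr0 -mcoeff_msupp.
have inv0 : (fun a : nat => a.+1%:R^-1 : R) @ U --> (0 : R).
  by move=> B /cvg_harmonic; exact: evU.
have xi_cvg i : absK (x a 0 i) @[a --> U] --> (0 : R).
  apply: (squeeze_cvgr _ (cvg_cst (0 : R)) inv0); apply: nearW => a.
  rewrite absK_ge0 /=; have := x_ball a; rewrite /euclidean_ball /= to_real_sqr.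
  rewrite (bigD1 i) //= => h.
  rewrite -(@ler_pXn2r _ 2) ?nnegrE ?absK_ge0 ?invr_ge0 //; apply: ltW;
    apply: le_lt_trans h.
  by rewrite lerDl sumr_ge0 // => l _; rewrite sqr_ge0.
have x_cvg : \sum_i absK (x a 0 i) @[a --> U] --> (0 : R).
  have e0 : \sum_(i < n) (0 : R) = 0 by rewrite big1.
  have h : \sum_i absK (x a 0 i) @[a --> U] --> \sum_(i < n) (0 : R).
    by apply: cvg_sumr => i _; exact: xi_cvg.
  by rewrite e0 in h.
have FG j m : mcoeff m (F (eps a) j) @[a --> U] --> mcoeff m (F eps0 j).
  exact: (@continuous_cvg nat K K U _ eps (fun e => mcoeff m (F e j)) eps0
    (real_analytic_cvg (Fan j m) (x := eps0)) epscv).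
have [Delta [Deltas [I [y [dec In DI [yI ysing yzero]]]]]] :=
  singular_limit n0 JD JSD QE UF x_neq0 x_cvg (fun a => FM (eps a)) (FM eps0) FG
    (fun a => @FJ (eps a)) x_sing.
have faceE : face_map (F eps0) Deltas = face_map f Deltas.
  apply/funext => j; apply/mpolyP => m; rewrite !mcoeff_truncation.
  case: asboolP => // mD; apply: FfE.
  have [_ _ /(_ j) [J1 [I1 [J2 [_ _ _ _ DE]]]] _] := dec.
  by move: mD; rewrite DE => -[].
apply: (nondeg dec In DI _ _ yI); first by rewrite -faceE.
by move=> w; rewrite -faceE; apply: yzero => a; exact: x_zero.
Qed.

Definition vanishing_part (G : poly_map R k n p) : set 'rV[K]_n :=
  if weak then zero_locus G else setT.

(** If all radii [1 / (a + 1)] fail, choosing a counterexample for each of them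
    gives a sequence to which the previous lemma applies. *)
Lemma no_singular_points_along (S : nat -> set K) :
  (forall (U : set_system nat) (eps : nat -> K), UltraFilter U -> eventually `<=` U ->
    (forall a, S a (eps a)) -> exists2 eps0 : K, eps a @[a --> U] --> eps0 &
    forall j m, D j (exponent R m) -> mcoeff m (F eps0 j) = mcoeff m (f j)) ->
  exists a, forall eps, S a eps ->
    singular_locus (F eps) `&` vanishing_part (F eps) `&`
      @euclidean_ball R k n a.+1%:R^-1 `<=` [set 0].
Proof.
move=> SP; apply: contrapT => /forallNP no.
have /choice[ex exP] : forall a, exists ex : K * 'rV[K]_n, [/\ S a ex.1, ex.2 != 0,
    @euclidean_ball R k n a.+1%:R^-1 ex.2, singular_locus (F ex.1) ex.2 &
    vanishing_part (F ex.1) ex.2].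
  move=> a; have /existsNP[e /not_implyP[Se /existsNP[x /not_implyP[[[h1 h2] h3] x0]]]]
    := no a.
  by exists (e, x); split=> //; apply/eqP.
have [U [UF evU]] := ultraFilterLemma eventually_filter.
have [|eps0 epscv epsE] := SP U (fun a => (ex a).1) UF evU.
  by move=> a; case: (exP a).
apply: (no_singular_sequence (eps := fun a => (ex a).1) (x := fun a => (ex a).2) UF evU
  _ _ _ _ epscv epsE) => a; case: (exP a) => //.
by rewrite /vanishing_part => _ _ _ _ + w; rewrite w.
Qed.

End Contradiction.

(** Under strict inequalities no exponent of the perturbation lies on the
    diagram. *)
Lemma strict_degrees_coef :
  (forall j eps w, P j w -> (wdeg w (D j) < wdeg w (supp (F eps j - f j)%R))%E) ->
  forall eps j m, D j (exponent R m) -> mcoeff m (F eps j) = mcoeff m (f j).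
Proof.
move=> strict eps j m mD; have [J JD] := DC j.
have n0 : (0 < n)%N.
  rewrite lt0n; apply/negP => /eqP n0; case: JD mD => _ _ -> [_ _ [l _]].
  rewrite /pairing /dot big1 => [/esym/eqP|[i ilt] _]; first by rewrite oner_eq0.
  by exfalso; rewrite n0 in ilt.
apply/eqP; rewrite -subr_eq0 -mcoeffB -[_ == _]negbK -mcoeff_msupp; apply/negP => mF.
apply: (notin_diagram_of_degrees n0 JD (@DP j) _ _ mD) => [|w Pw];
  first exact: exponent_ge0.
exact: lt_le_trans (strict j eps w Pw) (wdeg_supp _ mF).
Qed.

End Deformation.

Section Balls.
Variables (R : realType) (k : ground).
Local Notation K := (ground_field R k).

Lemma connected_absK_ball (e : R) : 0 < e -> connected [set z : K | absK z < e].
Proof.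
move=> e0; have -> : [set z : K | absK z < e] =
    \bigcup_(z in [set z : K | absK z < e]) ((fun t : R => embK k t * z) @` `[0, 1]).
  apply/seteqP; split=> z /=.
    by move=> ze; exists z => //; exists 1;
      rewrite /= ?in_itv /= ?ler01 ?lexx // embK1 mul1r.
  move=> [w we [t]]; rewrite /= in_itv /= => /andP[t0 t1] <-.
  by rewrite absKM absK_emb ger0_norm //; apply: le_lt_trans we;
    rewrite ler_piMl ?absK_ge0.
apply: bigcup_connected.
  by exists 0 => z _; exists 0; rewrite /= ?in_itv /= ?ler01 ?lexx // embK0 mul0r.
move=> z _; apply: connected_continuous_connected; first exact: segment_connected.
apply: continuous_subspaceT => t; apply: (@cvgM K _ (nbhs t)); last exact: cvg_cst.
by apply: (@cvg_embK R k _ (nbhs t)); exact: cvg_id.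
Qed.

Lemma nbhs_absK_ball (e : R) : 0 < e -> nbhs (0 : K) [set z : K | absK z < e].
Proof.
move=> e0; have h : \forall z \near (0 : K), absK (0 - z) < e.
  by apply: (@cvgKP R k _ (nbhs (0 : K)) _ id 0).1 e0; exact: cvg_id.
by apply: filterS h => z /=; rewrite sub0r absKN.
Qed.

End Balls.

Theorem theorem3p3 (R : realType) (k : ground) (n p : nat)
    (f : poly_map R k n p) (F : ground_field R k -> poly_map R k n p)
    (D : 'I_p -> set 'rV[R]_n) (P : 'I_p -> set 'rV[rat]_n) :
  peval f 0 = 0 ->
  deformation f F ->
  (forall j, Cface_diagram (D j)) ->
  (forall j, weight_system (D j) (P j)) ->
  (forall j eps w, P j w ->
     (wdeg w (D j) <= wdeg w (supp (F eps j - f j)%R))%E) ->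
  (IKND f D P ->
     (exists T : set (ground_field R k), nbhs 0 T /\ weak_no_coalescing_along F T) /\
     ((forall j eps w, P j w ->
         (wdeg w (D j) < wdeg w (supp (F eps j - f j)%R))%E) ->
      weak_no_coalescing F)) /\
  (SIKND f D P ->
     (exists T : set (ground_field R k), nbhs 0 T /\ no_coalescing_along F T) /\
     ((forall j eps w, P j w ->
         (wdeg w (D j) < wdeg w (supp (F eps j - f j)%R))%E) ->
      no_coalescing F)).
Proof.
move=> _ Fdef DC DP Fdeg; have [F0 _ _] := Fdef.
have inv_gt0 a : 0 < (a.+1%:R^-1 : R) by rewrite invr_gt0 ltr0n.
pose S a : set (ground_field R k) := [set z | absK z < a.+1%:R^-1].
have S_lim (U : set_system nat) (eps : nat -> ground_field R k) : UltraFilter U ->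
    eventually `<=` U -> (forall a, S a (eps a)) ->
    exists2 eps0 : ground_field R k, eps a @[a --> U] --> eps0 &
    forall j m, D j (exponent R m) -> mcoeff m (F eps0 j) = mcoeff m (f j).
  move=> UF evU epsS; exists 0; last by rewrite F0.
  apply/cvgKP => e e0.
  have inv0 : (fun a : nat => a.+1%:R^-1 : R) @ U --> (0 : R).
    by move=> B /cvg_harmonic; exact: evU.
  apply: filterS (cvgr_lt _ inv0 e e0) => a; rewrite sub0r absKN.
  exact: lt_trans (epsS a).
have T_lim (T : set (ground_field R k)) : compact T ->
    (forall j eps w, P j w -> (wdeg w (D j) < wdeg w (supp (F eps j - f j)%R))%E) ->
    forall (U : set_system nat) (eps : nat -> ground_field R k), UltraFilter U ->
    eventually `<=` U -> (forall a : nat, T (eps a)) ->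
    exists2 eps0 : ground_field R k, eps a @[a --> U] --> eps0 &
    forall j m, D j (exponent R m) -> mcoeff m (F eps0 j) = mcoeff m (f j).
  rewrite compact_ultra => cT strict U eps UF evU epsT.
  have [|eps0 [_ epscv]] := cT (eps @ U) (ultra_app UF eps).
    by apply: nearW => a; exact: epsT.
  by exists eps0 => //; exact: (strict_degrees_coef DC DP strict).
split=> [[fdeg ND]|[[fdeg _] ND]].
- have nondeg : forall Delta Deltas (I : {set 'I_n}),
      inner_face_decomposition D Delta Deltas -> I != finset.set0 ->
      Delta `&` coord_subspace I !=set0 ->
      forall y, singular_locus (face_map f Deltas) y ->
      (true -> zero_locus (face_map f Deltas) y) -> torus I y -> False.
    move=> Delta Deltas I dec In DI y ys yz yI; have := ND _ _ _ dec In DI.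
    by move/seteqP => [/(_ y) h _]; apply: h; split=> //; split=> //; exact: yz.
  have along := no_singular_points_along Fdef DC DP Fdeg fdeg nondeg.
  split=> [|strict T cT connT T0].
    have [a aP] := along S S_lim; exists (S a); split; first exact: nbhs_absK_ball.
    split; [exact: connected_absK_ball|by rewrite /S /= absK0|].
    by exists a.+1%:R^-1.
  have [a aP] := along (fun=> T) (T_lim T cT strict); split=> //.
  by exists a.+1%:R^-1.
have nondeg : forall Delta Deltas (I : {set 'I_n}),
    inner_face_decomposition D Delta Deltas -> I != finset.set0 ->
    Delta `&` coord_subspace I !=set0 ->
    forall y, singular_locus (face_map f Deltas) y ->
    (false -> zero_locus (face_map f Deltas) y) -> torus I y -> False.
  move=> Delta Deltas I dec In DI y ys _ yI; have := ND _ _ _ dec In DI.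
  by move/seteqP => [/(_ y) h _]; apply: h; split.
have along := no_singular_points_along Fdef DC DP Fdeg fdeg nondeg.
split=> [|strict T cT connT T0].
  have [a aP] := along S S_lim; exists (S a); split; first exact: nbhs_absK_ball.
  split; [exact: connected_absK_ball|by rewrite /S /= absK0|].
  by exists a.+1%:R^-1 => // eps epsS x [xs xb]; apply: (aP eps epsS); split=> //; split.
have [a aP] := along (fun=> T) (T_lim T cT strict); split=> //.
by exists a.+1%:R^-1 => // eps epsT x [xs xb]; apply: (aP eps epsT); split=> //; split.
Qed.
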